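(* Assume that $\Lambda(\kappa)=\kappa_-/\kappa_+\ge\Lambda_1$. If the heat source $\mathcal H\in H^{-1}(\varpi,\Omega)$ satisfies $$\|\mathcal H\|_{H^{-1}(\varpi,\Omega)}\le\frac{\gamma\tilde S}{4},$$ then, for every $h>0$, there is a triple $(\mathsf u_h,\mathsf p_h,\mathsf T_h)\in\mathbf X_h\times M_h\times W_h$ such that for all $\mathbf v_h\in\mathbf X_h$, $q_h\in M_h$, $r_h\in W_h$ $$\int_\Omega\big(\nu(\mathsf T_h)\nabla\mathsf u_h:\nabla\mathbf v_h+(\mathsf u_h\cdot\nabla\mathsf u_h)\cdot\mathbf v_h+\tfrac12\mathrm{div}\,\mathsf u_h\,\mathsf u_h\cdot\mathbf v_h-\mathsf p_h\,\mathrm{div}\,\mathbf v_h-\mathsf T_h\mathbf g\cdot\mathbf v_h\big)\,dx=0,$$ $$\int_\Omega q_h\,\mathrm{div}\,\mathsf u_h\,dx=0,\qquad\int_\Omega\big(\kappa(\mathsf T_h)\nabla\mathsf T_h\cdot\nabla r_h-\mathsf T_h\mathsf u_h\cdot\nabla r_h\big)\,dx=\langle\mathcal H,r_h\rangle .$$ Moreover, $\mathsf u_h\in\mathfrak B^h_{\mathbf u}$ and $\mathsf T_h\in\mathfrak B^h_T$.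
   Context: Let $d\in\{2,3\}$ and let $\Omega\subset\mathbb R^d$ be a bounded polytope with Lipschitz boundary. A weight is a nonnegative locally integrable function on $\mathbb R^d$; $\varpi\in A_2$ if $\sup_B(\frac1{|B|}\int_B\varpi)(\frac1{|B|}\int_B\varpi^{-1})<\infty$ and $\varpi\in A_1$ if $\sup_B(\frac1{|B|}\int_B\varpi)\sup_{x\in B}\varpi(x)^{-1}<\infty$ (suprema over balls $B\subset\mathbb R^d$). $L^2(\varpi,\Omega)$ has norm $(\int_\Omega|f|^2\varpi\,dx)^{1/2}$; $H^1_0(\varpi,\Omega)$ is the corresponding weighted Sobolev space with zero trace (closure of $C_0^\infty(\Omega)$), normed by $\|\nabla\cdot\|_{\mathbf L^2(\varpi,\Omega)}$; $H^{-1}(\varpi,\Omega):=H^1_0(\varpi^{-1},\Omega)'$ with duality pairing $\langle\cdot,\cdot\rangle$. Bold letters denote $\mathbb R^d$-valued spaces; $L^2_0(\Omega)$ is the space of zero-mean $L^2$ functions. Standing assumptions. Weight: $\varpi\in A_2$, $\varpi^{-1}\in A_1$; there are an open $\mathcal G\subset\Omega$ and $\varepsilon,\varpi_l>0$ with $\{x\in\Omega:\mathrm{dist}(x,\partial\Omega)<\varepsilon\}\subset\mathcal G$, $\varpi\in C(\overline{\mathcal G})$, $\varpi\ge\varpi_l$ on $\overline{\mathcal G}$; and $\mathbf S_{\mathrm{sing}}(\varpi)\Subset\Omega$, where $\mathbf S_{\mathrm{sing}}(\varpi)$ is the set of $x_0\in\mathbb R^d$ with $\inf_{Q\ni x_0}\varpi(Q)/|Q|=0$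 or $\sup_{Q\ni x_0}\varpi(Q)/|Q|=\infty$, $Q$ ranging over dyadic cubes of side $2^{-j}$, $j\in\mathbb N_0$. Gravity: $\mathbf g\in\mathbb R^d$ constant, $g=|\mathbf g|$. Coefficients: $\nu,\kappa\in C^{0,1}(\mathbb R)$ with $0<\nu_-\le\nu(t)\le\nu_+$ and $0<\kappa_-\le\kappa(t)\le\kappa_+$ for all $t\in\mathbb R$. Discrete spaces. For each $h>0$ we have finite dimensional spaces $W_h\subset H^1_0(\varpi,\Omega)\cap H^1_0(\varpi^{-1},\Omega)$, $\mathbf X_h\subset\mathbf H^1_0(\Omega)$, $M_h\subset L^2_0(\Omega)$ that are dense in the limit $h\to0$. There are $\beta,\gamma>0$ such that for all $h>0$ $$\beta\|q_h\|_{L^2(\Omega)}\le\sup_{\mathbf v_h\in\mathbf X_h}\frac{\int_\Omega\mathrm{div}\,\mathbf v_h\,q_h\,dx}{\|\nabla\mathbf v_h\|_{\mathbf L^2(\Omega)}}\ \ \forall q_h\in M_h,\qquad \gamma\|\nabla r_h\|_{\mathbf L^2(\varpi^{\pm1},\Omega)}\le\sup_{\theta_h\in W_h}\frac{\int_\Omega\nabla r_h\cdot\nabla\theta_h\,dx}{\|\nabla\theta_h\|_{\mathbf L^2(\varpi^{\mp1},\Omega)}}\ \ \forall r_h\in W_h .$$ There is an operator $\pi_W:H^1_0(\varpi^{-1},\Omega)\to W_h$ with $\|\nabla\pi_Wr\|_{\mathbf L^2(\varpi^{-1},\Omega)}\lesssim\|\nabla r\|_{\mathbf L^2(\varpi^{-1},\Omega)}$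 (constant independent of $h$ and $r$) and $\|\nabla(\pi_Wr-r)\|_{\mathbf L^2(\varpi^{-1},\Omega)}\to0$ as $h\to0$, for all $r\in H^1_0(\varpi^{-1},\Omega)$. Constants. $C_{e,1},C_{e,2}$ depend only on $\Omega,\varpi$ and are such that $|\int_\Omega\theta\mathbf g\cdot\mathbf v\,dx|\le C_{e,1}\|\mathbf g\|_{\mathbf L^\infty(\Omega)}\|\nabla\theta\|_{\mathbf L^2(\varpi,\Omega)}\|\nabla\mathbf v\|_{\mathbf L^2(\Omega)}$ and $|\int_\Omega\theta\mathbf v\cdot\nabla r\,dx|\le C_{e,2}\|\nabla\mathbf v\|_{\mathbf L^2(\Omega)}\|\nabla\theta\|_{\mathbf L^2(\varpi,\Omega)}\|\nabla r\|_{\mathbf L^2(\varpi^{-1},\Omega)}$ for all $\theta\in H^1_0(\varpi,\Omega)$, $\mathbf v\in\mathbf H^1_0(\Omega)$, $r\in H^1_0(\varpi^{-1},\Omega)$. $\Lambda_0$ is a constant depending only on $\Omega,\varpi$ such that, for $\varkappa\in L^\infty(\Omega)$ with $0<\varkappa_-\le\varkappa\le\varkappa_+$ and $\varkappa_-/\varkappa_+\ge\Lambda_0$, the problem of finding $T\in H^1_0(\varpi,\Omega)$ with $\int_\Omega\varkappa\nabla T\cdot\nabla r\,dx=\langle\mathcal F,r\rangle$ for all $r\in H^1_0(\varpi^{-1},\Omega)$ is well posed for every $\mathcal F\in H^{-1}(\varpi,\Omega)$. $\Lambda_1:=\max\{\Lambda_0,\,1-\gamma(1-\frac1{2\kappa_+})\}$.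 $C_P$ is the constant, depending only on $\Omega$ and $d$, in the smallness condition $C_PC_{e,1}g\|\nabla\theta\|_{\mathbf L^2(\varpi,\Omega)}<\nu_-^2$ that guarantees uniqueness for the stationary Navier–Stokes problem with viscosity $\nu(\theta)$ and forcing $\theta\mathbf g$ (the same constant is used for the discrete problem with skew-symmetrized convection). Sets (with $g\ne0$): $\mathfrak B_{\mathbf u}^h=\{\mathbf u_h\in\mathbf X_h:\|\nabla\mathbf u_h\|_{\mathbf L^2(\Omega)}\le\tilde G\}$, $\tilde G=\frac{\gamma}{4C_{e,2}}$; $\mathfrak B_T^h=\{\theta_h\in W_h:\|\nabla\theta_h\|_{\mathbf L^2(\varpi,\Omega)}\le\tilde S\}$, $\tilde S=\frac{\nu_-}{gC_{e,1}}\min\{\frac{\nu_-}{C_P},\frac{\gamma}{4C_{e,2}}\}$. *)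

(* Defs.v *)
From HB Require Import structures.
From mathcomp Require Import all_boot all_order all_algebra.
From mathcomp Require Import all_classical all_reals all_analysis.
From mathcomp Require Import ess_sup_inf.
Set Implicit Arguments.
Unset Strict Implicit.
Unset Printing Implicit Defensive.
Import Order.TTheory GRing.Theory Num.Theory.
Import numFieldNormedType.Exports.
Local Open Scope classical_set_scope.
Local Open Scope ring_scope.

Section RowMeasurable.
Context (R : realType) (n : nat).

Let coord : 'I_n -> 'rV[R]_n -> measurableTypeR R := fun i x => x 0 i.

Let row_set0 : g_sigma_preimage coord set0.
Proof. exact: sigma_algebra0. Qed.

Let row_setC A : g_sigma_preimage coord A -> g_sigma_preimage coord (~` A).
Proof. exact: sigma_algebraC. Qed.

Let row_bigcup (F : _^nat) : (forall i, g_sigma_preimage coord (F i)) ->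
  g_sigma_preimage coord (\bigcup_i (F i)).
Proof. exact: sigma_algebra_bigcup. Qed.

(* This is the Borel sigma-algebra of R^n, generated by the coordinate maps. *)
HB.instance Definition _ := @isMeasurable.Build default_measure_display
  'rV[R]_n (g_sigma_preimage coord) row_set0 row_setC row_bigcup.

End RowMeasurable.

Section RowMeasurableFun.
Context (R : realType).

Lemma measurable_coord n (i : 'I_n) :
  measurable_fun [set: 'rV[R]_n] (fun x : 'rV[R]_n => x 0 i : measurableTypeR R).
Proof.
move=> _ Y mY; rewrite setTI; apply: sub_sigma_algebra => /=.
rewrite -bigcup_seq/=; exists i => /=; first by rewrite mem_index_enum.
by exists Y => //; rewrite setTI.
Qed.

Lemma measurable_fun_row d (T : measurableType d) n (f : T -> 'rV[R]_n) :
  (forall i, measurable_fun [set: T] (fun t => f t 0 i : measurableTypeR R)) ->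
  measurable_fun [set: T] f.
Proof.
move=> mf; pose g i t := f t 0 i : measurableTypeR R.
suff H : @g_sigma_preimage _ (measurableTypeR R) _ _ g `<=` measurable.
  move=> _ A mA; rewrite setTI; apply: H.
  rewrite -[g]/(fun i => (fun x : 'rV[R]_n => x 0 i : measurableTypeR R) \o f).
  by rewrite g_sigma_preimage_comp; exists A => //; rewrite setTI.
apply: smallest_sub; first exact: sigma_algebra_measurable.
rewrite -bigcup_seq; apply: bigcup_sub => i _ A [B mB <-].
exact: mf.
Qed.

Definition row_cons n (p : measurableTypeR R * 'rV[R]_n) : 'rV[R]_n.+1 :=
  \row_i (if unlift ord0 i is Some j then p.2 0 j else p.1).

Definition row_uncons n (x : 'rV[R]_n.+1) : measurableTypeR R * 'rV[R]_n :=
  (x 0 ord0, \row_j x 0 (lift ord0 j)).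

Lemma row_consK n : cancel (@row_cons n) (@row_uncons n).
Proof.
move=> [a v]; rewrite /row_uncons /row_cons mxE unlift_none /=; congr pair.
by apply/rowP => j; rewrite !mxE liftK.
Qed.

Lemma measurable_row_cons n : measurable_fun setT (@row_cons n).
Proof.
apply: measurable_fun_row => i; rewrite /row_cons.
case: (unliftP ord0 i) => [j ij|i0].
- rewrite (_ : (fun _ => _) = (fun v : 'rV[R]_n => v 0 j : measurableTypeR R) \o snd).
    by apply: measurableT_comp => //; exact: measurable_coord.
  by apply/funext => p /=; rewrite mxE ij liftK.
- rewrite (_ : (fun _ => _) = fst) //.
  by apply/funext => p /=; rewrite mxE i0 unlift_none.
Qed.

Lemma measurable_row_uncons n : measurable_fun setT (@row_uncons n).
Proof.
apply/measurable_fun_pairP; split; first exact: measurable_coord.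
apply: measurable_fun_row => i.
rewrite (_ : (fun _ => _) = (fun x : 'rV[R]_n.+1 => x 0 (lift ord0 i) : measurableTypeR R)).
  exact: measurable_coord.
by apply/funext => x /=; rewrite mxE.
Qed.

Section step.
Context n (m : {sigma_finite_measure set 'rV[R]_n -> \bar R}).

Definition lebesgue_step : set 'rV[R]_n.+1 -> \bar R :=
  pushforward (lebesgue_measure \x m)%E (@row_cons n).

Let step0 : lebesgue_step set0 = 0%E.
Proof. by rewrite /lebesgue_step /pushforward preimage_set0 measure0. Qed.
Let step_ge0 A : (0 <= lebesgue_step A)%E.
Proof. exact: (measure_ge0 (lebesgue_measure \x m)%E). Qed.
Let step_sigma : semi_sigma_additive lebesgue_step.
Proof.
have mc A : measurable A -> measurable (@row_cons n @^-1` A).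
  by move=> mA; rewrite -[X in measurable X]setTI; exact: measurable_row_cons.
move=> F mF tF mUF; rewrite /lebesgue_step /pushforward preimage_bigcup.
apply: measure_semi_sigma_additive.
- by move=> k; exact: mc.
- apply/trivIsetP => /= i j _ _ ij; rewrite -preimage_setI.
  by move/trivIsetP : tF => /(_ _ _ _ _ ij) ->//; rewrite preimage_set0.
- by rewrite -preimage_bigcup; exact: mc.
Qed.

HB.instance Definition _ :=
  isMeasure.Build _ _ _ lebesgue_step step0 step_ge0 step_sigma.

Let step_sigma_finite : sigma_finite setT lebesgue_step.
Proof.
have /sigma_finiteP[F [FT ndF Foo]] := sigma_finiteT (@lebesgue_measure R).
have /sigma_finiteP[G [GT ndG Goo]] := sigma_finiteT m.
have mU k : measurable (@row_uncons n @^-1` (F k `*` G k)).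
  rewrite -[X in measurable X]setTI; apply: measurable_row_uncons => //.
  by apply: measurableX; [have [] := Foo k|have [] := Goo k].
exists (fun k => @row_uncons n @^-1` (F k `*` G k)).
  apply/esym; rewrite -subTset => x _.
  have : [set: measurableTypeR R] (row_uncons x).1 by [].
  rewrite FT => -[i _ Fi].
  have : [set: 'rV[R]_n] (row_uncons x).2 by [].
  rewrite GT => -[j _ Gj]; exists (maxn i j) => //; split.
    by move: Fi; exact/subsetPset/ndF/leq_maxl.
  by move: Gj; exact/subsetPset/ndG/leq_maxr.
move=> k; split; first exact: mU.
have [mF Fk] := Foo k; have [mG Gk] := Goo k.
rewrite /lebesgue_step /pushforward -comp_preimage (_ : _ \o _ = id); last first.
  by apply/funext => p; exact: row_consK.
by rewrite preimage_id product_measure1E// lte_mul_pinfty// ge0_fin_numE.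
Qed.

HB.instance Definition _ :=
  Measure_isSigmaFinite.Build _ _ _ lebesgue_step step_sigma_finite.

End step.

(* d-dimensional Lebesgue measure as the iterated product measure, carried to
   row vectors by row_cons; the product over no factor is the unit mass. *)
Fixpoint lebesgue_row n : {sigma_finite_measure set 'rV[R]_n -> \bar R} :=
  if n is n'.+1 then lebesgue_step (lebesgue_row n') else \d_(0 : 'rV[R]_0).

Lemma lebesgue_row_box n (A : 'I_n -> set (measurableTypeR R)) :
  (forall i, measurable (A i)) ->
  (lebesgue_row n [set x : 'rV[R]_n | forall i, A i (x 0%R i)] =
   \prod_i lebesgue_measure (A i))%E.
Proof.
elim: n A => [|n IHn] A mA; first by rewrite big_ord0 /= diracE mem_set// => -[].
rewrite big_ord_recl -IHn; last by move=> i; exact: mA.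
rewrite [LHS]/= /lebesgue_step /pushforward -product_measure1E//; last first.
  rewrite (_ : [set _ | _] = \bigcap_(i in [set: 'I_n])
      ((fun x : 'rV[R]_n => x 0 i : measurableTypeR R) @^-1` A (lift ord0 i))).
    apply: fin_bigcap_measurable => // i _.
    rewrite -[X in measurable X]setTI; exact: measurable_coord.
  by apply/seteqP; split => [x Ax i _|x Ax i]; [exact: Ax|exact: (Ax i)].
congr (_ _); apply/seteqP; split => [[a v] /= H|[a v] /= [Aa H] i].
  split; first by have := H ord0; rewrite mxE unlift_none.
  by move=> i; have := H (lift ord0 i); rewrite mxE liftK.
by rewrite mxE; case: unliftP => [j|] ->.
Qed.

End RowMeasurableFun.

Section Geometry.
Context {R : realType} {d : nat}.
Local Notation E := 'rV[R]_d.
Local Notation mu := (lebesgue_row R d).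
Implicit Types (x y : E) (A B Q O : set E).

Definition dotr x y : R := \sum_i x 0 i * y 0 i.

(* The library norm `|x| on 'rV_d is the max norm. *)
Definition enorm x : R := Num.sqrt (dotr x x).

Definition eball x (r : R) : set E := [set y | enorm (y - x) < r].

Definition bdry A : set E := closure A `\` A°.

Definition eucl_dist x A : \bar R := ereal_inf [set (enorm (x - z))%:E | z in A].

Definition conv_hull m (V : 'I_m -> E) : set E :=
  [set x | exists c : 'I_m -> R,
    [/\ forall j, 0 <= c j, \sum_j c j = 1 & x = \sum_j c j *: V j]].

(* Near each boundary point, and in direction e, O lies strictly above the
   graph of a Lipschitz function of the component orthogonal to e. *)
Definition lipschitz_boundary O : Prop :=
  forall x, bdry O x -> exists (e : E) (r : R) (phi : E -> R),
    [/\ enorm e = 1, 0 < r, lipschitz phi & forall y, eball x r y ->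
      (O y <-> phi (y - x - dotr (y - x) e *: e) < dotr (y - x) e)].

(* Polytopes need not be convex: the closure is a finite union of convex
   hulls of finite sets. *)
Definition lipschitz_polytope O : Prop :=
  [/\ open O, bounded_set O, lipschitz_boundary O &
    exists k m (V : 'I_k -> 'I_m -> E),
      closure O = \bigcup_(i in [set: 'I_k]) conv_hull (V i)].

Definition dyadic_cube (j : nat) (k : 'I_d -> int) : set E :=
  [set x | forall i,
    (k i)%:~R * 2 ^- j <= x 0 i /\ x 0 i < (k i + 1)%:~R * 2 ^- j].

Definition average (w : E -> R) A : \bar R :=
  (((fine (mu A))^-1)%:E * \int[mu]_(x in A) (w x)%:E)%E.

End Geometry.

Section Weights.
Context {R : realType} {d : nat}.
Local Notation E := 'rV[R]_d.
Local Notation mu := (lebesgue_row R d).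
Implicit Types (w : E -> R) (O : set E).

(* Positivity a.e. is explicit because 0^-1 = 0 here, whereas the classes A_1
   and A_2 read w^-1 as infinite where w vanishes. *)
Definition weight w : Prop :=
  [/\ measurable_fun setT w, forall x, 0 <= w x, \forall x \ae mu, 0 < w x &
    forall K : set E, compact K -> (\int[mu]_(x in K) (w x)%:E < +oo)%E].

Definition winv w : E -> R := fun x => (w x)^-1.

Definition A2 w : Prop :=
  weight w /\
  (ereal_sup [set average w (eball b.1 b.2) * average (winv w) (eball b.1 b.2)
             | b in [set b : E * R | (0 < b.2)%R]] < +oo)%E.

(* The supremum of w^-1 over a ball is the essential one, w being defined
   up to null sets. *)
Definition A1 w : Prop :=
  weight w /\
  (ereal_sup [set average w (eball b.1 b.2) *
                  ess_sup mu ((EFin \o winv w) \_ (eball b.1 b.2))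
             | b in [set b : E * R | (0 < b.2)%R]] < +oo)%E.

Definition dyadic_averages w (x : E) : set (\bar R) :=
  [set a | exists j k, dyadic_cube j k x /\ a = average w (dyadic_cube j k)].

Definition singular_set w : set E :=
  [set x | ereal_inf (dyadic_averages w x) = 0%E \/
           ereal_sup (dyadic_averages w x) = +oo%E].

Definition admissible_weight O w : Prop :=
  [/\ A2 w, A1 (winv w),
    exists (G : set E) (eps wl : R),
      [/\ open G /\ G `<=` O, 0 < eps /\ 0 < wl,
        [set x | O x /\ (eucl_dist x (bdry O) < eps%:E)%E] `<=` G,
        {within closure G, continuous w} &
        forall x, closure G x -> wl <= w x] &
    compact (closure (singular_set w)) /\ closure (singular_set w) `<=` O].

End Weights.

Section Sobolev.
Context {R : realType} {d : nat}.
Local Notation E := 'rV[R]_d.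
Local Notation mu := (lebesgue_row R d).
Implicit Types (w f : E -> R) (O : set E).

Definition partial (i : 'I_d) f : E -> R :=
  fun x => 'D_(delta_mx 0 i : E) f x.

Fixpoint Ck (k : nat) f : Prop :=
  continuous f /\
  if k is k'.+1 then
    forall i, (forall x, derivable f x (delta_mx 0 i : E)) /\ Ck k' (partial i f)
  else True.

Definition test_fun O f : Prop :=
  [/\ forall k, Ck k f, compact (closure [set x | f x != 0]) &
    closure [set x | f x != 0] `<=` O].

Definition classical_grad f : E -> E := fun x => \row_i partial i f x.

Definition loc_integrable O f : Prop :=
  measurable_fun O f /\
  forall K, K `<=` O -> compact K -> (\int[mu]_(x in K) `|f x|%:E < +oo)%E.

Definition L2 w O f : Prop :=
  measurable_fun O f /\ (\int[mu]_(x in O) (f x ^+ 2 * w x)%:E < +oo)%E.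

Definition L2norm w O f : R :=
  Num.sqrt (\int[mu]_(x in O) (f x ^+ 2 * w x))%R.

Definition L20 O f : Prop := L2 (cst 1) O f /\ (\int[mu]_(x in O) f x)%R = 0.

Definition vL2norm w O (G : E -> E) : R :=
  Num.sqrt (\int[mu]_(x in O) (enorm (G x) ^+ 2 * w x))%R.

Definition ae_eq_on O f1 f2 : Prop := \forall x \ae mu, O x -> f1 x = f2 x.

(* A weakly differentiable function is represented by the pair formed by the
   function and its weak gradient. Pairs form an R-module componentwise. *)
Definition sobfun : Type := ((E -> R^o) * (E -> E))%type.
HB.instance Definition _ := GRing.Lmodule.on sobfun.

Definition sobval (u : sobfun) : E -> R := u.1.
Definition sobgrad (u : sobfun) : E -> E := u.2.

Definition weak_grad O (u : sobfun) : Prop :=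
  [/\ loc_integrable O (sobval u),
    forall i, loc_integrable O (fun x => sobgrad u x 0 i) &
    forall phi i, test_fun O phi ->
      (\int[mu]_(x in O) (sobval u x * partial i phi x) =
       - \int[mu]_(x in O) (sobgrad u x 0 i * phi x))%R].

Definition H1 w O (u : sobfun) : Prop :=
  [/\ L2 w O (sobval u), forall i, L2 w O (fun x => sobgrad u x 0 i) &
    weak_grad O u].

Definition H10 w O : set sobfun := [set u | H1 w O u /\
  forall eps : R, 0 < eps -> exists2 phi, test_fun O phi &
    L2norm w O (fun x => sobval u x - phi x) < eps /\
    vL2norm w O (fun x => sobgrad u x - classical_grad phi x) < eps].

Definition H10norm w O (u : sobfun) : R := vL2norm w O (sobgrad u).

(* H is an element of the dual space of H10 w O. *)
Definition H10_dual w O (H : sobfun -> R) : Prop :=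
  (forall (a : R) r s, H10 w O r -> H10 w O s ->
     H (a *: r + s) = a * H r + H s) /\
  exists C : R, forall r, H10 w O r -> `|H r| <= C * H10norm w O r.

Definition H10_dual_norm w O (H : sobfun -> R) : \bar R :=
  ereal_sup [set (`|H r| / H10norm w O r)%:E | r in H10 w O].

Definition Hm1 w O (H : sobfun -> R) : Prop := H10_dual (winv w) O H.
Definition Hm1norm w O (H : sobfun -> R) : \bar R := H10_dual_norm (winv w) O H.

Definition vsobfun : Type := 'I_d -> sobfun.
HB.instance Definition _ := GRing.Lmodule.on vsobfun.
Implicit Types (u v z : vsobfun).

Definition vsobval u : E -> E := fun x => \row_i sobval (u i) x.

Definition divg u : E -> R := fun x => \sum_i sobgrad (u i) x 0 i.

Definition grad_dot u v : E -> R :=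
  fun x => \sum_i dotr (sobgrad (u i) x) (sobgrad (v i) x).

(* ((u . grad) v) . z *)
Definition convection u v z : E -> R :=
  fun x => \sum_i dotr (vsobval u x) (sobgrad (v i) x) * sobval (z i) x.

Definition vH10 O : set vsobfun := [set u | forall i, H10 (cst 1) O (u i)].

Definition vH10norm O u : R := Num.sqrt (\int[mu]_(x in O) grad_dot u u x)%R.

(* Spaces of a.e. classes are given by representatives: the span of finitely
   many functions. *)
Definition fin_dim (U : lmodType R) (V : set U) : Prop :=
  exists n (b : 'I_n -> U),
    V = range (fun c : 'I_n -> R => \sum_i c i *: b i).

End Sobolev.
Arguments sobfun R d : clear implicits.
Arguments vsobfun R d : clear implicits.

Section Problem.
Context {R : realType} {d : nat}.
Local Notation E := 'rV[R]_d.
Local Notation mu := (lebesgue_row R d).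
Implicit Types (w p : E -> R) (O : set E) (g : E) (th T : sobfun R d)
  (u v : vsobfun R d) (X : set (vsobfun R d)) (M : set (E -> R^o))
  (W : set (sobfun R d)).

Definition coefficient (nu : R -> R) (num nup : R) : Prop :=
  [/\ lipschitz nu, 0 < num & forall t, num <= nu t /\ nu t <= nup].

Definition buoyancy_const O w (C : R) : Prop := 0 < C /\
  forall g th v, H10 w O th -> vH10 O v ->
    mu.-integrable O (fun x => (sobval th x * dotr g (vsobval v x))%:E) /\
    `|\int[mu]_(x in O) (sobval th x * dotr g (vsobval v x))|%R
      <= C * enorm g * H10norm w O th * vH10norm O v.

Definition advection_const O w (C : R) : Prop := 0 < C /\
  forall th v r, H10 w O th -> vH10 O v -> H10 (winv w) O r ->
    mu.-integrable O (fun x => (sobval th x * dotr (vsobval v x) (sobgrad r x))%:E) /\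
    `|\int[mu]_(x in O) (sobval th x * dotr (vsobval v x) (sobgrad r x))|%R
      <= C * vH10norm O v * H10norm w O th * H10norm (winv w) O r.

Definition diffusion_solution O w (kap : E -> R) (F : sobfun R d -> R) T : Prop :=
  H10 w O T /\ forall r, H10 (winv w) O r ->
    (\int[mu]_(x in O) (kap x * dotr (sobgrad T x) (sobgrad r x)))%R = F r.

Definition diffusion_well_posed O w (kap : E -> R) : Prop :=
  exists C : R, forall F, Hm1 w O F -> exists T,
    [/\ diffusion_solution O w kap F T,
      forall T', diffusion_solution O w kap F T' ->
        ae_eq_on O (sobval T) (sobval T') &
      ((H10norm w O T)%:E <= C%:E * Hm1norm w O F)%E].

Definition diffusion_threshold O w (Lam0 : R) : Prop :=
  forall (kap : E -> R) (km kp : R), measurable_fun O kap -> 0 < km ->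
    (\forall x \ae mu, O x -> km <= kap x /\ kap x <= kp) ->
    Lam0 <= km / kp -> diffusion_well_posed O w kap.

Definition momentum O (nu : R -> R) g th u p v : R :=
  (\int[mu]_(x in O) (nu (sobval th x) * grad_dot u v x + convection u u v x
     - p x * divg v x - sobval th x * dotr g (vsobval v x)))%R.

Definition momentum_skew O (nu : R -> R) g th u p v : R :=
  (\int[mu]_(x in O) (nu (sobval th x) * grad_dot u v x + convection u u v x
     + 2^-1 * divg u x * dotr (vsobval u x) (vsobval v x)
     - p x * divg v x - sobval th x * dotr g (vsobval v x)))%R.

Definition NS_solution O nu g th u p : Prop :=
  [/\ vH10 O u, L20 O p, forall v, vH10 O v -> momentum O nu g th u p v = 0 &
    forall q, L20 O q -> (\int[mu]_(x in O) (q x * divg u x))%R = 0].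

Definition discrete_NS_solution O nu g th X M u p : Prop :=
  [/\ X u, M p, forall v, X v -> momentum_skew O nu g th u p v = 0 &
    forall q, M q -> (\int[mu]_(x in O) (q x * divg u x))%R = 0].

Definition unique_up (P : vsobfun R d -> (E -> R) -> Prop) O : Prop :=
  forall u1 p1 u2 p2, P u1 p1 -> P u2 p2 ->
    (forall i, ae_eq_on O (sobval (u1 i)) (sobval (u2 i))) /\ ae_eq_on O p1 p2.

Definition div_inf_sup O (beta : R) X M : Prop := forall q, M q ->
  ((beta * L2norm (cst 1) O q)%:E <=
   ereal_sup [set ((\int[mu]_(x in O) (divg v x * q x))%R / vH10norm O v)%:E
             | v in X])%E.

Definition grad_inf_sup O w1 w2 (gam : R) W : Prop := forall r, W r ->
  ((gam * H10norm w1 O r)%:E <=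
   ereal_sup [set ((\int[mu]_(x in O) dotr (sobgrad r x) (sobgrad th x))%R /
                   H10norm w2 O th)%:E | th in W])%E.

Definition flow_spaces O X M : Prop :=
  [/\ fin_dim X, fin_dim M, X `<=` vH10 O & M `<=` L20 O].

(* CP serves all admissible weights, viscosities and data, and all inf-sup
   stable discretizations: it depends on O and d only. *)
Definition NS_uniqueness_const O (CP : R) : Prop := 0 < CP /\
  forall w, admissible_weight O w -> forall Ce1, buoyancy_const O w Ce1 ->
  forall nu num nup, coefficient nu num nup -> forall g th, H10 w O th ->
  CP * Ce1 * enorm g * H10norm w O th < num ^+ 2 ->
  unique_up (NS_solution O nu g th) O /\
  forall X M (beta : R), flow_spaces O X M -> 0 < beta ->
    div_inf_sup O beta X M ->
    unique_up (discrete_NS_solution O nu g th X M) O.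

Definition dense_as_h_to_0 (U : zmodType) (V : set U) (N : U -> R)
    (Vh : R -> set U) : Prop :=
  forall r, V r -> forall eps : R, 0 < eps ->
    \forall h \near 0^'+, exists2 rh, Vh h rh & N (r - rh) < eps.

Definition stable_interpolation O w (W : R -> set (sobfun R d))
    (piW : R -> sobfun R d -> sobfun R d) : Prop :=
  [/\ forall h r, 0 < h -> H10 w O r -> W h (piW h r),
    exists C : R, forall h r, 0 < h -> H10 w O r ->
      H10norm w O (piW h r) <= C * H10norm w O r &
    forall r, H10 w O r -> H10norm w O (piW h r - r) @[h --> 0^'+] --> (0 : R)].

Definition flow_radius (gam Ce2 : R) : R := gam / (4 * Ce2).

Definition heat_radius (num : R) g (Ce1 CP gam Ce2 : R) : R :=
  num / (enorm g * Ce1) * Num.min (num / CP) (gam / (4 * Ce2)).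

End Problem.

(* Main.v *)
Require Import Defs.
From mathcomp Require Import all_boot all_order all_algebra.
From mathcomp Require Import all_classical all_reals all_analysis measurable_realfun.
From mathcomp Require Import ring lra.

(** The idea. For a fixed mesh parameter everything is finite dimensional, and
the nonlinear system is solved by freezing its coefficients. Given a velocity
uh in the ball of radius [flow_radius] and a temperature Th in the ball of
radius [heat_radius], solve two decoupled linear problems: an Oseen problem
with viscosity nu(Th), convecting field uh and forcing Th g, posed on the
discretely divergence free fields, and an advection-diffusion problem with
diffusivity kappa(Th) and convecting field uh. A fixed point of the map
(uh, Th) |-> (u, T) is a solution, and the two radii are chosen so
that the map sends the product of the balls into itself:

 - Testing the Oseen problem with u, the skew-symmetrized convection
   vanishes, so num |u|^2 <= Ce1 |g| |Th| |u|, and the choice of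
   [heat_radius] turns this into |u| <= [flow_radius]
   ([velocity_coercive], [buoyancy_radius]).
 - For the heat equation, T and the test function live in spaces with dual
   weights, so one cannot test with T. Instead kapp times the Laplace form is
   written as the frozen form plus the perturbation with coefficient
   kapp - kappa and the advection term; the inf-sup condition on W_h bounds
   the Laplace form from below by gam |T|, the hypothesis on kapm / kapp
   makes the perturbation leave gam / 2 of it, and the bound on uh leaves
   gam / 4, whence gam / 4 |T| <= |H| ([heat_estimate]).

The same two estimates with zero data show that both linear problems are
uniquely solvable. Continuity of the map follows from dominated convergence,
because nu and kappa are continuous and bounded. Brouwer's theorem
([brouwer], deduced from a combinatorial statement on grids) then gives
the fixed point ([galerkin_fixpoint], [galerkin_solution]). The pressure is
the family of Lagrange multipliers of the discrete incompressibility
constraint: the momentum residual vanishes on the joint kernel of finitely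
many linear forms, so it is a combination of them ([multipliers]).

Two analytic facts are behind the convection term. It is integrable and
skew-symmetric on H^1_0 because H^1_0 embeds in L^4 in dimensions two and
three; this is Ladyzhenskaya's inequality ([ladyzhenskaya]), proved for
smooth functions with compact support and extended by density ([H10_L4]),
after which the identity of [H10_skew] is the weak derivative of one factor
tested against the square of an approximation of the other.

Sobolev functions are represented by actual functions, so the gradient norms
are only seminorms on the discrete spaces. The linear systems are therefore
written in a basis modulo the elements with zero gradient
([exists_basis_modulo]), and every form involved is shown to vanish on those
elements. *)

Set Implicit Arguments. Unset Strict Implicit. Unset Printing Implicit Defensive.
Import Order.TTheory GRing.Theory Num.Theory.
Import numFieldNormedType.Exports.
Local Open Scope classical_set_scope.
Local Open Scope ring_scope.

(** * Discrete differential forms modulo two on a grid *)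

Section Grid.
Variables (n p : nat).
Local Notation pt := {ffun 'I_n -> nat}.
Implicit Types (x y : pt) (A B : {set 'I_n}) (c : pt -> {set 'I_n} -> 'F_2).

Definition upd x (i : 'I_n) (t : nat) : pt := [ffun j => if j == i then t else x j].
Definition step x (i : 'I_n) : pt := upd x i (x i).+1.

Lemma F2_addrr (a : 'F_2) : a + a = 0.
Proof. by apply: addrr_pchar2; apply: pchar_Fp. Qed.

Lemma F2_eq_of_add0 (a b : 'F_2) : a + b = 0 -> a = b.
Proof. by move=> ab0; rewrite -[a]addr0 -(F2_addrr b) addrA ab0 add0r. Qed.

Lemma updC x i j t u : i != j -> upd (upd x i t) j u = upd (upd x j u) i t.
Proof.
move=> ij; apply/ffunP => k; rewrite !ffunE.
by case: (eqVneq k j) => // ->; rewrite eq_sym (negbTE ij).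
Qed.

Lemma upd_upd x i t u : upd (upd x i t) i u = upd x i u.
Proof. by apply/ffunP => k; rewrite !ffunE; case: eqP. Qed.

Lemma step_upd x i t : step (upd x i t) i = upd x i t.+1.
Proof. by rewrite /step upd_upd ffunE eqxx. Qed.

Lemma stepC x i j : step (step x i) j = step (step x j) i.
Proof.
have [->//|ij] := eqVneq i j.
by rewrite /step updC// !ffunE [j == i]eq_sym (negbTE ij).
Qed.

(** Coboundary of cubical cochains: [c x A] is the value of [c] on the cube
with lowest vertex [x] and edge directions [A]. Modulo two no orientation
signs are needed. *)
Definition cobound c : pt -> {set 'I_n} -> 'F_2 :=
  fun x A => \sum_(i in A) (c (step x i) (A :\ i) + c x (A :\ i)).

(** The terms for (i, j) and (j, i) cancel modulo two. *)
Lemma sum_sym_F2 (A : {set 'I_n}) (f : 'I_n -> 'I_n -> 'F_2) :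
  (forall i j, f i j = f j i) -> \sum_(i in A) \sum_(j in A :\ i) f i j = 0.
Proof.
move=> fC.
have split_ltn i : \sum_(j in A :\ i) f i j =
    \sum_(j in A | (i < j)%N) f i j + \sum_(j in A | (j < i)%N) f i j.
  rewrite (bigID (fun j : 'I_n => (i < j)%N)) /=; congr (_ + _);
    apply: eq_bigl => j; rewrite !inE -val_eqE /=; case: ltngtP; rewrite ?andbF ?andbT //=.
under eq_bigr => i _ do rewrite split_ltn.
rewrite big_split /= [X in _ + X](exchange_big_dep (mem A)) /=; last by move=> i j _ /andP[].
apply/eqP; rewrite -[X in _ == X](F2_addrr (\sum_(i in A) \sum_(j in A | (i < j)%N) f i j)).
apply/eqP; congr (_ + _); apply: eq_bigr => i iA.
apply: eq_big => [j|j _]; last exact: fC.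
by rewrite iA.
Qed.

(** Removing directions i and j in either order gives the same face. *)
Lemma cobound_cobound c x A : cobound (cobound c) x A = 0.
Proof.
rewrite /cobound -[RHS](@sum_sym_F2 A (fun i j =>
  c (step (step x i) j) (A :\ i :\ j) + c (step x i) (A :\ i :\ j) +
  (c (step x j) (A :\ i :\ j) + c x (A :\ i :\ j)))).
  by apply: eq_bigr => i _; rewrite -big_split.
move=> i j; have -> : A :\ i :\ j = A :\ j :\ i.
  by apply/setP => k; rewrite !inE andbCA.
by rewrite stepC addrACA.
Qed.

Variable s : 'I_n -> pt -> 'F_2.

(** The exterior product of the differentials of the 0-forms [s k], built as
d (s k1 (d (s k2 ...))) so that it is closed by construction. *)
Fixpoint wedge (l : seq 'I_n) : pt -> {set 'I_n} -> 'F_2 :=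
  if l is k :: l' then cobound (fun x A => s k x * wedge l' x A) else fun _ _ => 1.

Lemma cobound_wedge l x A : cobound (wedge l) x A = 0.
Proof.
case: l => [|k l] /=; last exact: cobound_cobound.
by rewrite /cobound big1// => i _; rewrite F2_addrr.
Qed.

(** Leibniz rule, the second factor being closed. *)
Lemma wedge_cons k l x A : wedge (k :: l) x A =
  \sum_(i in A) (s k (step x i) + s k x) * wedge l (step x i) (A :\ i).
Proof.
have := cobound_wedge l x A; rewrite /cobound big_split /= => /F2_eq_of_add0 e.
rewrite /cobound big_split /= -mulr_sumr -e mulr_sumr -big_split /=.
by apply: eq_bigr => i _; rewrite mulrDl.
Qed.

Definition cell x A : pred pt :=
  fun y => [forall i, (y i == x i) || ((i \in A) && (y i == (x i).+1))].

Lemma cell_refl x A : cell x A x.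
Proof. by apply/forallP => i; rewrite eqxx. Qed.

Lemma cell_step x A i y : i \in A -> cell (step x i) (A :\ i) y -> cell x A y.
Proof.
move=> iA /forallP yc; apply/forallP => j; move: (yc j); rewrite !ffunE !inE.
by have [->|ji] := eqVneq j i; rewrite /= ?iA ?orbF // => ->; rewrite orbT.
Qed.

(** A product of differentials with a factor that is constant on the cell
vanishes there. This lets a nonzero value detect a cell on which every [s k]
takes both values. *)
Lemma wedge_const l j a x A : j \in l -> (forall y, cell x A y -> s j y = a) ->
  wedge l x A = 0.
Proof.
elim: l x A => [|k l IHl] x A //; rewrite inE => jkl sa.
rewrite wedge_cons big1// => i iA; have [jk|jk] := eqVneq j k.
  by rewrite -jk !sa ?F2_addrr ?mul0r ?cell_refl//; apply: cell_step iA (cell_refl _ _).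
rewrite IHl ?mulr0//; first by move: jkl; rewrite (negbTE jk).
by move=> y yc; apply: sa; apply: cell_step yc.
Qed.

Fixpoint boxsum (l : seq 'I_n) (F : pt -> 'F_2) x : 'F_2 :=
  if l is i :: l' then \sum_(0 <= t < p) boxsum l' F (upd x i t) else F x.

Lemma eq_boxsum l F G x : F =1 G -> boxsum l F x = boxsum l G x.
Proof. by move=> FG; elim: l x => [|i l IHl] x //=; apply: eq_bigr. Qed.

Lemma boxsum_sum l (I : Type) (r : seq I) (P : pred I) (F : I -> pt -> 'F_2) x :
  boxsum l (fun y => \sum_(i <- r | P i) F i y) x =
  \sum_(i <- r | P i) boxsum l (F i) x.
Proof.
elim: l x => [|j l IHl] x //=.
by under eq_bigr => t _ do rewrite IHl; rewrite exchange_big.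
Qed.

Lemma boxsum_upd l F x i t : i \notin l ->
  boxsum l F (upd x i t) = boxsum l (fun y => F (upd y i t)) x.
Proof.
elim: l x => [|j l IHl] x //=; rewrite inE negb_or => /andP[ij il].
by apply: eq_bigr => u _; rewrite -IHl// updC.
Qed.

(** The order of summation is immaterial, so direction [i] can be summed first. *)
Lemma boxsum_rem l F x i : uniq l -> i \in l ->
  boxsum l F x = boxsum (rem i l) (fun y => \sum_(0 <= t < p) F (upd y i t)) x.
Proof.
elim: l x => [|j l IHl] x //= /andP[jl ul]; rewrite inE.
have [->|ij] /= := eqVneq i j => il.
  by rewrite boxsum_sum; apply: eq_bigr => t _; rewrite boxsum_upd.
by apply: eq_bigr => t _; rewrite IHl.
Qed.

Lemma boxsum_neq0 l F x : boxsum l F x != 0 -> uniq l ->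
  exists y, F y != 0 /\ forall i, i \in l -> (y i < p)%N.
Proof.
elim: l x F => [|i l IHl] x F /=; first by move=> Fx _; exists x.
move=> S0 /andP[il ul].
have [[t [tp St]]|nex] := pselect (exists t, (t < p)%N /\ boxsum l F (upd x i t) != 0); last first.
  case/negP: S0; apply/eqP; rewrite big_nat big1// => t /andP[_ tp].
  by apply/eqP; apply: contrapT => /negP St; apply: nex; exists t.
move: St; rewrite boxsum_upd// => /IHl-/(_ ul)[y [Fy yl]]; exists (upd y i t); split => // j.
rewrite ffunE inE; case: eqP => //= _; exact: yl.
Qed.

Hypothesis s0 : forall i x, x i = 0%N -> s i x = 0.
Hypothesis sp : forall i x, x i = p -> s i x = 1.

Lemma telescope_F2 (e : nat -> 'F_2) :
  \sum_(0 <= t < p) (e t.+1 + e t) = e p + e 0%N.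
Proof.
elim: p => [|q IHq]; first by rewrite big_geq// F2_addrr.
by rewrite big_nat_recr//= IHq addrC addrA -[_ + e q + e q]addrA F2_addrr addr0.
Qed.

(** Stokes' theorem on the box. The sum of an exact form reduces to the faces.
On a face orthogonal to a direction i of the remaining factors, [s i] is
constant and the form vanishes; on the two faces orthogonal to the first
direction the factor [s k] is 0 and 1, which leaves the same sum in one
dimension less. *)
Lemma boxsum_wedge l x : uniq l -> boxsum l (wedge l ^~ [set:: l]) x = 1.
Proof.
elim: l x => [|k l IHl] x //= /andP[kl ul].
pose A := [set:: k :: l].
pose e i y := s k y * wedge l y (A :\ i).
have AE i : (i \in A) = (i \in k :: l) by rewrite inE.
transitivity (boxsum (k :: l) (fun y => \sum_(i in A) (e i (step y i) + e i y)) x) => //.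
have face i : i \in A -> boxsum (k :: l) (fun y => e i (step y i) + e i y) x =
    boxsum (rem i (k :: l)) (fun y => e i (upd y i p) + e i (upd y i 0%N)) x.
  rewrite AE => il; rewrite (boxsum_rem _ _ _ il) /= ?kl//.
  apply: eq_boxsum => y; under eq_bigr => t _ do rewrite step_upd.
  exact: telescope_F2 (fun t => e i (upd y i t)).
have kA : k \in A by rewrite AE mem_head.
pose f i := boxsum (k :: l) (fun y => e i (step y i) + e i y) x.
rewrite boxsum_sum; transitivity (\sum_(i in A) f i) => //.
rewrite (bigD1 k kA) /= big1 ?addr0 /f => [|i /andP[iA ik]].
  have := face k; rewrite AE mem_head /= => /(_ isT) ->; rewrite eqxx.
  rewrite -(IHl (upd x k p) ul) boxsum_upd//; apply: eq_boxsum => y.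
  rewrite /e sp ?s0 ?mul0r ?addr0 ?mul1r ?ffunE ?eqxx//; congr wedge.
  by apply/setP => j; rewrite !inE; case: eqP => //= ->; rewrite (negbTE kl).
have {}iA : i \in A := iA.
rewrite face//; have il : i \in l by have := iA; rewrite AE inE (negbTE ik).
suff e0 y t : (t = 0%N \/ t = p) -> e i (upd y i t) = 0.
  rewrite (_ : boxsum _ _ _ = boxsum (rem i (k :: l)) (fun=> 0) x).
    by elim: (rem _ _) (x) => [|j r IHr] z //=; rewrite big1.
  by apply: eq_boxsum => y; rewrite !e0 ?addr0//; [left|right].
have vi z : cell (upd y i t) (A :\ i) z -> z i = t.
  by move=> /forallP/(_ i); rewrite !inE eqxx orbF ffunE eqxx => /eqP.
move=> [] t0; rewrite /e.
  by rewrite (@wedge_const l i 0) ?mulr0// => z /vi zt; apply: s0; rewrite zt.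
by rewrite (@wedge_const l i 1) ?mulr0// => z /vi zt; apply: sp; rewrite zt.
Qed.

(** The combinatorial core of Brouwer's theorem: labels that are 0 on the
lower faces and 1 on the upper faces all change value within one cell. *)
Lemma grid_cell : exists x, (forall i, (x i < p)%N) /\
  forall i, exists y z, [/\ cell x finset.setT y, cell x finset.setT z, s i y = 0 & s i z = 1].
Proof.
have := boxsum_wedge [ffun=> 0%N] (enum_uniq 'I_n).
have -> : [set:: enum 'I_n] = finset.setT :> {set 'I_n} by apply/setP => i; rewrite !inE mem_enum.
move=> S1; have : boxsum (enum 'I_n) ((wedge (enum 'I_n))^~ finset.setT) [ffun=> 0%N] != 0.
  by rewrite S1.
move=> /boxsum_neq0-/(_ (enum_uniq _))[x [Fx xp]]; exists x; split.
  by move=> i; apply: xp; rewrite mem_enum.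
move=> i.
have F2E (a : 'F_2) : a = 0 \/ a = 1.
  by case: a => [[|[|m]] lt_m] //; [left|right]; apply: val_inj.
(* if [s i] missed the value [a] it would be constant on the cell, equal to [a + 1] *)
have hit a : exists2 y, cell x finset.setT y & s i y = a.
  apply: contrapT => nex; case/negP: Fx; apply/eqP.
  apply: (@wedge_const _ i (a + 1)); rewrite ?mem_enum// => y yc.
  have : s i y <> a by move=> sa; apply: nex; exists y.
  by case: (F2E (s i y)) => ->; case: (F2E a) => -> // _; apply: val_inj.
have [y ? ?] := hit 0; have [z ? ?] := hit 1; by exists y, z.
Qed.

End Grid.

(** * Brouwer's fixed point theorem *)

Section Brouwer.
Variable R : realType.

Lemma nbhs_row n (c : 'rV[R]_n) (P : set 'rV[R]_n) : nbhs c P ->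
  exists2 e : R, 0 < e & forall y : 'rV[R]_n, (forall i, `|c 0 i - y 0 i| < e) -> P y.
Proof.
move=> /nbhs_ballP[e /= e0 eP]; exists e => // y ye; apply: eP; split => // i j.
by rewrite ord1; exact: ye.
Qed.

Lemma continuous_row n (T : topologicalType) (F : T -> 'rV[R]_n) :
  continuous F <-> forall i, continuous (fun x => F x 0 i).
Proof.
split=> [cF i x|cF x].
  exact: (@continuous_comp _ _ _ F (fun v : 'rV_n => v 0 i) x (cF x) (@coord_continuous _ _ _ _ _ _)).
apply/cvg_ballP => e e0.
have : \forall t \near x, forall i, ball (F x 0 i) e (F t 0 i).
  by apply: filter_forall => i; move/cvg_ballP: (cF i x); apply.
by apply: filterS => t Ft; split => // i j; rewrite ord1; exact: Ft.
Qed.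

(** Label a vertex x in direction i by whether F_i(x) <= x_i. The bound on F
forces the label 1 on the upper faces, and 0 is imposed on the lower faces,
where F_i(x) >= x_i holds anyway. Cells of finer and finer grids on which all
labels change accumulate at a point c; both inequalities hold arbitrarily
near c in every direction, so F(c) = c. *)
Lemma brouwer_box n (F : 'rV[R]_n -> 'rV[R]_n) (r : R) : 0 < r ->
  continuous F -> (forall x i, `|F x 0 i| <= r) -> exists x, F x = x.
Proof.
move=> r0 cF Fr.
(* the vertices of the grid of mesh [2 * r / p] on the box [- r, r] ^ n *)
pose gp (p : nat) (x : {ffun 'I_n -> nat}) : 'rV[R]_n :=
  \row_i (- r + 2 * r * (x i)%:R / p%:R).
pose s p (i : 'I_n) (x : {ffun 'I_n -> nat}) : 'F_2 := if (x i == 0)%N then 0 else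
  if F (gp p x) 0 i <= gp p x 0 i then 1 else 0.
have cellP (N : nat) : exists x : {ffun 'I_n -> nat}, (forall i, (x i < N.+1)%N) /\ forall i, exists y z,
    [/\ cell x finset.setT y, cell x finset.setT z, s N.+1 i y = 0 & s N.+1 i z = 1].
  apply: grid_cell => i x xi; rewrite /s xi ?eqxx//=.
  case: ifPn => // /negP[]; rewrite [X in _ <= X]mxE xi mulfK ?pnatr_eq0//.
  rewrite (_ : - r + _ = r); last by ring.
  by have := Fr (gp N.+1 x) i; rewrite ler_norml => /andP[].
have /choice[X XP] := cellP.
pose Z (N : nat) := gp N.+1 (X N).
pose K := [set v : 'rV[R]_n | forall i, [set` `[- r, r]] (v ord0 i)].
have cK : compact K by apply: (@rV_compact _ _ (fun=> _)) => i; exact: segment_compact.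
have ZK N : K (Z N).
  move=> i; rewrite /= mxE in_itv /=; have [/(_ i) Xi _] := XP N.
  have : 0 <= ((X N i)%:R / N.+1%:R : R) <= 1.
    apply/andP; split; first exact: divr_ge0.
    by rewrite ler_pdivrMr ?ltr0n// mul1r ler_nat; exact: ltnW.
  move=> /andP[]; rewrite -mulrA; move: (_ / _) => q q0 q1; apply/andP; split; nra.
have [c [_ cc]] : K `&` cluster (Z @ \oo) !=set0.
  by apply: cK; exists 0%N => // N _; exact: ZK.
(* all vertices of a small cell close to c belong to a given neighbourhood of c *)
have near_vertex (P : set 'rV[R]_n) : nbhs c P -> exists N, forall y,
    cell (X N) finset.setT y -> P (gp N.+1 y).
  move=> /nbhs_row[e e0 eP].
  have e40 : 0 < e / 2 by rewrite divr_gt0.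
  have [N0 N0P] : exists N0 : nat, 2 * r / (e / 2) < N0%:R.
    by exists (Num.truncn (2 * r / (e / 2))).+1; exact: truncnS_gt.
  have [] := cc [set Z N | N in [set N | (N0 <= N)%N]] (ball c (e / 2)).
  - by exists N0 => // N /= N0N; exists N.
  - exact: nbhsx_ballx.
  move=> _ [[N N0N <-] [_ cZ]]; exists N => y /forallP yc; apply: eP => i.
  have := cZ 0 i; rewrite /ball /= !mxE => cZi.
  have : `|(- r + 2 * r * (X N i)%:R / N.+1%:R) - (- r + 2 * r * (y i)%:R / N.+1%:R)|
      <= 2 * r / N.+1%:R.
    rewrite opprD opprK addrACA addNr add0r -!mulrBl -mulrBr normrM [X in _ * X]ger0_norm ?invr_ge0//.
    rewrite ler_wpM2r ?invr_ge0// normrM ger0_norm ?mulr_ge0 ?(ltW r0)//.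
    rewrite ler_piMr ?mulr_ge0 ?(ltW r0)//.
    case/orP: (yc i) => [/eqP ->|/andP[_ /eqP ->]]; first by rewrite subrr normr0.
    by rewrite -natr1 opprD addNKr normrN1.
  move=> d1; have d2 : 2 * r / N.+1%:R < e / 2.
    rewrite ltr_pdivrMr ?ltr0n// [e / 2 * _]mulrC -ltr_pdivrMr//; apply: (lt_le_trans N0P).
    by rewrite ler_nat; exact: leqW.
  move: cZi d1 d2; rewrite !ltr_norml !ler_norml.
  set a := - r + _; set b := - r + _; move: a b (2 * r / N.+1%:R) (c 0 i) => a b q t.
  by move=> /andP[h1 h2] /andP[h3 h4] h5; apply/andP; split; lra.
have cFi i : continuous (fun x => F x 0 i - x 0 i).
  by move=> x; exact: (@continuousB _ _ _ _ (fun v : 'rV_n => v 0 i) x ((continuous_row F).1 cF i x) (@coord_continuous _ _ _ _ _ x)).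
exists c; apply/rowP => i; apply/eqP; rewrite -subr_eq0; apply/eqP.
have [pos|neg|//] := ltgtP 0 (F c 0 i - c 0 i).
- have [N NP] := near_vertex _ (@cvgr_gt _ _ _ _ _ _ (cFi i c) _ pos); have [_ /(_ i)[y [z [_ zc _]]]] := XP N.
  have := NP _ zc; rewrite subr_gt0 /s; case: ifPn => // _; case: ifPn => // Fz.
  by rewrite ltNge Fz.
- have [N NP] := near_vertex _ (@cvgr_lt _ _ _ _ _ _ (cFi i c) _ neg); have [_ /(_ i)[y [z [yc _ sy _]]]] := XP N.
  have := NP _ yc; rewrite subr_lt0; move: sy; rewrite /s; case: ifPn => [/eqP y0 _|_].
    have := Fr (gp N.+1 y) i; rewrite ler_norml => /andP[Fy _].
    by rewrite ltNge {1}mxE y0 mulr0 mul0r addr0 Fy.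
  by case: ifPn => // Fy _ /ltW; rewrite (negbTE Fy).
Qed.

Lemma brouwer n (F : 'rV[R]_n -> 'rV[R]_n) (r : R) :
  continuous F -> (forall x i, `|F x 0 i| <= r) -> exists x, F x = x.
Proof.
move=> cF Fr; apply: (@brouwer_box _ _ (`|r| + 1)) => //.
move=> x i; by rewrite (le_trans (Fr x i))// (le_trans (ler_norm r))// lerDl.
Qed.

End Brouwer.

(** * Finite dimensional fixed points of linearizations *)

Section ContinuousMatrices.
Context {R : realType} {T : topologicalType}.

Lemma continuous_bigsum (I : Type) (r : seq I) (P : pred I) (F : I -> T -> R) :
  (forall i, P i -> continuous (F i)) -> continuous (fun x => \sum_(i <- r | P i) F i x).
Proof.
move=> cF x; elim: r => [|i r IHr].
  by under eq_fun do rewrite big_nil; exact: cvg_cst.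
under eq_fun do rewrite big_cons; case: ifPn => // Pi.
by apply: (@continuousD _ _ _ _ _ x (cF i Pi x) IHr).
Qed.

Lemma continuous_bigprod (I : Type) (r : seq I) (P : pred I) (F : I -> T -> R) :
  (forall i, P i -> continuous (F i)) -> continuous (fun x => \prod_(i <- r | P i) F i x).
Proof.
move=> cF x; elim: r => [|i r IHr].
  by under eq_fun do rewrite big_nil; exact: cvg_cst.
under eq_fun do rewrite big_cons; case: ifPn => // Pi.
by apply: (@continuousM _ _ _ _ x (cF i Pi x) IHr).
Qed.

Lemma continuous_det n (A : T -> 'M[R]_n) :
  (forall i j, continuous (fun x => A x i j)) -> continuous (fun x => \det (A x)).
Proof.
move=> cA; apply: continuous_bigsum => s _ x.
apply: (@continuousM _ _ (fun=> _) _ x); first exact: cvg_cst.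
exact: continuous_bigprod.
Qed.

Lemma continuous_invmx n (A : T -> 'M[R]_n) : (forall x, A x \in unitmx) ->
  (forall i j, continuous (fun x => A x i j)) ->
  forall i j, continuous (fun x => invmx (A x) i j).
Proof.
move=> uA cA i j x.
rewrite (_ : (fun x => _) = (fun x => (\det (A x))^-1 * cofactor (A x) j i)); last first.
  by apply/funext => y; rewrite /invmx uA !mxE.
apply: (@continuousM _ _ (fun y => (\det (A y))^-1) (fun y => cofactor (A y) j i) x).
  apply: (@continuousV _ _ (fun y => \det (A y)) x).
    by have := uA x; rewrite unitmxE unitfE.
  exact: continuous_det.
apply: (@continuousM _ _ (fun=> _) _ x); first exact: cvg_cst.
apply: continuous_det => k l y.
by under eq_fun do rewrite !mxE; exact: cA.
Qed.

Lemma continuous_mulmx m n p (A : T -> 'M[R]_(m, n)) (B : T -> 'M[R]_(n, p)) :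
  (forall i j, continuous (fun x => A x i j)) ->
  (forall i j, continuous (fun x => B x i j)) ->
  forall i j, continuous (fun x => (A x *m B x) i j).
Proof.
move=> cA cB i j; under eq_fun do rewrite mxE.
apply: continuous_bigsum => k _ x.
by apply: (@continuousM _ _ (fun y => A y i k) (fun y => B y k j) x); [exact: cA|exact: cB].
Qed.

End ContinuousMatrices.

Section Galerkin.
Variable R : realType.

(** Radial retraction on the ball {N <= r}, written without a case distinction. *)
Definition retract (V : lmodType R) (N : V -> R) (r : R) (v : V) : V :=
  (r / Num.max r (N v)) *: v.

Section Retract.
Variables (V : lmodType R) (N : V -> R) (r : R).
Hypothesis (r0 : 0 < r) (NZ : forall t v, 0 <= t -> N (t *: v) = t * N v).

Lemma retract_le v : N (retract N r v) <= r.
Proof.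
have m0 : 0 < Num.max r (N v) by rewrite lt_max r0.
rewrite /retract NZ ?divr_ge0 ?(ltW r0) ?(ltW m0)// mulrAC ler_pdivrMr//.
by rewrite ler_wpM2l ?(ltW r0)// le_max lexx orbT.
Qed.

Lemma retract_id v : N v <= r -> retract N r v = v.
Proof. by move=> Nr; rewrite /retract max_l// divff ?scale1r// gt_eqF. Qed.

End Retract.

(** Systems whose matrices depend on the unknown are solved by freezing the
matrices at the retraction of x to the product of the two balls, where they
are invertible. The a priori bounds then keep the solution in the balls, so
that at a fixed point the retraction does nothing. *)
Lemma galerkin_fixpoint n m (A : 'rV[R]_(n + m) -> 'M[R]_n)
    (B : 'rV[R]_(n + m) -> 'M[R]_m) (f : 'rV[R]_(n + m) -> 'rV[R]_n) (b : 'rV[R]_m)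
    (N1 : 'rV[R]_n -> R) (N2 : 'rV[R]_m -> R) (r1 r2 K : R) :
  0 < r1 -> 0 < r2 ->
  (forall i j, continuous (fun x => A x i j)) ->
  (forall i j, continuous (fun x => B x i j)) ->
  (forall j, continuous (fun x => f x 0 j)) ->
  continuous N1 -> continuous N2 ->
  (forall t c, 0 <= t -> N1 (t *: c) = t * N1 c) ->
  (forall t c, 0 <= t -> N2 (t *: c) = t * N2 c) ->
  (forall c i, N1 c <= r1 -> `|c 0 i| <= K) ->
  (forall c i, N2 c <= r2 -> `|c 0 i| <= K) ->
  (forall x, N1 (lsubmx x) <= r1 -> N2 (rsubmx x) <= r2 ->
     [/\ A x \in unitmx, B x \in unitmx,
       forall c, c *m A x = f x -> N1 c <= r1 &
       forall e, e *m B x = b -> N2 e <= r2]) ->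
  exists x, [/\ N1 (lsubmx x) <= r1, N2 (rsubmx x) <= r2,
    lsubmx x *m A x = f x & rsubmx x *m B x = b].
Proof.
move=> r10 r20 cA cB cf cN1 cN2 N1Z N2Z N1K N2K AB.
pose rho (x : 'rV[R]_(n + m)) :=
  row_mx (retract N1 r1 (lsubmx x)) (retract N2 r2 (rsubmx x)).
have rho1 x : N1 (lsubmx (rho x)) <= r1 by rewrite row_mxKl; exact: retract_le.
have rho2 x : N2 (rsubmx (rho x)) <= r2 by rewrite row_mxKr; exact: retract_le.
have csub k (g : 'I_k -> 'I_(n + m)) (h : 'rV[R]_(n + m) -> 'rV[R]_k) :
    (forall x i, h x 0 i = x 0 (g i)) -> continuous h.
  move=> hg; apply/continuous_row => i; under eq_fun do rewrite hg.
  exact: coord_continuous.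
have cl : continuous (@lsubmx R 1 n m) by apply: csub => x i; rewrite mxE.
have cr : continuous (@rsubmx R 1 n m) by apply: csub => x i; rewrite mxE.
have cretract k (N : 'rV[R]_k -> R) r (g : 'rV[R]_(n + m) -> 'rV[R]_k) :
    0 < r -> continuous N -> continuous g ->
    forall i, continuous (fun x => retract N r (g x) 0 i).
  move=> rr cN cg i x; rewrite /retract; under eq_fun do rewrite mxE.
  have cNg : {for x, continuous (N \o g)} by apply: continuous_comp; [exact: cg|exact: cN].
  apply: (@continuousM _ _ (fun y => r / Num.max r (N (g y))) (fun y => g y 0 i) x).
    apply: (@continuousM _ _ (fun=> r) (fun y => (Num.max r (N (g y)))^-1) x).
      exact: cst_continuous.
    apply: (@continuousV _ _ (fun y => Num.max r (N (g y))) x).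
      by rewrite gt_eqF// lt_max rr.
    by apply: (@continuous_max _ _ (fun=> r) (N \o g) x) => //; exact: cst_continuous.
  by move: x {cNg}; apply/(continuous_row g).1.
have crho : continuous rho.
  apply/continuous_row => i; rewrite /rho; case: (split_ordP i) => j ->.
    by under eq_fun do rewrite row_mxEl; exact: cretract.
  by under eq_fun do rewrite row_mxEr; exact: cretract.
pose F x := row_mx (f (rho x) *m invmx (A (rho x))) (b *m invmx (B (rho x))).
have uA x : A (rho x) \in unitmx by have [] := AB _ (rho1 x) (rho2 x).
have uB x : B (rho x) \in unitmx by have [] := AB _ (rho1 x) (rho2 x).
have crho' (g : 'rV[R]_(n + m) -> R) : continuous g -> continuous (g \o rho).
  by move=> cg x; apply: continuous_comp; [exact: crho|exact: cg].
have cF : continuous F.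
  apply/continuous_row => i; rewrite /F; case: (split_ordP i) => j ->.
    under eq_fun do rewrite row_mxEl.
    apply: (@continuous_mulmx R _ 1 n n (f \o rho)) => k l.
      by rewrite (ord1 k); exact: (crho' (fun x => f x 0 l)).
    apply: (@continuous_invmx _ _ _ (A \o rho)) => // ? ?.
    exact: (crho' (fun x => A x _ _)).
  under eq_fun do rewrite row_mxEr.
  apply: (@continuous_mulmx R _ 1 m m (fun=> b)) => k l; first by move=> x; exact: cst_continuous.
  apply: (@continuous_invmx _ _ _ (B \o rho)) => // ? ?.
  exact: (crho' (fun x => B x _ _)).
have F1 x : N1 (lsubmx (F x)) <= r1.
  have [_ _ + _] := AB _ (rho1 x) (rho2 x); apply.
  by rewrite row_mxKl mulmxKV.
have F2 x : N2 (rsubmx (F x)) <= r2.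
  have [_ _ _] := AB _ (rho1 x) (rho2 x); apply.
  by rewrite row_mxKr mulmxKV.
have [x xF] : exists x, F x = x.
  apply: (@brouwer _ _ _ K cF) => x i; rewrite -[F x]hsubmxK.
  by case: (split_ordP i) => j ->; rewrite ?row_mxEl ?row_mxEr; [exact: N1K|exact: N2K].
have l1 : N1 (lsubmx x) <= r1 by have := F1 x; rewrite xF.
have l2 : N2 (rsubmx x) <= r2 by have := F2 x; rewrite xF.
have xrho : rho x = x by rewrite /rho !retract_id// hsubmxK.
have xl : lsubmx x = f (rho x) *m invmx (A (rho x)) by rewrite -[in LHS]xF row_mxKl.
have xr : rsubmx x = b *m invmx (B (rho x)) by rewrite -[in LHS]xF row_mxKr.
exists x; split => //.
  by rewrite xl -[A x]/(A x) -{3}xrho mulmxKV// xrho.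
by rewrite xr -{2}xrho mulmxKV.
Qed.

End Galerkin.

(** * Linear algebra of spanning families and kernels *)

Section LinearAlgebra.
Context {R : realType}.

(** Discard vectors one at a time: when the family is dependent modulo [N],
some [b i] is a combination of the others modulo [N]. *)
Lemma exists_free_modulo (U : lmodType R) (N : set U) n (b : 'I_n -> U) :
  N 0 -> (forall (a : R) u v, N u -> N v -> N (a *: u + v)) ->
  exists m (f : 'I_m -> 'I_n),
    (forall c : 'I_m -> R, N (\sum_i c i *: b (f i)) -> forall i, c i = 0) /\
    (forall c : 'I_n -> R, exists c' : 'I_m -> R,
       N (\sum_i c i *: b i - \sum_i c' i *: b (f i))).
Proof.
move=> N0 NL; elim: n b => [|n IHn] b.
  exists 0%N, id; split; first by move=> c _ [].
  by move=> c; exists c; rewrite subrr.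
have [free|] := pselect (forall c : 'I_n.+1 -> R, N (\sum_i c i *: b i) -> forall i, c i = 0).
  by exists n.+1, id; split => // c; exists c; rewrite subrr.
move=> /existsNP[c /not_implyP[Nc /existsNP[i /eqP ci]]].
have [m [f [ffree fspan]]] := IHn (b \o lift i).
exists m, (lift i \o f); split => // c1.
have [c' c'P] := fspan (fun k => c1 (lift i k) - c1 i / c i * c (lift i k)).
exists c'; rewrite -(subrK (\sum_k (c1 (lift i k) - c1 i / c i * c (lift i k)) *: b (lift i k))
  (\sum_i0 c1 i0 *: b i0)) -addrA.
suff -> : \sum_i0 c1 i0 *: b i0 -
    \sum_k (c1 (lift i k) - c1 i / c i * c (lift i k)) *: b (lift i k) =
    (c1 i / c i) *: \sum_i c i *: b i by exact: NL.
rewrite (bigD1_ord i)//= [in RHS](bigD1_ord i)//= scalerDr scalerA divfK// -addrA; congr (_ + _).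
under [X in _ - X]eq_bigr do rewrite scalerBl.
rewrite sumrB opprB addrCA subrr addr0 scaler_sumr.
by apply: eq_bigr => k _; rewrite scalerA.
Qed.

Lemma col_range_of_kernel n k (B : 'M[R]_(n, k)) (L : 'cV[R]_n) :
  (forall c : 'rV[R]_n, c *m B = 0 -> c *m L = 0) -> exists p, L = B *m p.
Proof.
move=> BL; have /submxP[D LD] : (L^T <= B^T)%MS.
  rewrite submxE; apply/eqP/trmx_inj; rewrite trmx_mul trmxK trmx0.
  apply/row_matrixP => i; rewrite row_mul row0 BL// -row_mul.
  by rewrite -[B]trmxK -trmx_mul trmxK mulmx_coker trmx0 row0.
by exists D^T; rewrite -[L]trmxK LD trmx_mul trmxK.
Qed.

End LinearAlgebra.

(** * Measurability and iterated integrals on row vectors *)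

Section RowMeasure.
Context {R : realType}.

(** The sigma-algebra is the product one, so an open set has to be written as
a countable union of boxes, here with rational centres and sides 2 / (k + 1). *)
Lemma open_measurable_row n (A : set 'rV[R]_n) : open A -> measurable A.
Proof.
move=> oA.
pose box (qk : 'rV[rat]_n * nat) : set 'rV[R]_n :=
  [set x | forall i, [set` `]ratr (qk.1 0 i) - qk.2.+1%:R^-1, ratr (qk.1 0 i) + qk.2.+1%:R^-1[] (x 0 i)].
have mbox qk : measurable (box qk).
  rewrite (_ : box qk = \bigcap_(i in [set: 'I_n]) ((fun x : 'rV[R]_n => x 0 i : measurableTypeR R) @^-1`
      [set` `]ratr (qk.1 0 i) - qk.2.+1%:R^-1, ratr (qk.1 0 i) + qk.2.+1%:R^-1[])).
    apply: fin_bigcap_measurable => // i _; rewrite -[X in measurable X]setTI.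
    by apply: measurable_coord => //; exact: measurable_itv.
  by apply/seteqP; split => [x bx i _|x bx i]; [exact: bx|exact: (bx i)].
pose F qk := if `[< box qk `<=` A >] then box qk else set0.
rewrite (_ : A = \bigcup_qk F qk).
  apply: countable_bigcupT_measurable => [|qk]; first exact: countableP.
  rewrite /F.
  by case: ifPn.
apply/seteqP; split => [x Ax|x [qk _]]; last first.
  by rewrite /F; case: asboolP => // + bx; apply.
have /nbhs_row[e e0 eA] : nbhs x A by exact: open_nbhs_nbhs.
have [k ke] : exists k : nat, 2 / e < k.+1%:R.
  by exists (Num.truncn (2 / e)); exact: truncnS_gt.
pose h : R := k.+1%:R^-1.
have h0 : 0 < h by rewrite invr_gt0.
have he : 2 * h < e by rewrite /h ltr_pdivrMr// mulrC -ltr_pdivrMr.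
have /choice[q qP] : forall i, exists q : rat, ratr q \in `](x 0 i - h), (x 0 i + h)[.
  move=> i; have /rat_in_itvoo[q Hq] : x 0 i - h < x 0 i + h.
    by move: h0; lra.
  by exists q.
have bxq (y : 'rV[R]_n) : box (\row_i q i, k) y -> A y.
  move=> by_; apply: eA => i; have := by_ i; have := qP i.
  rewrite /= !in_itv /= mxE -/h ltr_norml.
  move: (ratr _) (x 0 i) (y 0 i) => a b c /andP[? ?] /andP[? ?]; apply/andP; split; lra.
exists (\row_i q i, k) => //; rewrite /F asboolT// => i; have := qP i.
rewrite /= !in_itv /= mxE -/h.
by move: (ratr _) (x 0 i) => a b /andP[? ?]; apply/andP; split; lra.
Qed.

Lemma continuous_measurable_row n (f : 'rV[R]_n -> R) :
  continuous f -> measurable_fun [set: 'rV[R]_n] f.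
Proof.
move=> /continuousP cf; apply: (measurability _ (measurable_realfun.RGenOpens.measurableE R)).
move=> _ [_ [a [b ->]] <-]; rewrite setTI.
by apply: open_measurable_row; apply: cf; exact: interval_open.
Qed.

Lemma ge0_integral_row_cons n (f : 'rV[R]_n.+1 -> \bar R) :
  measurable_fun [set: 'rV[R]_n.+1] f -> (forall x, (0 <= f x)%E) ->
  (\int[lebesgue_row R n.+1]_x f x =
   \int[lebesgue_measure]_a \int[lebesgue_row R n]_v f (@row_cons R n (a, v)))%E.
Proof.
move=> mf f0; have mc := @measurable_row_cons R n.
rewrite [LHS](_ : _ = \int[lebesgue_measure \x lebesgue_row R n]_z (f \o @row_cons R n) z)%E.
  rewrite fubini_tonelli1 => [//||x]; [exact: (measurableT_comp mf mc)|exact: f0].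
have := @ge0_integral_pushforward _ _ _ _ R (@row_cons R n) mc
  (lebesgue_measure \x lebesgue_row R n)%E setT f measurableT mf (fun y _ => f0 y).
by rewrite preimage_setT.
Qed.

Lemma bounded_row_measure n (A : set 'rV[R]_n) : measurable A -> bounded_set A ->
  (lebesgue_row R n A < +oo)%E.
Proof.
move=> mA [M0 [_ /(_ (M0 + 1))]]; rewrite ltrDl => /(_ ltr01) MA.
pose M := M0 + 1.
pose B : set 'rV[R]_n := [set x | forall i, [set` `[- M, M]] (x 0 i)].
have mB : measurable B.
  rewrite (_ : B = \bigcap_(i in [set: 'I_n]) ((fun x : 'rV[R]_n => x 0 i : measurableTypeR R) @^-1`
      [set` `[- M, M]])).
    apply: fin_bigcap_measurable => // i _; rewrite -[X in measurable X]setTI.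
    by apply: measurable_coord => //; exact: measurable_itv.
  by apply/seteqP; split => [x bx i _|x bx i]; [exact: bx|exact: (bx i)].
have AB : A `<=` B.
  move=> x /MA xM i; rewrite /= in_itv /= -ler_norml; apply: le_trans xM.
  by rewrite [leRHS]/Num.norm /= mx_normrE; apply/bigmax_geP; right; exists (0, i).
apply: (@le_lt_trans _ _ (lebesgue_row R n B)).
  by apply: le_measure => //; rewrite inE.
have -> := @lebesgue_row_box R n (fun=> [set` `[- M, M]]) (fun=> measurable_itv _).
suff /andP[] : (0 <= \prod_(i < n) @lebesgue_measure R [set` `[(- M)%R, M%R]] < +oo)%E by [].
elim/big_rec: _ => [|i x _ /andP[x0 xoo]]; first by rewrite lee01 ltry.
have lM : (@lebesgue_measure R [set` `[(- M)%R, M%R]] < +oo)%E.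
  by rewrite lebesgue_measure_itv /=; case: ifP => _; rewrite ?ltry// -EFinD ltry.
by rewrite mule_ge0// lte_mul_pinfty// ge0_fin_numE.
Qed.

End RowMeasure.

(** * Inequalities between integrals *)

Section RealInequalities.
Context {R : realType}.

Lemma young (a b t : R) : 0 < t -> `|a * b| <= (t * a ^+ 2 + t^-1 * b ^+ 2) / 2.
Proof.
move=> t0; have t'0 : 0 < t^-1 by rewrite invr_gt0.
have tt : t * t^-1 = 1 by rewrite divff// gt_eqF.
have sq (c : R) : 0 <= (t * a + c * b) ^+ 2 * t^-1 by rewrite mulr_ge0 ?sqr_ge0// ltW.
have e (c : R) : c ^+ 2 = 1 -> (t * a + c * b) ^+ 2 * t^-1 = t * a ^+ 2 + 2 * c * (a * b) + t^-1 * b ^+ 2.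
  move=> c2; transitivity (t * (t * t^-1) * a ^+ 2 + 2 * c * (t * t^-1) * (a * b) + c ^+ 2 * t^-1 * b ^+ 2).
    by ring.
  by rewrite tt c2; ring.
have := sq 1; have := sq (-1); rewrite !e ?sqrrN ?expr1n// => h1 h2.
rewrite ler_norml; move: h1 h2; move: (t * _) (t^-1 * _) (a * b) => p q r h1 h2.
by apply/andP; split; lra.
Qed.

(** Optimizing Young's inequality over t; when A or B is zero a suitable t
makes the right-hand side smaller than any positive x. *)
Lemma le_sqrt_of_young (A B x : R) : 0 <= A -> 0 <= B ->
  (forall t, 0 < t -> x <= (t * A + t^-1 * B) / 2) -> x <= Num.sqrt A * Num.sqrt B.
Proof.
move=> A0 B0 xAB.
have [A0'|A_gt0] := eqVneq A 0.
  rewrite A0' sqrtr0 mul0r leNgt; apply/negP => x0.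
  have [B0'|B_gt0] := eqVneq B 0.
    by have := xAB 1 ltr01; rewrite A0' B0' !mulr0 addr0 mul0r leNgt x0.
  have B1 : 0 < B by rewrite lt_def B_gt0.
  have := xAB (B / x); rewrite divr_gt0// => /(_ isT).
  by rewrite A0' mulr0 add0r invf_div divfK//; lra.
have [B0'|B_gt0] := eqVneq B 0.
  rewrite B0' sqrtr0 mulr0 leNgt; apply/negP => x0.
  have A1 : 0 < A by rewrite lt_def A_gt0.
  have := xAB (x / A); rewrite divr_gt0// => /(_ isT).
  by rewrite B0' mulr0 addr0 divfK//; lra.
have sA : 0 < Num.sqrt A by rewrite sqrtr_gt0 lt_def A_gt0.
have sB : 0 < Num.sqrt B by rewrite sqrtr_gt0 lt_def B_gt0.
have := xAB (Num.sqrt B / Num.sqrt A); rewrite divr_gt0// => /(_ isT).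
have -> : Num.sqrt B / Num.sqrt A * A = Num.sqrt A * Num.sqrt B.
  by rewrite -{2}(sqr_sqrtr A0) expr2 mulrA divfK ?gt_eqF// mulrC.
have -> : (Num.sqrt B / Num.sqrt A)^-1 * B = Num.sqrt A * Num.sqrt B.
  by rewrite invf_div -{2}(sqr_sqrtr B0) expr2 mulrA divfK ?gt_eqF.
by move: (Num.sqrt A * Num.sqrt B) => y; lra.
Qed.

End RealInequalities.

Section Integration.
Context d (T : measurableType d) (R : realType) (mu : {measure set T -> \bar R}).
Variables (D : set T) (mD : measurable D).
Implicit Types f g h F G : T -> R.

Local Notation intg f := (mu.-integrable D (EFin \o f)).

Lemma intg_measurable f : intg f -> measurable_fun D f.
Proof. by move=> /measurable_int/measurable_EFinP. Qed.

Lemma intgZ (k : R) f : intg f -> intg (fun x => k * f x).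
Proof. by move=> fi; exact: (integrableZl mD k fi). Qed.

Lemma intgD f g : intg f -> intg g -> intg (fun x => f x + g x).
Proof. by move=> fi gi; exact: (integrableD mD fi gi). Qed.

Lemma intgB f g : intg f -> intg g -> intg (fun x => f x - g x).
Proof. by move=> fi gi; exact: (integrableB mD fi gi). Qed.

Lemma intg_sum I (r : seq I) (P : pred I) (f : I -> T -> R) :
  (forall i, P i -> intg (f i)) -> intg (fun x => \sum_(i <- r | P i) f i x).
Proof.
move=> fi; elim: r => [|i r IHr].
  have -> : (fun x => \sum_(i <- [::] | P i) f i x) = cst 0 :> (T -> R).
    by apply/funext => x; rewrite big_nil.
  exact: integrable0.
have -> : (fun x => \sum_(j <- i :: r | P j) f j x) =
    if P i then (fun x => f i x + \sum_(j <- r | P j) f j x)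
    else (fun x => \sum_(j <- r | P j) f j x) :> (T -> R).
  by apply/funext => x; rewrite big_cons; case: ifP.
by case: ifPn => // Pi; apply: intgD => //; exact: fi.
Qed.

Lemma Rintegral_sum I (r : seq I) (P : pred I) (f : I -> T -> R) :
  (forall i, P i -> intg (f i)) ->
  \int[mu]_(x in D) (\sum_(i <- r | P i) f i x) =
  \sum_(i <- r | P i) \int[mu]_(x in D) f i x.
Proof.
move=> fi; elim: r => [|i r IHr].
  rewrite big_nil; under eq_Rintegral => x _ do rewrite big_nil.
  by rewrite /Rintegral integral0.
rewrite big_cons; under eq_Rintegral => x _ do rewrite big_cons.
case: ifPn => // Pi; rewrite RintegralD ?IHr//; [exact: fi|exact: intg_sum].
Qed.

Lemma ge0_intg f : measurable_fun D f -> (forall x, D x -> 0 <= f x) ->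
  (\int[mu]_(x in D) (f x)%:E < +oo)%E -> intg f.
Proof.
move=> mf f0 foo; apply/integrableP; split; first exact/measurable_EFinP.
by under eq_integral => x /[!inE] Dx do rewrite /= ger0_norm ?f0//.
Qed.

Lemma ae_le_intg h F : measurable_fun D h -> intg F -> (forall x, D x -> 0 <= F x) ->
  (\forall x \ae mu, D x -> `|h x| <= F x) ->
  intg h /\ `|\int[mu]_(x in D) h x| <= \int[mu]_(x in D) F x.
Proof.
move=> mh iF F0 hF.
have le_int : (\int[mu]_(x in D) `|(h x)%:E| <= \int[mu]_(x in D) (F x)%:E)%E.
  apply: ae_ge0_le_integral => //.
  - by apply: measurableT_comp => //; exact/measurable_EFinP.
  - exact/measurable_EFinP/intg_measurable.
have Ffin : (\int[mu]_(x in D) (F x)%:E \is a fin_num)%E by exact: integrable_fin_num.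
have ih : intg h.
  apply/integrableP; split; first exact/measurable_EFinP.
  by apply: (le_lt_trans le_int); rewrite -ge0_fin_numE// integral_ge0// => x /F0.
split => //; apply: (le_trans (le_normr_Rintegral mD ih)).
by apply: fine_le => //; rewrite ge0_fin_numE ?integral_ge0//; case/integrableP: ih.
Qed.

(** Cauchy-Schwarz in a form that needs no product structure of h: a pointwise
Young bound for every t is integrated, and t is optimized afterwards. This
covers weighted products, matrix-valued coefficients and sums at once. *)
Lemma ae_young_intg h F G : measurable_fun D h -> intg F -> intg G ->
  (forall x, D x -> 0 <= F x) -> (forall x, D x -> 0 <= G x) ->
  (\forall x \ae mu, D x -> forall t, 0 < t -> `|h x| <= (t * F x + t^-1 * G x) / 2) ->
  intg h /\ `|\int[mu]_(x in D) h x| <=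
    Num.sqrt (\int[mu]_(x in D) F x) * Num.sqrt (\int[mu]_(x in D) G x).
Proof.
move=> mh iF iG F0 G0 hFG.
have key t : 0 < t -> intg h /\ `|\int[mu]_(x in D) h x| <=
    (t * \int[mu]_(x in D) F x + t^-1 * \int[mu]_(x in D) G x) / 2.
  move=> t0; have t'0 : 0 < t^-1 by rewrite invr_gt0.
  have itF : intg (fun x => t * F x) by exact: intgZ.
  have itG : intg (fun x => t^-1 * G x) by exact: intgZ.
  have itFG : intg (fun x => t * F x + t^-1 * G x) by exact: intgD.
  have [|||ih le] := @ae_le_intg h (fun x => (t * F x + t^-1 * G x) / 2) mh.
  - by under eq_fun do rewrite mulrC; exact: intgZ.
  - by move=> x Dx; rewrite divr_ge0// addr_ge0// mulr_ge0 ?F0 ?G0// ltW.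
  - by apply: filterS hFG => x hx Dx; exact: hx.
  split => //; apply: (le_trans le).
  by rewrite RintegralZr// RintegralD// !RintegralZl.
split; first by have [] := key 1 ltr01.
apply: le_sqrt_of_young; rewrite ?Rintegral_ge0//.
by move=> t t0; have [] := key t t0.
Qed.

Definition lnorm2 f := Num.sqrt (\int[mu]_(x in D) (f x ^+ 2)).
Definition lnorm4 f := Num.sqrt (Num.sqrt (\int[mu]_(x in D) (f x ^+ 4))).

Lemma intg_mul f g : measurable_fun D f -> measurable_fun D g ->
  intg (fun x => f x ^+ 2) -> intg (fun x => g x ^+ 2) ->
  intg (fun x => f x * g x) /\ `|\int[mu]_(x in D) (f x * g x)| <= lnorm2 f * lnorm2 g.
Proof.
move=> mf mg if2 ig2; apply: ae_young_intg => //.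
- exact: measurable_funM.
- by move=> x _; exact: sqr_ge0.
- by move=> x _; exact: sqr_ge0.
- by apply: aeW => x _ t; exact: young.
Qed.

Lemma lnorm2_triangle f g : measurable_fun D f -> measurable_fun D g ->
  intg (fun x => f x ^+ 2) -> intg (fun x => g x ^+ 2) ->
  intg (fun x => (f x + g x) ^+ 2) /\ lnorm2 (fun x => f x + g x) <= lnorm2 f + lnorm2 g.
Proof.
move=> mf mg if2 ig2; have [ifg le_fg] := intg_mul mf mg if2 ig2.
have i2fg : intg (fun x => 2 * (f x * g x)) by exact: intgZ.
have i1 : intg (fun x => f x ^+ 2 + 2 * (f x * g x)) by exact: intgD.
have E : (fun x => (f x + g x) ^+ 2) = (fun x => f x ^+ 2 + 2 * (f x * g x) + g x ^+ 2).
  by apply/funext => x; ring.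
split; first by rewrite E; exact: intgD.
have s0 : 0 <= lnorm2 f + lnorm2 g by rewrite addr_ge0 ?sqrtr_ge0.
rewrite -[leRHS]ger0_norm// -[leRHS]sqrtr_sqr ler_wsqrtr// E RintegralD// RintegralD// RintegralZl//.
rewrite sqrrD !sqr_sqrtr ?Rintegral_ge0//; do ?by move=> x _; exact: sqr_ge0.
rewrite lerD2r lerD2l -[leRHS]mulr_natl ler_wpM2l//.
exact: le_trans (ler_norm _) le_fg.
Qed.

Lemma intg_mul3 f g h : measurable_fun D f -> measurable_fun D g -> measurable_fun D h ->
  intg (fun x => f x ^+ 4) -> intg (fun x => g x ^+ 4) -> intg (fun x => h x ^+ 2) ->
  intg (fun x => f x * g x * h x) /\
  `|\int[mu]_(x in D) (f x * g x * h x)| <= lnorm4 f * lnorm4 g * lnorm2 h.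
Proof.
move=> mf mg mh if4 ig4 ih2.
have sqE k : (fun x : T => (k x ^+ 2) ^+ 2) = (fun x => k x ^+ 4) :> (T -> R).
  by apply/funext => x; rewrite -exprM.
have [i2 le2] : intg (fun x => f x ^+ 2 * g x ^+ 2) /\
    `|\int[mu]_(x in D) (f x ^+ 2 * g x ^+ 2)| <=
      lnorm2 (fun x => f x ^+ 2) * lnorm2 (fun x => g x ^+ 2).
  by apply: intg_mul; rewrite ?sqE//; exact: measurable_funX.
have fgE : (fun x => (f x * g x) ^+ 2) = (fun x => f x ^+ 2 * g x ^+ 2).
  by apply/funext => x; rewrite exprMn.
have [|//|||i3 le3] := @intg_mul (fun x => f x * g x) h; rewrite ?fgE//.
  exact: measurable_funM.
split => //; apply: (le_trans le3); rewrite ler_wpM2r ?sqrtr_ge0//.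
rewrite /lnorm2 fgE /lnorm4 -sqrtrM ?sqrtr_ge0// ler_wsqrtr//.
apply: (le_trans (ler_norm _)); apply: (le_trans le2).
by rewrite /lnorm2 !sqE.
Qed.

End Integration.

(** * Slices of compactly supported functions *)

Section CompactSupport.
Context {R : realType}.

Definition box_support n (f : 'rV[R]_n -> R) : Prop :=
  exists r : R, forall (x : 'rV[R]_n) i, r < `|x 0 i| -> f x = 0.

Definition C1c n (f : 'rV[R]_n -> R) : Prop :=
  [/\ continuous f,
    forall i, (forall x, derivable f x (delta_mx 0 i : 'rV[R]_n)) /\ continuous (partial i f) &
    box_support f].

Lemma Cc_integrable n (f : 'rV[R]_n -> R) : continuous f -> box_support f ->
  (lebesgue_row R n).-integrable setT (EFin \o f).
Proof.
move=> cf [r rf].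
pose B : set 'rV[R]_n := [set x | forall i, [set` `[- r, r]] (x ord0 i)].
have cB : compact B by apply: (@rV_compact _ _ (fun=> _)) => i; exact: segment_compact.
have clB : closed B by apply: compact_closed => //; exact: norm_hausdorff.
have mB : measurable B.
  by rewrite -[B]setCK; apply: measurableC; apply: open_measurable_row; exact: closed_openC.
have Boo : (lebesgue_row R n B < +oo)%E by apply: bounded_row_measure => //; exact: compact_bounded.
have mf := continuous_measurable_row cf.
have : (lebesgue_row R n).-integrable B (EFin \o f).
  apply: measurable_bounded_integrable => //; first exact: measurable_funTS.
  have : compact (f @` B).
    by apply: continuous_compact => //; exact: continuous_subspaceT.
  move=> /compact_bounded[M [Mr MB]]; exists M; split => // y My x Bx.
  by apply: (MB _ My); exists x.
rewrite integrable_mkcond// => iB.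
rewrite (_ : EFin \o f = (EFin \o f) \_ B)//; apply/funext => x.
rewrite patchE; case: ifPn => //= /negP xB; congr EFin.
have /existsNP[i xi] : ~ (forall i, [set` `[- r, r]] (x ord0 i)).
  by move=> H; apply: xB; rewrite inE.
apply: (rf x i); rewrite ltNge; apply/negP => xr; apply: xi.
by rewrite /= in_itv /= -ler_norml.
Qed.

Lemma row_cons_shift0 n (h a : R) (v : 'rV[R]_n) :
  row_cons (h + a, v) = h *: delta_mx 0 ord0 + row_cons (a, v).
Proof.
apply/rowP => i; rewrite !mxE; case: unliftP => [j ->|->] /=.
  by rewrite mulr0 add0r.
by rewrite mulr1.
Qed.

Lemma row_cons_shift n (h a : R) (v : 'rV[R]_n) i :
  row_cons (a, h *: delta_mx 0 i + v) = h *: delta_mx 0 (lift ord0 i) + row_cons (a, v).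
Proof.
apply/rowP => k; rewrite !mxE; case: unliftP => [j ->|->] /=.
  by rewrite !mxE (inj_eq lift_inj).
by rewrite mulr0 add0r.
Qed.

Lemma continuous_row_consr n a : continuous (fun v => @row_cons R n (a, v)).
Proof.
apply/continuous_row => i; have [j ij|i0] := unliftP ord0 i.
  have -> : (fun v => @row_cons R n (a, v) 0 i) = (fun v => v 0 j).
    by apply/funext => p; rewrite mxE ij liftK.
  exact: coord_continuous.
have -> : (fun v => @row_cons R n (a, v) 0 i) = cst a.
  by apply/funext => p; rewrite mxE i0 unlift_none.
exact: cst_continuous.
Qed.

Lemma continuous_row_consl n v : continuous (fun a : R => @row_cons R n (a, v)).
Proof.
apply/continuous_row => i; have [j ij|i0] := unliftP ord0 i.
  have -> : (fun a : R => @row_cons R n (a, v) 0 i) = cst (v 0 j).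
    by apply/funext => p; rewrite mxE ij liftK.
  exact: cst_continuous.
have -> : (fun a : R => @row_cons R n (a, v) 0 i) = id.
  by apply/funext => p; rewrite mxE i0 unlift_none.
by move=> x; exact: cvg_id.
Qed.

Section Slices.
Variables (n : nat) (f : 'rV[R]_n.+1 -> R).
Hypothesis cf : C1c f.

Lemma continuous_slice (g : 'rV[R]_n.+1 -> R) a :
  continuous g -> continuous (fun v => g (@row_cons R n (a, v))).
Proof.
move=> cg v; apply: (@continuous_comp _ _ _ (fun v => @row_cons R n (a, v)) g); last exact: cg.
exact: continuous_row_consr.
Qed.

Lemma continuous_line (g : 'rV[R]_n.+1 -> R) v :
  continuous g -> continuous (fun a => g (@row_cons R n (a, v))).
Proof.
move=> cg a; apply: (@continuous_comp _ _ _ (fun a => @row_cons R n (a, v)) g); last exact: cg.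
exact: continuous_row_consl.
Qed.

Lemma slice_quotient a v i :
  (fun h : R => h^-1 *: (((fun v => f (@row_cons R n (a, v))) \o shift v) (h *: delta_mx 0 i)
     - f (@row_cons R n (a, v)))) =
  (fun h : R => h^-1 *: ((f \o shift (row_cons (a, v))) (h *: delta_mx 0 (lift ord0 i))
     - f (row_cons (a, v)))).
Proof. by apply/funext => h; rewrite /= row_cons_shift. Qed.

Lemma partial_slice a i :
  partial i (fun v => f (@row_cons R n (a, v))) =
  (fun v => partial (lift ord0 i) f (row_cons (a, v))).
Proof. by apply/funext => v; rewrite /partial /derive slice_quotient. Qed.

Lemma C1c_slice a : C1c (fun v => f (@row_cons R n (a, v))).
Proof.
have [cf0 df [r rf]] := cf; split.
- exact: continuous_slice.
- move=> i; have [dfi cdfi] := df (lift ord0 i); split.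
    by move=> v; have := dfi (row_cons (a, v)); rewrite /derivable slice_quotient.
  by rewrite partial_slice; exact: continuous_slice.
- exists r => v i vi; apply: (rf _ (lift ord0 i)).
  by rewrite mxE liftK.
Qed.

Lemma line_derive v a : derivable (fun b => f (@row_cons R n (b, v)) : R^o) a 1 /\
  derive1 (fun b => f (@row_cons R n (b, v)) : R^o) a = partial ord0 f (row_cons (a, v)).
Proof.
have [_ df _] := cf; have [+ _] := df ord0 => /(_ (row_cons (a, v))).
have E : (fun h : R => h^-1 *: (((fun b => f (@row_cons R n (b, v)) : R^o) \o shift a) (h *: 1) -
    f (@row_cons R n (a, v)) : R^o)) =
  (fun h : R => h^-1 *: ((f \o shift (row_cons (a, v))) (h *: delta_mx 0 ord0) - f (row_cons (a, v)))).
  by apply/funext => h; rewrite /= -row_cons_shift0 /GRing.scale /= mulr1.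
split; first by rewrite /derivable E.
by rewrite derive1E /partial /derive E.
Qed.

End Slices.

End CompactSupport.

(** * Ladyzhenskaya's inequality for smooth functions *)

Section Ladyzhenskaya.
Context {R : realType}.
Local Notation leb := (@lebesgue_measure R).

(** The fundamental theorem of calculus for f^2 on [a, t], starting at a
point [a] to the left of the support. *)
Lemma sqr_le_integral_derive (f df : R -> R) (r : R) :
  (forall x, derivable (f : R -> R^o) x 1 /\ derive1 (f : R -> R^o) x = df x) ->
  continuous df -> (forall x, r < `|x| -> f x = 0) ->
  forall t, ((f t ^+ 2)%:E <= \int[leb]_s `|2 * f s * df s|%:E)%E.
Proof.
move=> dfE cdf fr t.
have isd (x : R) : is_derive x 1 (f : R -> R^o) (df x).
  by have [d1 d2] := dfE x; split => //; rewrite -derive1E.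
have cf : continuous f.
  by move=> x; apply: (@differentiable_continuous _ _ (R^o : normedModType R)); apply/derivable1_diffP; have [] := dfE x.
pose F x := f x * f x.
have isF (x : R) : is_derive x 1 (F : R -> R^o) (2 * f x * df x).
  have := is_deriveM (isd x) (isd x); rewrite (_ : _ *: _ + _ *: _ = 2 * f x * df x)//.
  by rewrite /GRing.scale /=; ring.
pose a := - (`|r| + `|t| + 1).
have at_ : a < t by have := ler_norm (- t); have := normr_ge0 r; rewrite normrN /a; lra.
have fa0 : f a = 0.
  apply: fr; rewrite normrN; have := ler_norm r; have := normr_ge0 t.
  by have := ler_norm (`|r| + `|t| + 1); lra.
have cg : continuous (fun x => 2 * f x * df x).
  move=> x; apply: (@continuousM _ _ (fun x => 2 * f x) df x); last exact: cdf.
  by apply: (@continuousM _ _ (fun=> 2) f x); [exact: cst_continuous|exact: cf].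
have cF : continuous F.
  by move=> x; apply: (@continuousM _ _ f f x); exact: cf.
have mg : measurable_fun setT (fun x => 2 * f x * df x) by exact: continuous_measurable_fun.
have ftc := @continuous_FTC2 R (fun x => 2 * f x * df x) F a t at_.
have -> : (f t ^+ 2)%:E = ((F t)%:E - (F a)%:E)%E.
  by rewrite /F fa0 mulr0 sube0 expr2.
rewrite -ftc; last first.
- by move=> x _; rewrite derive1E; have [] := isF x.
- split.
  + by move=> x _; have [] := isF x.
  + exact: (cvg_at_right_filter (cF a)).
  + exact: (cvg_at_left_filter (cF t)).
- exact: continuous_subspaceT.
apply: (@le_trans _ _ (\int[leb]_(x in `[a, t]) `|2 * f x * df x|%:E)%E).
  apply: (le_trans (lee_abs _)); apply: le_abse_integral => //.
  exact/measurable_EFinP/measurable_funTS.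
apply: ge0_subset_integral => //; first by do 2 apply: measurableT_comp => //.
Qed.

End Ladyzhenskaya.

Section Ladyzhenskaya2.
Context {R : realType}.
Local Notation leb := (@lebesgue_measure R).

Lemma continuous_expn (T : topologicalType) (f : T -> R) m :
  continuous f -> continuous (fun x => f x ^+ m).
Proof.
move=> cf x; apply: (@continuous_comp _ _ _ f (fun y : R => y ^+ m)); first exact: cf.
exact: exprn_continuous.
Qed.

Lemma line_sqr_le n (f : 'rV[R]_n.+1 -> R) a (v : 'rV[R]_n) : C1c f ->
  ((f (row_cons (a, v)) ^+ 2)%:E <=
   \int[leb]_s `|2 * f (row_cons (s, v)) * partial ord0 f (row_cons (s, v))|%:E)%E.
Proof.
move=> cf; have [_ df [r rf]] := cf.
apply: (@sqr_le_integral_derive _ (fun b => f (row_cons (b, v)))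
  (fun b => partial ord0 f (row_cons (b, v))) r).
- exact: line_derive.
- by apply: (@continuous_line R n (partial ord0 f)); have [] := df ord0.
- by move=> x rx; apply: (rf _ ord0); rewrite mxE unlift_none.
Qed.

Lemma integral_row0 (k : 'rV[R]_0 -> \bar R) :
  (\int[lebesgue_row R 0]_v k v = k 0%R)%E.
Proof.
have mk : measurable_fun [set: 'rV[R]_0] k.
  have -> : k = cst (k 0) by apply/funext => v; rewrite [v]thinmx0.
  exact: measurable_cst.
rewrite [LHS]/= (@integral_dirac _ _ (0 : 'rV[R]_0) R _ measurableT _ mk).
by rewrite diracE mem_set// mul1e.
Qed.

Definition pt2 (x y : R) : 'rV[R]_2 := row_cons (x, row_cons (y, 0)).

Lemma continuous_integral_row_cons n (k : 'rV[R]_n.+1 -> R) : continuous k ->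
  (forall x, 0 <= k x) ->
  (\int[lebesgue_row R n.+1]_x (k x)%:E =
   \int[leb]_a \int[lebesgue_row R n]_v (k (@row_cons R n (a, v)))%:E)%E.
Proof.
move=> ck k0; apply: ge0_integral_row_cons; last by move=> x; rewrite lee_fin.
by apply/measurable_EFinP; exact: continuous_measurable_row.
Qed.

Lemma continuous_integral_row2 (k : 'rV[R]_2 -> R) : continuous k ->
  (forall x, 0 <= k x) ->
  (\int[lebesgue_row R 2]_x (k x)%:E = \int[leb]_x \int[leb]_y (k (pt2 x y))%:E)%E.
Proof.
move=> ck k0; rewrite continuous_integral_row_cons//; apply: eq_integral => x _.
rewrite continuous_integral_row_cons//; last exact: continuous_slice.
by apply: eq_integral => y _; rewrite integral_row0.
Qed.

Lemma measurable_pt2 (k : 'rV[R]_2 -> R) : continuous k ->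
  measurable_fun setT (fun p : measurableTypeR R * measurableTypeR R => (k (pt2 p.1 p.2))%:E).
Proof.
move=> ck; apply/measurable_EFinP.
apply: (@measurableT_comp _ _ _ _ _ _ k _ (fun p : measurableTypeR R * measurableTypeR R => pt2 p.1 p.2)).
  exact: continuous_measurable_row.
apply: (@measurableT_comp _ _ _ _ _ _ (@row_cons R 1) _
  (fun p : measurableTypeR R * measurableTypeR R => (p.1, row_cons (p.2, 0)))).
  exact: measurable_row_cons.
apply/measurable_fun_pairP; split => /=; first exact: measurable_fst.
apply: (@measurableT_comp _ _ _ _ _ _ (@row_cons R 0) _
  (fun p : measurableTypeR R * measurableTypeR R => (p.2, 0))).
  exact: measurable_row_cons.
by apply/measurable_fun_pairP; split => /=; [exact: measurable_snd|exact: measurable_cst].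
Qed.

(** The mechanism of Gagliardo's argument: a function dominated by a function
of y times a function of x has an integral at most the product of the
integrals. *)
Lemma integral_row2_le_product (f k0 k1 : 'rV[R]_2 -> R) :
  continuous f -> continuous k0 -> continuous k1 ->
  (forall x, 0 <= f x) -> (forall x, 0 <= k0 x) -> (forall x, 0 <= k1 x) ->
  (forall x y, ((f (pt2 x y))%:E <=
    \int[leb]_s (k0 (pt2 s y))%:E * \int[leb]_s (k1 (pt2 x s))%:E)%E) ->
  (\int[lebesgue_row R 2]_x (f x)%:E <=
   \int[lebesgue_row R 2]_x (k0 x)%:E * \int[lebesgue_row R 2]_x (k1 x)%:E)%E.
Proof.
move=> cf ck0 ck1 f_ge0 k0_ge0 k1_ge0 fkk.
pose A y := (\int[leb]_s (k0 (pt2 s y))%:E)%E.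
pose B x := (\int[leb]_s (k1 (pt2 x s))%:E)%E.
have A0 y : (0 <= A y)%E by apply: integral_ge0 => s _; rewrite lee_fin.
have B0 y : (0 <= B y)%E by apply: integral_ge0 => s _; rewrite lee_fin.
have mA : measurable_fun setT A.
  apply: (@measurable_fun_fubini_tonelli_G _ _ _ _ _ leb _ (measurable_pt2 ck0)).
  by move=> p; rewrite lee_fin.
have mB : measurable_fun setT B.
  apply: (@measurable_fun_fubini_tonelli_F _ _ _ _ _ leb _ (measurable_pt2 ck1)).
  by move=> p; rewrite lee_fin.
have mf := measurable_pt2 cf.
have E0 : (\int[lebesgue_row R 2]_x (k0 x)%:E = \int[leb]_y A y)%E.
  rewrite (continuous_integral_row2 ck0)//.
  by rewrite (fubini_tonelli _ (measurable_pt2 ck0))// => p; rewrite lee_fin.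
have E1 : (\int[lebesgue_row R 2]_x (k1 x)%:E = \int[leb]_x B x)%E.
  by rewrite (continuous_integral_row2 ck1).
rewrite E0 E1 (continuous_integral_row2 cf)//.
rewrite -ge0_integralZl//; last exact: integral_ge0.
apply: ge0_le_integral => //.
- by move=> x _; apply: integral_ge0 => y _; rewrite lee_fin.
- apply: (@measurable_fun_fubini_tonelli_F _ _ _ _ _ leb _ mf).
  by move=> p; rewrite lee_fin.
- exact: measurable_funeM.
move=> x _; rewrite muleC -ge0_integralZl//.
apply: ge0_le_integral => //.
- by move=> y _; rewrite lee_fin.
- by have := measurableT_comp mf (@measurable_pair1 _ _ _ _ x); apply.
- exact: measurable_funeM.
- by move=> y _; rewrite muleC.
Qed.

Definition flux n (f : 'rV[R]_n -> R) i x := `|2 * f x * partial i f x|.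

Lemma continuous_flux n (f : 'rV[R]_n -> R) i : C1c f -> continuous (flux f i).
Proof.
move=> [cf df _].
move=> x; apply: (@continuous_comp _ _ _ (fun x => 2 * f x * partial i f x) (Num.norm : R -> R)).
  2: exact: (@norm_continuous _ R^o).
apply: (@continuousM _ _ (fun x => 2 * f x) (partial i f) x); last by have [_ +] := df i; apply.
by apply: (@continuousM _ _ (fun=> 2) f x); [exact: cst_continuous|exact: cf].
Qed.

(** f^4 = f^2 f^2, one factor being bounded along the horizontal line and the
other along the vertical line through the point. *)
Lemma gagliardo2 (f : 'rV[R]_2 -> R) : C1c f ->
  (\int[lebesgue_row R 2]_x (f x ^+ 4)%:E <=
   \int[lebesgue_row R 2]_x (flux f ord0 x)%:E *
   \int[lebesgue_row R 2]_x (flux f (lift ord0 ord0) x)%:E)%E.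
Proof.
move=> cf; have [cf0 _ _] := cf; apply: integral_row2_le_product.
- exact: continuous_expn.
- exact: continuous_flux.
- exact: continuous_flux.
- by move=> x; rewrite (exprM _ 2 2) sqr_ge0.
- by move=> x; exact: normr_ge0.
- by move=> x; exact: normr_ge0.
move=> x y; rewrite (exprM _ 2 2) expr2 EFinM; apply: lee_pmul; rewrite ?lee_fin ?sqr_ge0//.
  exact: (line_sqr_le x (row_cons (y, 0)) cf).
have := line_sqr_le y 0 (C1c_slice cf x).
by rewrite partial_slice.
Qed.

End Ladyzhenskaya2.

Section Ladyzhenskaya3.
Context {R : realType}.
Local Notation leb := (@lebesgue_measure R).
Local Notation "'I[' n ] f" := (\int[lebesgue_row R n]_x (f x))%R (at level 10, n at level 50, f at level 9).
Local Notation "'E[' n ] f" := (\int[lebesgue_row R n]_x (f x)%:E)%E (at level 10, n at level 50, f at level 9).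

Lemma Cc_EFin_integral n (f : 'rV[R]_n -> R) : continuous f -> box_support f ->
  E[n] f = (I[n] f)%:E.
Proof.
by move=> cf bf; rewrite fineK//; apply: integrable_fin_num => //; exact: Cc_integrable.
Qed.

Lemma C1c_partial n (f : 'rV[R]_n -> R) i : C1c f ->
  continuous (partial i f) /\ box_support (partial i f).
Proof.
move=> [cf df [r rf]]; split; first by have [] := df i.
exists r => x j xj; rewrite /partial /derive.
have fx : \forall y \near x, f y = 0.
  have : \forall y \near x, r < `|(y : 'rV[R]_n) 0 j|.
    have cj : {for x, continuous (fun y : 'rV[R]_n => `|y 0 j|)}.
      apply: (@continuous_comp _ _ _ (fun y : 'rV[R]_n => y 0 j) (Num.norm : R -> R)).
        exact: coord_continuous.
      exact: (@norm_continuous _ R^o).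
    exact: (@cvgr_gt _ _ _ _ _ _ cj _ xj).
  by apply: filterS => y; exact: rf.
rewrite -[LHS]/('D_(delta_mx 0 i : 'rV[R]_n) (f : 'rV[R]_n -> R^o) x).
by rewrite (@near_eq_derive _ _ R^o f (cst 0))// derive_cst.
Qed.

Lemma box_support_exp n (f : 'rV[R]_n -> R) m : box_support f -> box_support (fun x => f x ^+ m.+1).
Proof. by move=> [r rf]; exists r => x i xi; rewrite (rf x i xi) expr0n. Qed.

Lemma C1c_sqr n (f : 'rV[R]_n -> R) : C1c f ->
  continuous (fun x => f x ^+ 2) /\ box_support (fun x => f x ^+ 2).
Proof.
by move=> [cf _ bf]; split; [exact: continuous_expn|exact: box_support_exp].
Qed.

Lemma C1c_partial_sqr n (f : 'rV[R]_n -> R) i : C1c f ->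
  continuous (fun x => partial i f x ^+ 2) /\ box_support (fun x => partial i f x ^+ 2).
Proof.
move=> /(C1c_partial i)[cf bf].
by split; [exact: continuous_expn|exact: box_support_exp].
Qed.

Lemma flux_le n (f : 'rV[R]_n -> R) i : C1c f ->
  (E[n] (flux f i) <=
   (2 * Num.sqrt (I[n] (fun x => f x ^+ 2)) * Num.sqrt (I[n] (fun x => partial i f x ^+ 2)))%:E)%E.
Proof.
move=> cf; have [c2 b2] := C1c_sqr cf; have [cd2 bd2] := C1c_partial_sqr i cf.
have i2 := Cc_integrable c2 b2; have id2 := Cc_integrable cd2 bd2.
have mf := continuous_measurable_row (@continuous_flux _ _ _ i cf).
have i4 : (lebesgue_row R n).-integrable setT (EFin \o (fun x => (2 * f x) ^+ 2)).
  rewrite (_ : (fun x => (2 * f x) ^+ 2) = (fun x => 4 * f x ^+ 2)); first exact: intgZ.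
  by apply/funext => x; ring.
have [|ifl le] := ae_young_intg measurableT mf i4 id2 (fun x _ => sqr_ge0 _) (fun x _ => sqr_ge0 _).
  by apply: aeW => x _ t t0; rewrite normr_id; exact: young.
rewrite -[leLHS]fineK; last exact: integrable_fin_num.
rewrite lee_fin; apply: (le_trans (ler_norm _)); apply: (le_trans le).
rewrite ler_wpM2r ?sqrtr_ge0// (_ : (fun x => (2 * f x) ^+ 2) = (fun x => 4 * f x ^+ 2)); last first.
  by apply/funext => x; ring.
by rewrite RintegralZl// sqrtrM// (_ : 4 = 2 ^+ 2 :> R) ?sqrtr_sqr ?ger0_norm//; ring.
Qed.

Lemma sqrt_product_le (F G H : R) : 0 <= F -> 0 <= G -> 0 <= H ->
  (2 * Num.sqrt F * Num.sqrt G) * (2 * Num.sqrt F * Num.sqrt H) <= 2 * F * (G + H).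
Proof.
move=> F0 G0 H0; have := sqr_ge0 (Num.sqrt G - Num.sqrt H); rewrite sqrrB !sqr_sqrtr// => GH.
rewrite (_ : _ * (_ * _ * _) = 4 * (Num.sqrt F ^+ 2) * (Num.sqrt G * Num.sqrt H)); last by ring.
rewrite sqr_sqrtr// -subr_ge0.
rewrite (_ : _ - _ = 2 * F * (G - Num.sqrt G * Num.sqrt H *+ 2 + H)); last by ring.
by rewrite mulr_ge0// mulr_ge0.
Qed.

Lemma two_sqrt_le (F A : R) : 0 <= F -> 0 <= A -> 2 * Num.sqrt F * Num.sqrt A <= F + A.
Proof.
move=> F0 A0; have := sqr_ge0 (Num.sqrt F - Num.sqrt A); rewrite sqrrB !sqr_sqrtr//.
by rewrite -mulr_natl; lra.
Qed.

Lemma ladyzhenskaya2 (f : 'rV[R]_2 -> R) : C1c f ->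
  (E[2] (fun x => f x ^+ 4) <=
   (2 * I[2] (fun x => f x ^+ 2) *
     (I[2] (fun x => partial ord0 f x ^+ 2) + I[2] (fun x => partial (lift ord0 ord0) f x ^+ 2)))%:E)%E.
Proof.
move=> cf; apply: (le_trans (gagliardo2 cf)).
apply: (@le_trans _ _ ((2 * Num.sqrt (I[2] (fun x => f x ^+ 2)) *
    Num.sqrt (I[2] (fun x => partial ord0 f x ^+ 2)))%:E *
  (2 * Num.sqrt (I[2] (fun x => f x ^+ 2)) *
    Num.sqrt (I[2] (fun x => partial (lift ord0 ord0) f x ^+ 2)))%:E)%E).
  apply: lee_pmul; try exact: flux_le.
    by apply: integral_ge0 => x _; rewrite lee_fin normr_ge0.
  by apply: integral_ge0 => x _; rewrite lee_fin normr_ge0.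
rewrite -EFinM lee_fin.
have F0 : 0 <= I[2] (fun x => f x ^+ 2) by apply: Rintegral_ge0 => x _; exact: sqr_ge0.
have G0 i : 0 <= I[2] (fun x => partial i f x ^+ 2) by apply: Rintegral_ge0 => x _; exact: sqr_ge0.
exact: sqrt_product_le.
Qed.

(** Apply the planar inequality on each slice x_0 = a. The square of the L^2
norm of a slice is bounded uniformly in a by the total flux in the direction
of x_0, again by [line_sqr_le]; the remaining factor integrates in a. *)
Lemma ladyzhenskaya3 (f : 'rV[R]_3 -> R) : C1c f ->
  (E[3] (fun x => f x ^+ 4) <=
   (2 * (2 * Num.sqrt (I[3] (fun x => f x ^+ 2)) * Num.sqrt (I[3] (fun x => partial ord0 f x ^+ 2))) *
     I[3] (fun x => partial (lift ord0 ord0) f x ^+ 2 + partial (lift ord0 (lift ord0 ord0)) f x ^+ 2))%:E)%E.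
Proof.
move=> cf; have [cf0 df [r rf]] := cf.
set K := 2 * Num.sqrt _ * _; have K0 : 0 <= K by rewrite !mulr_ge0 ?sqrtr_ge0.
have [c2 b2] := C1c_sqr cf.
have cfl := @continuous_flux _ _ _ ord0 cf.
have FK a : I[2] (fun v => f (row_cons (a, v)) ^+ 2) <= K.
  have [cs2 bs2] := C1c_sqr (C1c_slice cf a).
  rewrite -lee_fin -(Cc_EFin_integral cs2 bs2) (le_trans _ (flux_le ord0 cf))//.
  rewrite (continuous_integral_row_cons cfl); last by move=> x; exact: normr_ge0.
  have mfl : measurable_fun setT (fun p : measurableTypeR R * 'rV[R]_2 => (flux f ord0 (row_cons p))%:E).
    apply/measurable_EFinP; apply: (measurableT_comp (continuous_measurable_row cfl)).
    exact: measurable_row_cons.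
  rewrite (fubini_tonelli _ mfl); last by move=> p; rewrite lee_fin normr_ge0.
  apply: ge0_le_integral => //.
  - by move=> v _; rewrite lee_fin sqr_ge0.
  - by apply/measurable_EFinP; exact: continuous_measurable_row.
  - apply: (@measurable_fun_fubini_tonelli_G _ _ _ _ _ leb _ mfl).
    by move=> p; rewrite lee_fin normr_ge0.
  - by move=> v _; exact: line_sqr_le.
pose D x := partial (lift ord0 ord0) f x ^+ 2 + partial (lift ord0 (lift ord0 ord0)) f x ^+ 2.
have [cd1 [r1 bd1]] := C1c_partial_sqr (lift ord0 ord0) cf.
have [cd2 [r2 bd2]] := C1c_partial_sqr (lift ord0 (lift ord0 ord0)) cf.
have cD : continuous D by move=> x; exact: (@continuousD _ _ _ _ _ x (cd1 x) (cd2 x)).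
have bD : box_support D.
  exists (Num.max r1 r2) => x i; rewrite gt_max => /andP[h1 h2].
  by rewrite /D (bd1 x i h1) (bd2 x i h2) addr0.
have D0 x : 0 <= D x by rewrite addr_ge0 ?sqr_ge0.
rewrite -[X in _ * X]/(I[3] D) EFinM -Cc_EFin_integral//.
have cf4 : continuous (fun x => f x ^+ 4) by exact: continuous_expn.
have f4 x : 0 <= f x ^+ 4 by rewrite (exprM _ 2 2) sqr_ge0.
rewrite (continuous_integral_row_cons cf4 f4) (continuous_integral_row_cons cD D0).
have mrow (k : 'rV[R]_3 -> R) : continuous k -> (forall x, 0 <= k x) ->
    measurable_fun setT (fun a => \int[lebesgue_row R 2]_v (k (@row_cons R 2 (a, v)))%:E)%E.
  move=> ck k0; apply: (@measurable_fun_fubini_tonelli_F _ _ _ _ _ _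
    (fun p : measurableTypeR R * 'rV[R]_2 => (k (row_cons p))%:E)).
    apply/measurable_EFinP; apply: (measurableT_comp (continuous_measurable_row ck)).
    exact: measurable_row_cons.
  by move=> p; rewrite lee_fin.
have K20 : (0 <= (2 * K)%:E)%E by rewrite lee_fin mulr_ge0.
rewrite -ge0_integralZl//; last 2 first.
- exact: mrow.
- by move=> a _; apply: integral_ge0 => v _; rewrite lee_fin.
apply: ge0_le_integral => //.
- by move=> a _; apply: integral_ge0 => v _; rewrite lee_fin (exprM _ 2 2) sqr_ge0.
- apply: (mrow (fun x => f x ^+ 4)); first exact: continuous_expn.
  by move=> x; rewrite (exprM _ 2 2) sqr_ge0.
- by apply: measurable_funeM; exact: mrow.
move=> a _; have cfa := C1c_slice cf a; apply: (le_trans (ladyzhenskaya2 cfa)).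
rewrite !partial_slice.
have [ca1 ba1] := C1c_partial_sqr ord0 cfa; have [ca2 ba2] := C1c_partial_sqr (lift ord0 ord0) cfa.
rewrite partial_slice in ca1 ba1; rewrite partial_slice in ca2 ba2.
have bDa : box_support (fun v => D (row_cons (a, v))).
  have [s bs] := bD; exists s => v i vi; apply: (bs _ (lift ord0 i)).
  by rewrite mxE liftK.
rewrite (Cc_EFin_integral (@continuous_slice _ _ _ a cD) bDa) -EFinM lee_fin.
have -> : I[2] (fun v => D (row_cons (a, v))) =
    I[2] (fun v => partial (lift ord0 ord0) f (row_cons (a, v)) ^+ 2) +
    I[2] (fun v => partial (lift ord0 (lift ord0 ord0)) f (row_cons (a, v)) ^+ 2).
  by apply: RintegralD => //; [exact: Cc_integrable ca1 ba1|exact: Cc_integrable ca2 ba2].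
apply: ler_wpM2r; first by apply: addr_ge0; apply: Rintegral_ge0 => v _; exact: sqr_ge0.
by rewrite ler_wpM2l.
Qed.

Lemma product_le_energy (K F A S : R) : 0 <= K -> K <= F + A ->
  0 <= F -> 0 <= A -> 0 <= S -> 2 * K * S <= 2 * (F + (A + S)) * (A + S).
Proof.
move=> K0 KFA F0 A0 S0; apply: ler_pM; rewrite ?lerDr// ?mulr_ge0//.
by rewrite ler_wpM2l// (le_trans KFA)// addrA lerDl.
Qed.

Lemma sum_ord2 (F : 'I_2 -> R) : \sum_i F i = F ord0 + F (lift ord0 ord0).
Proof. by rewrite !big_ord_recl big_ord0 addr0. Qed.

Lemma sum_ord3 (F : 'I_3 -> R) :
  \sum_i F i = F ord0 + (F (lift ord0 ord0) + F (lift ord0 (lift ord0 ord0))).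
Proof. by rewrite !big_ord_recl big_ord0 addr0. Qed.

Definition grad_sqr n (f : 'rV[R]_n -> R) x := \sum_i partial i f x ^+ 2.

(** The exponents that are optimal in dimension two and in dimension three
differ; this weaker common form bounds the L^4 norm by the H^1 norm in both
cases and keeps the factor that vanishes with the gradient. *)
Theorem ladyzhenskaya n (f : 'rV[R]_n -> R) : n = 2%N \/ n = 3%N -> C1c f ->
  I[n] (fun x => f x ^+ 4) <=
  2 * (I[n] (fun x => f x ^+ 2) + I[n] (grad_sqr f)) * I[n] (grad_sqr f).
Proof.
move=> n23 cf; have [cf0 df bf] := cf.
rewrite -lee_fin -Cc_EFin_integral; [|exact: continuous_expn|exact: box_support_exp].
have ig i : (lebesgue_row R n).-integrable setT (EFin \o (fun x => partial i f x ^+ 2)).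
  by have [c b] := C1c_partial_sqr i cf; exact: Cc_integrable.
have F0 : 0 <= I[n] (fun x => f x ^+ 2) by apply: Rintegral_ge0 => x _; exact: sqr_ge0.
have G0 i : 0 <= I[n] (fun x => partial i f x ^+ 2) by apply: Rintegral_ge0 => x _; exact: sqr_ge0.
have GE : I[n] (grad_sqr f) = \sum_i I[n] (fun x => partial i f x ^+ 2).
  by rewrite /grad_sqr Rintegral_sum.
case: n23 => n23; subst n; rewrite GE.
  apply: (le_trans (ladyzhenskaya2 cf)); rewrite lee_fin.
  rewrite (sum_ord2 (fun i => I[2] (fun x => partial i f x ^+ 2))).
  have := G0 ord0; have := G0 (lift ord0 ord0).
  by move=> h0 h1; rewrite ler_wpM2r ?addr_ge0// ler_wpM2l// lerDl addr_ge0.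
apply: (le_trans (ladyzhenskaya3 cf)); rewrite lee_fin.
rewrite (sum_ord3 (fun i => I[3] (fun x => partial i f x ^+ 2))).
have -> : I[3] (fun x => partial (lift ord0 ord0) f x ^+ 2 + partial (lift ord0 (lift ord0 ord0)) f x ^+ 2) =
    I[3] (fun x => partial (lift ord0 ord0) f x ^+ 2) +
    I[3] (fun x => partial (lift ord0 (lift ord0 ord0)) f x ^+ 2) by exact: RintegralD.
have h0 := G0 ord0; have h1 := G0 (lift ord0 ord0); have h2 := G0 (lift ord0 (lift ord0 ord0)).
have hK := two_sqrt_le F0 h0.
apply: product_le_energy hK F0 h0 (addr_ge0 h1 h2).
by apply: mulr_ge0; [apply: mulr_ge0 => //|]; exact: sqrtr_ge0.
Qed.

End Ladyzhenskaya3.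

(** * Test functions *)

Section TestFunctions.
Context {R : realType} {n : nat}.
Local Notation E := 'rV[R]_n.
Implicit Types (f g phi psi : E -> R) (O : set E).

Lemma partialB f g i : (forall x, derivable f x (delta_mx 0 i : E)) ->
  (forall x, derivable g x (delta_mx 0 i : E)) ->
  partial i (fun x => f x - g x) = (fun x => partial i f x - partial i g x).
Proof.
move=> df dg; apply/funext => x.
exact: (@deriveB R E R^o f g x (delta_mx 0 i) (df x) (dg x)).
Qed.

Lemma partialM f g i : (forall x, derivable f x (delta_mx 0 i : E)) ->
  (forall x, derivable g x (delta_mx 0 i : E)) ->
  partial i (fun x => f x * g x) = (fun x => f x * partial i g x + g x * partial i f x).
Proof.
move=> df dg; apply/funext => x.
exact: (@deriveM R E f g x (delta_mx 0 i) (df x) (dg x)).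
Qed.

Lemma CkW k f : Ck k.+1 f -> Ck k f.
Proof.
elim: k f => [|k IHk] f [cf df]; first by split.
by split => // i; have [? ?] := df i; split => //; exact: IHk.
Qed.

Lemma CkD k f g : Ck k f -> Ck k g -> Ck k (fun x => f x + g x).
Proof.
elim: k f g => [|k IHk] f g [cf df] [cg dg].
  by split => // x; exact: (@continuousD _ _ _ _ _ x (cf x) (cg x)).
split; first by move=> x; exact: (@continuousD _ _ _ _ _ x (cf x) (cg x)).
move=> i; have [dfi Ckf] := df i; have [dgi Ckg] := dg i; split.
  by move=> x; exact: (@derivableD R E R^o f g x (delta_mx 0 i) (dfi x) (dgi x)).
have -> : partial i (fun x => f x + g x) = (fun x => partial i f x + partial i g x).
  by apply/funext => x; exact: (@deriveD R E R^o f g x (delta_mx 0 i) (dfi x) (dgi x)).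
exact: IHk.
Qed.

Lemma CkB k f g : Ck k f -> Ck k g -> Ck k (fun x => f x - g x).
Proof.
elim: k f g => [|k IHk] f g [cf df] [cg dg].
  by split => // x; exact: (@continuousB _ _ _ _ _ x (cf x) (cg x)).
split; first by move=> x; exact: (@continuousB _ _ _ _ _ x (cf x) (cg x)).
move=> i; have [dfi Ckf] := df i; have [dgi Ckg] := dg i; split.
  by move=> x; exact: (@derivableB R E R^o f g x (delta_mx 0 i) (dfi x) (dgi x)).
by rewrite partialB//; exact: IHk.
Qed.

Lemma CkM k f g : Ck k f -> Ck k g -> Ck k (fun x => f x * g x).
Proof.
elim: k f g => [|k IHk] f g [cf df] [cg dg].
  by split => // x; exact: (@continuousM _ _ _ _ x (cf x) (cg x)).
split; first by move=> x; exact: (@continuousM _ _ _ _ x (cf x) (cg x)).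
move=> i; have [dfi Ckf] := df i; have [dgi Ckg] := dg i; split.
  by move=> x; exact: (@derivableM R E f g x (delta_mx 0 i) (dfi x) (dgi x)).
rewrite partialM//.
have Cf : Ck k f by apply: CkW; split.
have Cg : Ck k g by apply: CkW; split.
by apply: CkD; exact: IHk.
Qed.

Lemma test_fun_out O phi x : test_fun O phi -> ~ O x -> phi x = 0.
Proof.
move=> [_ _ sO] Ox; apply: contrapT => /eqP px; apply: Ox; apply: sO.
exact: subset_closure.
Qed.

Lemma test_fun_partial_out O phi i x : test_fun O phi -> ~ O x -> partial i phi x = 0.
Proof.
move=> [_ _ sO] Ox.
have fx : \forall y \near x, phi y = 0.
  have : nbhs x (~` closure [set x | phi x != 0]).
    apply: open_nbhs_nbhs; split; first by apply: closed_openC; exact: closed_closure.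
    by move=> /sO.
  apply: filterS => y ny; apply: contrapT => /eqP py; apply: ny.
  exact: subset_closure.
rewrite -[LHS]/('D_(delta_mx 0 i : 'rV[R]_n) (phi : 'rV[R]_n -> R^o) x).
by rewrite (@near_eq_derive _ _ R^o phi (cst 0))// derive_cst.
Qed.

Lemma entry_le_norm (x : E) i : `|x 0 i| <= `|x|.
Proof. by rewrite [leRHS]/Num.norm /= mx_normrE; apply/bigmax_geP; right; exists (0, i). Qed.

Lemma test_fun_C1c O phi : test_fun O phi -> C1c phi.
Proof.
move=> [Cphi /compact_bounded[M [_ MK0]] _].
have MK := MK0 (M + 1); rewrite ltrDl ltr01 in MK; have {}MK := MK isT.
have [c0 d0] := Cphi 1%N; split => //.
  by move=> i; have [d1 [c1 _]] := d0 i.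
exists (M + 1) => x i xi; apply: contrapT => /eqP px.
have px' : closure [set x | phi x != 0] x by exact: subset_closure.
have : `|x| <= M + 1 by exact: (MK x px').
rewrite leNgt (lt_le_trans xi)//.
exact: entry_le_norm.
Qed.

Lemma test_fun_support O phi psi : closed (closure [set x | psi x != 0]) ->
  test_fun O phi -> (forall k, Ck k psi) -> (forall x, phi x = 0 -> psi x = 0) ->
  test_fun O psi.
Proof.
move=> cl [_ cphi sO] Cpsi pp.
have sub : closure [set x | psi x != 0] `<=` closure [set x | phi x != 0].
  by apply: closureS => x /= /eqP px; apply/eqP => /pp.
split => //; first exact: subclosed_compact sub.
exact: subset_trans sub sO.
Qed.

Lemma test_fun_sqr O phi : test_fun O phi -> test_fun O (fun x => phi x * phi x).
Proof.
move=> tp; apply: (test_fun_support _ tp); first exact: closed_closure.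
  by move=> k; case: tp => C _ _; exact: CkM.
by move=> x ->; rewrite mul0r.
Qed.

Lemma test_funB O phi psi : test_fun O phi -> test_fun O psi ->
  test_fun O (fun x => phi x - psi x).
Proof.
move=> [C1 c1 s1] [C2 c2 s2].
have sub : closure [set x | phi x - psi x != 0] `<=`
    closure [set x | phi x != 0] `|` closure [set x | psi x != 0].
  rewrite -closureU; apply: closureS => x /= px.
  have [p0|] := eqVneq (phi x) 0; last by left.
  by right; apply: contra_neq px => q0; rewrite p0 q0 subr0.
split; first by move=> k; exact: CkB.
  by apply: subclosed_compact sub; [exact: closed_closure|exact: compactU].
by apply: (subset_trans sub) => x [/s1|/s2].
Qed.

Section Integrals.
Variables (O : set E) (mO : measurable O).
Local Notation mu := (lebesgue_row R n).

Lemma Rintegral_out (k : E -> R) : (forall x, ~ O x -> k x = 0) ->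
  \int[mu]_(x in O) k x = \int[mu]_x k x.
Proof.
move=> kO; rewrite Rintegral_mkcond; congr Rintegral; apply/funext => x.
by rewrite patchE; case: ifPn => // /negP xO; rewrite kO// => Ox; apply: xO; rewrite inE.
Qed.

Lemma test_fun_intg phi m : test_fun O phi ->
  measurable_fun O phi /\ mu.-integrable O (EFin \o (fun x => phi x ^+ m.+1)).
Proof.
move=> /test_fun_C1c[cf _ bf]; split.
  by apply: measurable_funTS; exact: continuous_measurable_row.
apply: (@integrableS _ _ _ _ setT) => //.
by apply: Cc_integrable; [exact: continuous_expn|exact: box_support_exp].
Qed.

Lemma test_fun_partial_intg phi i m : test_fun O phi ->
  measurable_fun O (partial i phi) /\ mu.-integrable O (EFin \o (fun x => partial i phi x ^+ m.+1)).
Proof.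
move=> /test_fun_C1c/(C1c_partial i)[cf bf]; split.
  by apply: measurable_funTS; exact: continuous_measurable_row.
apply: (@integrableS _ _ _ _ setT) => //.
by apply: Cc_integrable; [exact: continuous_expn|exact: box_support_exp].
Qed.

Lemma ladyzhenskaya_test phi : n = 2%N \/ n = 3%N -> test_fun O phi ->
  \int[mu]_(x in O) (phi x ^+ 4) <=
  2 * (\int[mu]_(x in O) (phi x ^+ 2) + \sum_i \int[mu]_(x in O) (partial i phi x ^+ 2)) *
  \sum_i \int[mu]_(x in O) (partial i phi x ^+ 2).
Proof.
move=> n23 tp; have cp := test_fun_C1c tp.
have := ladyzhenskaya n23 cp.
rewrite /grad_sqr Rintegral_sum//; last first.
  by move=> i _; have [? ?] := C1c_partial_sqr i cp; exact: Cc_integrable.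
rewrite -Rintegral_out; last by move=> x /(test_fun_out tp) ->; rewrite expr0n.
rewrite -Rintegral_out; last by move=> x /(test_fun_out tp) ->; rewrite expr0n.
suff -> : \sum_i \int[mu]_(x in O) (partial i phi x ^+ 2) = \sum_i \int[mu]_x (partial i phi x ^+ 2) by [].
apply: eq_bigr => i _; rewrite Rintegral_out// => x Ox.
by rewrite (test_fun_partial_out i tp Ox) expr0n.
Qed.

End Integrals.

End TestFunctions.

(** * Passing to the limit in an L^4 bound *)

Section L4Closure.
Context d (T : measurableType d) (R : realType) (mu : {measure set T -> \bar R}).
Variables (D : set T) (mD : measurable D) (Dfin : (mu D < +oo)%E).
Local Notation intg f := (mu.-integrable D (EFin \o f)).

(** Fourth power cut off at level [k]: unlike the fourth power itself it is
controlled by L^2 convergence. *)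
Definition trunc4 (k : nat) (s : R) : R := (Num.min `|s| k%:R) ^+ 4.

Lemma le_of_right_limit (p : R -> R) (x : R) : continuous p ->
  (forall e, 0 < e -> x <= p e) -> x <= p 0.
Proof.
move=> cp xp; rewrite leNgt; apply/negP => p0x.
have : nbhs (0 : R) (fun e => p e < x) by exact: (@cvgr_lt _ _ _ _ _ _ (cp 0) _ p0x).
move=> /nbhs_ballP[e /= e0 eb].
have e20 : 0 < e / 2 by rewrite divr_gt0.
have : p (e / 2) < x.
  apply: eb; rewrite /ball /= sub0r normrN ger0_norm ?(ltW e20)//.
  by rewrite ltr_pdivrMr// mulr_natr mulr2n ltrDl.
by rewrite ltNge xp.
Qed.

(** Truncation is 1-Lipschitz, and on [0, k] the fourth power has slope at
most 4 k^3. *)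
Lemma trunc4_le (k : nat) (a b : R) : trunc4 k a <= b ^+ 4 + 4 * k%:R ^+ 3 * `|a - b|.
Proof.
rewrite /trunc4; set u := Num.min _ _; pose v := Num.min `|b| k%:R.
have k0 : 0 <= k%:R :> R by [].
have u0 : 0 <= u by rewrite le_min normr_ge0.
have v0 : 0 <= v by rewrite le_min normr_ge0.
have uk : u <= k%:R by rewrite ge_min lexx orbT.
have vk : v <= k%:R by rewrite ge_min lexx orbT.
have vb : v ^+ 4 <= b ^+ 4.
  rewrite -[b ^+ 4]ger0_norm ?normrX; last by rewrite (exprM _ 2 2) sqr_ge0.
  by rewrite lerXn2r ?nnegrE// ge_min lexx.
have uv : u - v <= `|a - b|.
  rewrite /u /v; have := lerB_dist a b.
  have := normr_ge0 (a - b); move: `|a - b| `|a| `|b| => p q r h1 p0.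
  by rewrite /Num.min; case: ltP => ?; case: ltP => ?; lra.
apply: (@le_trans _ _ (v ^+ 4 + 4 * k%:R ^+ 3 * `|a - b|)); last by rewrite lerD2r.
rewrite -lerBlDl (_ : u ^+ 4 - v ^+ 4 = (u + v) * (u ^+ 2 + v ^+ 2) * (u - v)); last by ring.
have [uv'|uv'] := leP (u - v) 0.
  apply: (@le_trans _ _ 0); last by rewrite !mulr_ge0// exprn_ge0.
  by rewrite mulr_ge0_le0// mulr_ge0 ?addr_ge0// sqr_ge0.
apply: ler_pM => //; rewrite ?(ltW uv')//.
  by rewrite mulr_ge0 ?addr_ge0 ?sqr_ge0.
rewrite (_ : 4 * k%:R ^+ 3 = (k%:R + k%:R) * (k%:R ^+ 2 + k%:R ^+ 2) :> R); last by ring.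
by apply: ler_pM; rewrite ?addr_ge0 ?sqr_ge0// lerD// lerXn2r ?nnegrE.
Qed.

Lemma intg_cst (c : R) : intg (fun=> c).
Proof.
apply: measurable_bounded_integrable => //; exists `|c|; split => // y cy x _.
exact: ltW.
Qed.

(** An L^4 bound survives L^2 convergence: truncate, let the approximation
converge at a fixed truncation level, then let the level grow by monotone
convergence. *)
Lemma L4_closure (a : T -> R) (f g : R) : measurable_fun D a ->
  (forall e, 0 < e -> exists b : T -> R, [/\ measurable_fun D b, intg (fun x => b x ^+ 4),
     intg (fun x => (a x - b x) ^+ 2), lnorm2 mu D (fun x => a x - b x) < e &
     \int[mu]_(x in D) (b x ^+ 4) <= 2 * ((f + e) ^+ 2 + (g + e) ^+ 2) * (g + e) ^+ 2]) ->
  intg (fun x => a x ^+ 4) /\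
  \int[mu]_(x in D) (a x ^+ 4) <= 2 * (f ^+ 2 + g ^+ 2) * g ^+ 2.
Proof.
move=> ma approx; set c := 2 * _ * _.
have mt k : measurable_fun D (fun x => trunc4 k (a x)).
  apply: measurable_funX; apply: measurable_minr => //.
  exact: measurableT_comp.
have t0 k s : 0 <= trunc4 k s by rewrite /trunc4 (exprM _ 2 2) sqr_ge0.
have tk k s : trunc4 k s <= k%:R ^+ 4.
  apply: lerXn2r; rewrite ?nnegrE//.
  by rewrite ge_min lexx orbT.
have it k : intg (fun x => trunc4 k (a x)).
  apply: measurable_bounded_integrable => //; exists (k%:R ^+ 4); split => // y ky x _.
  by rewrite /= ger0_norm// (le_trans (tk k _))// ltW.
have le_c k : \int[mu]_(x in D) trunc4 k (a x) <= c.
  pose C := 4 * k%:R ^+ 3 * lnorm2 mu D (fun=> 1).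
  pose p e := 2 * ((f + e) ^+ 2 + (g + e) ^+ 2) * (g + e) ^+ 2 + C * e.
  suff : \int[mu]_(x in D) trunc4 k (a x) <= p 0.
    by rewrite /p mulr0 !addr0.
  apply: le_of_right_limit.
    have cadd (z : R) m : continuous (fun e : R => (z + e) ^+ m).
      apply: continuous_expn => x.
      by apply: (@continuousD _ _ _ (fun=> z) id x); [exact: cst_continuous|exact: cvg_id].
    move=> x; apply: (@continuousD _ _ _ (fun e => 2 * ((f + e) ^+ 2 + (g + e) ^+ 2) * (g + e) ^+ 2) (fun e => C * e) x).
      apply: (@continuousM _ _ (fun e => 2 * ((f + e) ^+ 2 + (g + e) ^+ 2)) (fun e => (g + e) ^+ 2) x); last exact: cadd.
      apply: (@continuousM _ _ (fun=> 2) (fun e => ((f + e) ^+ 2 + (g + e) ^+ 2)) x); first exact: cst_continuous.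
      by apply: (@continuousD _ _ _ (fun e => (f + e) ^+ 2) (fun e => (g + e) ^+ 2) x); exact: cadd.
    by apply: (@continuousM _ _ (fun=> C) id x); [exact: cst_continuous|exact: cvg_id].
  move=> e e0; have [b [mb ib4 iab2 abe bl]] := approx e e0.
  have mab : measurable_fun D (fun x => a x - b x) by exact: measurable_funB.
  have i1 : intg (fun x => (fun=> 1) x ^+ 2).
    by under eq_fun do rewrite expr1n; exact: intg_cst.
  have nE : (fun x => `|a x - b x| ^+ 2) = (fun x => (a x - b x) ^+ 2).
    by apply/funext => x; rewrite real_normK// num_real.
  have [||||iab le_ab] := @intg_mul _ _ _ mu D mD (fun x => `|a x - b x|) (fun=> 1).
  - exact: measurableT_comp.
  - exact: measurable_cst.
  - by rewrite nE.
  - exact: i1.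
  have E1 : (fun x => `|a x - b x| * 1) = (fun x => `|a x - b x|) by apply/funext => x; rewrite mulr1.
  rewrite E1 in iab le_ab.
  apply: (@le_trans _ _ (\int[mu]_(x in D) (b x ^+ 4 + 4 * k%:R ^+ 3 * `|a x - b x|))).
    apply: le_Rintegral => //; last by move=> x _; exact: trunc4_le.
    by apply: intgD => //; exact: intgZ.
  rewrite RintegralD//; last exact: intgZ.
  rewrite RintegralZl//; apply: lerD => //.
  rewrite /C -[leRHS]mulrA ler_wpM2l ?mulr_ge0 ?exprn_ge0//.
  apply: (le_trans (ler_norm _)); apply: (le_trans le_ab).
  by rewrite mulrC ler_wpM2l ?sqrtr_ge0// /lnorm2 nE ltW.
have a40 x : 0 <= a x ^+ 4 by rewrite (exprM _ 2 2) sqr_ge0.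
have ma4 : measurable_fun D (fun x => a x ^+ 4) by exact: measurable_funX.
have lim_t x : limn (fun k => (trunc4 k (a x))%:E) = (a x ^+ 4)%:E.
  apply/cvg_lim => //; apply: cvg_near_cst.
  exists (Num.truncn `|a x|).+1 => // k /= kx; congr EFin.
  rewrite /trunc4 min_l; first by rewrite -normrX ger0_norm.
  by apply: ltW; apply: (lt_le_trans (truncnS_gt _)); rewrite ler_nat.
have nd m k s : (m <= k)%N -> trunc4 m s <= trunc4 k s.
  move=> mk; apply: lerXn2r; rewrite ?nnegrE ?le_min ?normr_ge0 ?ler0n//.
  by rewrite !ge_min lexx /= ler_nat mk orbT.
have le_int : (\int[mu]_(x in D) (a x ^+ 4)%:E <= c%:E)%E.
  under eq_integral => x _ do rewrite -lim_t.
  rewrite (monotone_convergence mu mD (g' := fun k x => (trunc4 k (a x))%:E)).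
  - apply: lime_le.
      apply: ereal_nondecreasing_is_cvgn => m k mk; apply: ge0_le_integral => //.
      + by move=> x _; rewrite lee_fin.
      + exact/measurable_EFinP.
      + exact/measurable_EFinP.
      + by move=> x _; rewrite lee_fin; exact: nd.
    apply: nearW => k; rewrite -[leLHS]fineK ?lee_fin; first exact: le_c.
    exact: (integrable_fin_num mD (it k)).
  - by move=> k; exact/measurable_EFinP.
  - by move=> k x _; rewrite lee_fin.
  - by move=> x _ m k mk; rewrite lee_fin; exact: nd.
have ia4 : intg (fun x => a x ^+ 4).
  by apply: ge0_intg => //; apply: (le_lt_trans le_int); exact: ltry.
split => //; rewrite -lee_fin fineK//; exact: integrable_fin_num.
Qed.

End L4Closure.

(** * The embedding of H^1_0 in L^4 *)

Section SobolevL4.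
Context {R : realType} {n : nat}.
Local Notation E := 'rV[R]_n.
Local Notation mu := (lebesgue_row R n).
Variables (O : set E) (oO : open O) (bO : bounded_set O) (n23 : n = 2%N \/ n = 3%N).

Let mO : measurable O := open_measurable_row oO.
Let Ofin : (mu O < +oo)%E := bounded_row_measure mO bO.
Local Notation intg f := (mu.-integrable O (EFin \o f)).
Local Notation L2n := (lnorm2 mu O).
Local Notation L4n := (lnorm4 mu O).

Definition gradc (u : sobfun R n) i : E -> R := fun x => sobgrad u x 0 i.

Lemma L2n_sqr (f : E -> R) : L2n f ^+ 2 = \int[mu]_(x in O) (f x ^+ 2).
Proof. by rewrite sqr_sqrtr// Rintegral_ge0// => x _; exact: sqr_ge0. Qed.

Lemma L2n_ge0 (f : E -> R) : 0 <= L2n f. Proof. exact: sqrtr_ge0. Qed.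
Lemma L4n_ge0 (f : E -> R) : 0 <= L4n f. Proof. exact: sqrtr_ge0. Qed.

Lemma L2_cst1 (f : E -> R) : L2 (cst 1) O f ->
  measurable_fun O f /\ intg (fun x => f x ^+ 2).
Proof.
move=> [mf f2]; split => //; apply: ge0_intg => //.
- exact: measurable_funX.
- by move=> x _; exact: sqr_ge0.
- by under eq_integral => x _ do rewrite -[f x ^+ 2]mulr1.
Qed.

Lemma H10_L2 u : H10 (cst 1) O u ->
  [/\ measurable_fun O (sobval u), intg (fun x => sobval u x ^+ 2),
    forall i, measurable_fun O (gradc u i) & forall i, intg (fun x => gradc u i x ^+ 2)].
Proof.
move=> [[/L2_cst1[m1 i1] gL _] _]; split => // i; first by have [] := L2_cst1 (gL i).
by have [] := L2_cst1 (gL i).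
Qed.

Lemma enorm_sqr (x : E) : enorm x ^+ 2 = \sum_i x 0 i ^+ 2.
Proof.
rewrite sqr_sqrtr; first by apply: eq_bigr => i _; rewrite expr2.
by apply: sumr_ge0 => i _; rewrite -expr2 sqr_ge0.
Qed.

Lemma intg_sub_sqr (f h : E -> R) : measurable_fun O f -> measurable_fun O h ->
  intg (fun x => f x ^+ 2) -> intg (fun x => h x ^+ 2) -> intg (fun x => (f x - h x) ^+ 2).
Proof.
move=> mf mh if2 ih2.
have hN : (fun x => (- h x) ^+ 2) = (fun x => h x ^+ 2) by apply/funext => x; rewrite sqrrN.
have mN : measurable_fun O (fun x => - h x) by exact: measurable_funN.
have iN : intg (fun x => (- h x) ^+ 2) by rewrite hN.
by have [] := @lnorm2_triangle _ _ _ mu O mO f (fun x => - h x) mf mN if2 iN.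
Qed.

Lemma L2n_sub_le (f h : E -> R) : measurable_fun O f -> measurable_fun O h ->
  intg (fun x => f x ^+ 2) -> intg (fun x => h x ^+ 2) ->
  L2n (fun x => f x - h x) <= L2n f + L2n h.
Proof.
move=> mf mh if2 ih2.
have hN : (fun x => (- h x) ^+ 2) = (fun x => h x ^+ 2) by apply/funext => x; rewrite sqrrN.
have mN : measurable_fun O (fun x => - h x) by exact: measurable_funN.
have iN : intg (fun x => (- h x) ^+ 2) by rewrite hN.
have [_] := @lnorm2_triangle _ _ _ mu O mO f (fun x => - h x) mf mN if2 iN.
by rewrite {3}/lnorm2 hN.
Qed.

Lemma H10_approx u : H10 (cst 1) O u -> forall e, 0 < e -> exists phi, [/\ test_fun O phi,
  L2n (fun x => sobval u x - phi x) < e &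
  forall i, L2n (fun x => gradc u i x - partial i phi x) < e].
Proof.
move=> uH e e0; have [m1 i1 mg ig] := H10_L2 uH.
have [_ /(_ e e0)[phi tphi [h1 h2]]] := uH; exists phi; split => //.
  move: h1; rewrite /L2norm /lnorm2.
  by under eq_Rintegral => x _ do rewrite mulr1.
move=> i; apply: le_lt_trans h2; rewrite /vL2norm /lnorm2 ler_wsqrtr//.
have id j : intg (fun x => (gradc u j x - partial j phi x) ^+ 2).
  have [mp ip] := test_fun_partial_intg mO j 1 tphi.
  exact: intg_sub_sqr.
have E1 : (fun x => enorm (sobgrad u x - classical_grad phi x) ^+ 2 * cst 1 x) =
    (fun x => \sum_j (gradc u j x - partial j phi x) ^+ 2).
  by apply/funext => x; rewrite /cst mulr1 enorm_sqr; apply: eq_bigr => j _; rewrite !mxE.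
rewrite E1; apply: le_Rintegral => //; first exact: intg_sum.
by move=> x _; rewrite (bigD1 i)//= lerDl sumr_ge0// => j _; exact: sqr_ge0.
Qed.

(** Ladyzhenskaya's inequality for u minus a test function, obtained as the
limit of the inequality for differences of test functions. With a zero test
function this is the embedding; with an approximation of u it shows that the
approximation also converges in L^4. *)
Lemma H10_L4_sub u phi0 : H10 (cst 1) O u -> test_fun O phi0 ->
  let f := L2n (fun x => sobval u x - phi0 x) in
  let g := \sum_i L2n (fun x => gradc u i x - partial i phi0 x) in
  intg (fun x => (sobval u x - phi0 x) ^+ 4) /\
  \int[mu]_(x in O) ((sobval u x - phi0 x) ^+ 4) <= 2 * (f ^+ 2 + g ^+ 2) * g ^+ 2.
Proof.
move=> uH t0 f g; have [mu1 iu mg ig] := H10_L2 uH.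
have [mp0 ip0] := test_fun_intg mO 1 t0.
have mgp i := (test_fun_partial_intg mO i 1 t0).1.
have igp i := (test_fun_partial_intg mO i 1 t0).2.
apply: (L4_closure mO Ofin); first exact: measurable_funB.
(* the factor n + 1 leaves room for the sum over the n components of the gradient *)
move=> e e0; pose e' := e / n.+1%:R.
have e'0 : 0 < e' by rewrite divr_gt0.
have e'e : e' <= e by rewrite ler_pdivrMr// ler_peMr ?(ltW e0)// ler1n.
have [phi [tphi hphi hgrad]] := H10_approx uH e'0.
have [mp ip] := test_fun_intg mO 1 tphi.
have tb := test_funB tphi t0.
exists (fun x => phi x - phi0 x).
have [mb ib4] := test_fun_intg mO 3 tb.
have subE : (fun x => sobval u x - phi0 x - (phi x - phi0 x)) = (fun x => sobval u x - phi x).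
  by apply/funext => x; ring.
split => //.
- by under eq_fun do rewrite opprB addrA subrK; exact: intg_sub_sqr.
- by rewrite subE (lt_le_trans hphi).
apply: (le_trans (ladyzhenskaya_test n23 tb)).
have f0 : 0 <= f by exact: L2n_ge0.
have g0 : 0 <= g by apply: sumr_ge0 => i _; exact: L2n_ge0.
have fe : L2n (fun x => phi x - phi0 x) <= f + e.
  have -> : (fun x => phi x - phi0 x) =
    (fun x => (sobval u x - phi0 x) - (sobval u x - phi x)) by apply/funext => x; ring.
  apply: (le_trans (L2n_sub_le _ _ _ _)).
  - exact: measurable_funB.
  - exact: measurable_funB.
  - exact: intg_sub_sqr.
  - exact: intg_sub_sqr.
  by rewrite lerD2l ltW// (lt_le_trans hphi).
have pE i : partial i (fun x => phi x - phi0 x) = (fun x => partial i phi x - partial i phi0 x).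
  have [/(_ 1%N)[_ d1] _ _] := tphi; have [/(_ 1%N)[_ d2] _ _] := t0.
  by rewrite partialB//; [have [] := d1 i|have [] := d2 i].
have ge : \sum_i L2n (partial i (fun x => phi x - phi0 x)) <= g + e.
  apply: (@le_trans _ _ (\sum_i (L2n (fun x => gradc u i x - partial i phi0 x) + e'))).
    apply: ler_sum => i _; rewrite pE.
    have [mpi ipi] := test_fun_partial_intg mO i 1 tphi.
    have -> : (fun x => partial i phi x - partial i phi0 x) =
      (fun x => (gradc u i x - partial i phi0 x) - (gradc u i x - partial i phi x)).
      by apply/funext => x; ring.
    apply: (le_trans (L2n_sub_le _ _ _ _)).
    - exact: measurable_funB.
    - exact: measurable_funB.
    - exact: intg_sub_sqr.
    - exact: intg_sub_sqr.
    by rewrite lerD2l ltW.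
  rewrite big_split /= lerD2l sumr_const card_ord -mulr_natl /e' mulrCA ler_piMr ?(ltW e0)//.
  by rewrite ler_pdivrMr// mul1r ler_nat.
have ge2 : \sum_i \int[mu]_(x in O) (partial i (fun x => phi x - phi0 x) x ^+ 2) <= (g + e) ^+ 2.
  apply: (@le_trans _ _ ((\sum_i L2n (partial i (fun x => phi x - phi0 x))) ^+ 2)).
    under eq_bigr => i _ do rewrite -L2n_sqr.
    rewrite expr2 mulr_suml; apply: ler_sum => i _; rewrite expr2.
    rewrite ler_wpM2l ?L2n_ge0// (bigD1 i)//= lerDl; apply: sumr_ge0 => j _; exact: L2n_ge0.
  by rewrite lerXn2r ?nnegrE ?addr_ge0 ?(ltW e0)// sumr_ge0// => i _; exact: L2n_ge0.
have s0 : 0 <= \sum_i \int[mu]_(x in O) (partial i (fun x => phi x - phi0 x) x ^+ 2).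
  by apply: sumr_ge0 => i _; apply: Rintegral_ge0 => x _; exact: sqr_ge0.
have fe2 : \int[mu]_(x in O) ((phi x - phi0 x) ^+ 2) <= (f + e) ^+ 2.
  by rewrite -L2n_sqr lerXn2r ?nnegrE ?L2n_ge0 ?addr_ge0 ?(ltW e0).
have i0 : 0 <= \int[mu]_(x in O) ((phi x - phi0 x) ^+ 2).
  by apply: Rintegral_ge0 => x _; exact: sqr_ge0.
by apply: ler_pM => //; rewrite ?mulr_ge0 ?addr_ge0// ler_wpM2l// lerD.
Qed.

Lemma test_fun0 : test_fun O (fun=> 0).
Proof.
have c0 : continuous ((fun=> 0) : E -> R) by exact: cst_continuous.
have C0 k : Ck k ((fun=> 0) : E -> R).
  elim: k => [|k IHk]; split => // i; split.
    by move=> x; exact: (@derivable_cst R E R^o 0).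
  have -> : partial i (fun=> 0) = ((fun=> 0) : E -> R); last exact: IHk.
  by apply/funext => x; exact: (@derive_cst R E R^o 0).
have s0 : [set x : E | (0 : R) != 0] = set0.
  by apply/seteqP; split => x //=; rewrite eqxx.
split => //; first by rewrite s0 closure0; exact: compact0.
by rewrite s0 closure0.
Qed.

Lemma partial_cst0 i : partial i ((fun=> 0) : E -> R) = (fun=> 0).
Proof. by apply/funext => x; exact: (@derive_cst R E R^o 0). Qed.

Lemma H10_L4 u : H10 (cst 1) O u -> 
  let f := L2n (sobval u) in let g := \sum_i L2n (gradc u i) in
  intg (fun x => sobval u x ^+ 4) /\
  \int[mu]_(x in O) (sobval u x ^+ 4) <= 2 * (f ^+ 2 + g ^+ 2) * g ^+ 2.
Proof.
move=> uH; have := H10_L4_sub uH test_fun0.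
have -> : (fun x => sobval u x - 0) = sobval u by apply/funext => x; rewrite subr0.
have -> : (fun x => (sobval u x - 0) ^+ 4) = (fun x => sobval u x ^+ 4).
  by apply/funext => x; rewrite subr0.
suff -> : \sum_i L2n (fun x => gradc u i x - partial i ((fun=> 0) : E -> R) x) =
  \sum_i L2n (gradc u i) by [].
by apply: eq_bigr => i _; congr lnorm2; apply/funext => x; rewrite partial_cst0 subr0.
Qed.

Lemma H10_approx4 u : H10 (cst 1) O u -> forall e, 0 < e -> exists phi, [/\ test_fun O phi,
  intg (fun x => (sobval u x - phi x) ^+ 4),
  L4n (fun x => sobval u x - phi x) < e &
  forall i, L2n (fun x => gradc u i x - partial i phi x) < e].
Proof.
(* with both norms at most e / 2 the bound of [H10_L4_sub] is e ^ 4 / 4 *)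
move=> uH e e0; pose e' := e / (2 * n.+1%:R).
have e'0 : 0 < e' by rewrite divr_gt0// mulr_gt0.
have e'e : e' <= e.
  rewrite ler_pdivrMr ?mulr_gt0// ler_peMr ?(ltW e0)// -natrM ler1n//.
have [phi [tphi hphi hgrad]] := H10_approx uH e'0.
exists phi; have [i4 le4] := H10_L4_sub uH tphi; split => //; last first.
  by move=> i; rewrite (lt_le_trans (hgrad i)).
move: le4; set f := L2n _; set g := \sum_i _ => le4.
have f0 : 0 <= f by exact: L2n_ge0.
have g0 : 0 <= g by apply: sumr_ge0 => i _; exact: L2n_ge0.
pose s := e / 2.
have s0 : 0 < s by rewrite divr_gt0.
have e'E : e' = s / n.+1%:R by rewrite /e' /s invfM mulrA.
have fs : f <= s.
  by rewrite (le_trans (ltW hphi))// e'E ler_piMr ?(ltW s0)// invf_le1// ler1n.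
have gs : g <= s.
  apply: (@le_trans _ _ (\sum_(i < n) e')); first by apply: ler_sum => i _; exact: ltW.
  rewrite sumr_const card_ord -mulr_natl e'E mulrCA ler_piMr ?(ltW s0)//.
  by rewrite ler_pdivrMr// mul1r ler_nat.
have le_s : \int[mu]_(x in O) ((sobval u x - phi x) ^+ 4) <= 4 * s ^+ 4.
  apply: (le_trans le4); rewrite (_ : 4 * s ^+ 4 = 2 * (s ^+ 2 + s ^+ 2) * s ^+ 2); last by ring.
  by apply: ler_pM; rewrite ?mulr_ge0 ?addr_ge0 ?sqr_ge0// ?ler_wpM2l// ?lerD// lerXn2r ?nnegrE ?(ltW s0).
apply: (@le_lt_trans _ _ (Num.sqrt (Num.sqrt (4 * s ^+ 4)))).
  by rewrite /lnorm4 !ler_wsqrtr.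
rewrite (_ : 4 * s ^+ 4 = (2 * s ^+ 2) ^+ 2); last by ring.
rewrite sqrtr_sqr ger0_norm; last by rewrite mulr_ge0 ?sqr_ge0.
have -> : e = Num.sqrt (e ^+ 2) by rewrite sqrtr_sqr gtr0_norm.
rewrite ltr_sqrt ?exprn_gt0// /s.
rewrite (_ : 2 * (e / 2) ^+ 2 = e ^+ 2 / 2); last by field.
by rewrite ltr_pdivrMr// ltr_pMr ?exprn_gt0// ltr1n.
Qed.

End SobolevL4.

(** * Skew-symmetry of the convection term *)

Section Skew.
Context {R : realType} {n : nat}.
Local Notation E := 'rV[R]_n.
Local Notation mu := (lebesgue_row R n).
Variables (O : set E) (oO : open O) (bO : bounded_set O) (n23 : n = 2%N \/ n = 3%N).

Let mO : measurable O := open_measurable_row oO.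
Local Notation intg f := (mu.-integrable O (EFin \o f)).
Local Notation L2n := (lnorm2 mu O).
Local Notation L4n := (lnorm4 mu O).
Local Notation H1O := (H10 (cst 1) O).

(** The restriction to e <= 1 lets the error terms that are quadratic in e be absorbed. *)
Lemma eq0_of_small (J C : R) : 0 <= C ->
  (forall e, 0 < e -> e <= 1 -> `|J| <= e * C) -> J = 0.
Proof.
move=> C0 JC; apply/eqP; rewrite -normr_le0 leNgt; apply/negP => J0.
pose e := Num.min 1 (`|J| / (2 * (C + 1))).
have C1 : 0 < 2 * (C + 1) by rewrite mulr_gt0// ltr_wpDl.
have e0 : 0 < e by rewrite lt_min ltr01 divr_gt0.
have := JC e e0; rewrite ge_min lexx => /(_ isT); rewrite leNgt => /negP; apply.
apply: (@le_lt_trans _ _ (`|J| / (2 * (C + 1)) * C)).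
  by rewrite ler_wpM2r// ge_min lexx orbT.
rewrite mulrAC ltr_pdivrMr// ltr_pM2l//; move: C0; lra.
Qed.

(** Hoelder's inequality with exponents 4, 4, 2 makes the trilinear terms integrable. *)
Lemma H10_mul3 a f b i : H1O a -> H1O f -> H1O b ->
  intg (fun x => sobval a x * sobval f x * gradc b i x).
Proof.
move=> /[dup] /(H10_L4 oO bO n23)[a4 _] /(H10_L2)[ma _ _ _].
move=> /[dup] /(H10_L4 oO bO n23)[f4 _] /(H10_L2)[mf _ _ _].
move=> /(H10_L2)[_ _ mb ib].
by have [] := intg_mul3 mO ma mf (mb i) a4 f4 (ib i).
Qed.

(** For a test function phi in place of f this is the definition of the weak
derivative of a, tested with phi^2. The general case follows because both
integrals are continuous in f for the L^4 norm of f and the L^2 norm of its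
gradient. *)
Lemma H10_skew a f i : H1O a -> H1O f ->
  \int[mu]_(x in O) (sobval a x * sobval f x * gradc f i x) +
  2^-1 * \int[mu]_(x in O) (sobval f x * sobval f x * gradc a i x) = 0.
Proof.
move=> aH fH.
have [a4 _] := H10_L4 oO bO n23 aH; have [f4 _] := H10_L4 oO bO n23 fH.
have [ma ia mga iga] := H10_L2 aH; have [mf if_ mgf igf] := H10_L2 fH.
set A := sobval a; set F := sobval f; set p := gradc f i; set q := gradc a i.
pose C := L4n A * L2n p + L4n A * L4n F + L4n A + L4n F * L2n q + L2n q.
apply: (@eq0_of_small _ C); first by rewrite !addr_ge0 ?mulr_ge0 ?L4n_ge0 ?L2n_ge0.
move=> e e0 e1.
have [phi [tphi i4 h4 /(_ i) h2]] := H10_approx4 oO bO n23 fH e0.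
have [mp ip4] := test_fun_intg mO 3 tphi; have [mdp idp] := test_fun_partial_intg mO i 1 tphi.
pose dl x := F x - phi x; pose D x := p x - partial i phi x.
have mdl : measurable_fun O dl by exact: measurable_funB.
have mD : measurable_fun O D by exact: (measurable_funB (mgf i) mdp).
have idl4 : intg (fun x => dl x ^+ 4) by [].
have iD2 : intg (fun x => D x ^+ 2) by exact: (intg_sub_sqr oO (mgf i) mdp (igf i) idp).
have [i1 b1] := intg_mul3 mO ma mdl (mgf i) a4 idl4 (igf i).
have [i2 b2] := intg_mul3 mO ma mf mD a4 f4 iD2.
have [i3 b3] := intg_mul3 mO ma mdl mD a4 idl4 iD2.
have [i5 b5] := intg_mul3 mO mf mdl (mga i) f4 idl4 (iga i).
have [i6 b6] := intg_mul3 mO mdl mdl (mga i) idl4 idl4 (iga i).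
have [i7 _] := intg_mul3 mO ma mp mdp a4 ip4 idp.
have [i8 _] := intg_mul3 mO mp mp (mga i) ip4 ip4 (iga i).
have i9 := H10_mul3 i aH fH fH; have i10 := H10_mul3 i fH fH aH.
have test0 : \int[mu]_(x in O) (A x * phi x * partial i phi x) +
    2^-1 * \int[mu]_(x in O) (phi x * phi x * q x) = 0.
  have [[_ _ [_ _ /(_ _ i (test_fun_sqr tphi)) wg]] _] := aH.
  have [/(_ 1%N)[_ /(_ i)[dphi _]] _ _] := tphi.
  rewrite partialM// in wg.
  have -> : \int[mu]_(x in O) (phi x * phi x * q x) = \int[mu]_(x in O) (sobgrad a x 0 i * (phi x * phi x)).
    by apply: eq_Rintegral => x _; rewrite mulrC.
  rewrite -[X in 2^-1 * X]opprK -wg.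
  have -> : \int[mu]_(x in O) (sobval a x * (phi x * partial i phi x + phi x * partial i phi x)) =
      2 * \int[mu]_(x in O) (A x * phi x * partial i phi x).
    by rewrite -RintegralZl//; apply: eq_Rintegral => x _; rewrite /A; ring.
  by rewrite mulrN mulrA mulVf ?mul1r ?subrr.
(* write A F p around phi: the terms without an error factor [dl] or [D] are those of [test0] *)
have EA : \int[mu]_(x in O) (A x * F x * p x) = \int[mu]_(x in O) (A x * dl x * p x)
   + \int[mu]_(x in O) (A x * F x * D x) - \int[mu]_(x in O) (A x * dl x * D x)
   + \int[mu]_(x in O) (A x * phi x * partial i phi x).
  rewrite -RintegralD// -RintegralB//; last exact: intgD.
  rewrite -RintegralD//; last by apply: intgB => //; exact: intgD.
  by apply: eq_Rintegral => x _; rewrite /dl /D; ring.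
have EF : \int[mu]_(x in O) (F x * F x * q x) = 2 * \int[mu]_(x in O) (F x * dl x * q x)
   - \int[mu]_(x in O) (dl x * dl x * q x) + \int[mu]_(x in O) (phi x * phi x * q x).
  rewrite -RintegralZl// -RintegralB//; last exact: intgZ.
  rewrite -RintegralD//; last by apply: intgB => //; exact: intgZ.
  by apply: eq_Rintegral => x _; rewrite /dl; ring.
rewrite EA EF.
have A4 : 0 <= L4n A by exact: L4n_ge0. have F4 : 0 <= L4n F by exact: L4n_ge0.
have P2 : 0 <= L2n p by exact: L2n_ge0. have Q2 : 0 <= L2n q by exact: L2n_ge0.
have dl0 : 0 <= L4n dl by exact: L4n_ge0. have D0 : 0 <= L2n D by exact: L2n_ge0.
have dle : L4n dl <= e by exact: ltW.
have De : L2n D <= e by exact: ltW.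
have {}b1 : `|\int[mu]_(x in O) (A x * dl x * p x)| <= e * (L4n A * L2n p).
  by apply: (le_trans b1); rewrite [leLHS]mulrAC mulrC; apply: ler_wpM2r => //; exact: (mulr_ge0 A4 P2).
have {}b2 : `|\int[mu]_(x in O) (A x * F x * D x)| <= e * (L4n A * L4n F).
  by apply: (le_trans b2); rewrite mulrC; apply: ler_wpM2r => //; exact: (mulr_ge0 A4 F4).
have {}b3 : `|\int[mu]_(x in O) (A x * dl x * D x)| <= e * L4n A.
  apply: (le_trans b3); rewrite -mulrA mulrC ler_wpM2r//.
  by rewrite -[leRHS]mulr1; apply: ler_pM => //; exact: le_trans De e1.
have {}b5 : `|\int[mu]_(x in O) (F x * dl x * q x)| <= e * (L4n F * L2n q).
  by apply: (le_trans b5); rewrite [leLHS]mulrAC mulrC; apply: ler_wpM2r => //; exact: (mulr_ge0 F4 Q2).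
have {}b6 : `|\int[mu]_(x in O) (dl x * dl x * q x)| <= e * L2n q.
  apply: (le_trans b6); rewrite ler_wpM2r// -[leRHS]mulr1.
  by apply: ler_pM => //; exact: le_trans dle e1.
move: test0 b1 b2 b3 b5 b6; rewrite /C.
move: (\int[mu]_(x in O) (A x * phi x * partial i phi x)) (\int[mu]_(x in O) (phi x * phi x * q x)) => t1 t2.
move: (\int[mu]_(x in O) (A x * dl x * p x)) (\int[mu]_(x in O) (A x * F x * D x)) => s1 s2.
move: (\int[mu]_(x in O) (A x * dl x * D x)) (\int[mu]_(x in O) (F x * dl x * q x)) => s3 s5.
move: (\int[mu]_(x in O) (dl x * dl x * q x)) => s6 t12.
have -> : s1 + s2 - s3 + t1 + 2^-1 * (2 * s5 - s6 + t2) = s1 + s2 - s3 + s5 - s6 / 2.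
  by rewrite -[RHS]addr0 -t12; field.
rewrite !mulrDr !ler_norml; move: (e * _) (e * _) (e * L4n A) (e * _) (e * L2n q) => c1 c2 c3 c5 c6.
move=> /andP[? ?] /andP[? ?] /andP[? ?] /andP[? ?] /andP[? ?]; apply/andP; split; lra.
Qed.

Section Vector.
Local Notation vH1O := (vH10 O).

Lemma convectionE (u v z : vsobfun R n) : convection u v z =
  (fun x => \sum_i \sum_j sobval (u j) x * sobval (z i) x * gradc (v i) j x).
Proof.
apply/funext => x; rewrite /convection; apply: eq_bigr => i _.
rewrite /dotr mulr_suml; apply: eq_bigr => j _.
by rewrite mxE /gradc mulrAC.
Qed.

Lemma div_dotE (u v z : vsobfun R n) : (fun x => divg u x * dotr (vsobval v x) (vsobval z x)) =
  (fun x => \sum_i \sum_j sobval (v i) x * sobval (z i) x * gradc (u j) j x).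
Proof.
apply/funext => x; rewrite /divg /dotr mulr_sumr; apply: eq_bigr => i _.
rewrite mulr_suml; apply: eq_bigr => j _.
by rewrite !mxE /gradc mulrC.
Qed.

Lemma convection_intg u v z : vH1O u -> vH1O v -> vH1O z -> intg (convection u v z).
Proof.
move=> uH vH zH; rewrite convectionE; apply: intg_sum => // i _; apply: intg_sum => // j _.
exact: H10_mul3.
Qed.

Lemma div_dot_intg u v z : vH1O u -> vH1O v -> vH1O z ->
  intg (fun x => divg u x * dotr (vsobval v x) (vsobval z x)).
Proof.
move=> uH vH zH; rewrite div_dotE; apply: intg_sum => // i _; apply: intg_sum => // j _.
exact: H10_mul3.
Qed.

Lemma convection_skew u v : vH1O u -> vH1O v ->
  \int[mu]_(x in O) convection u v v x +
  2^-1 * \int[mu]_(x in O) (divg u x * dotr (vsobval v x) (vsobval v x)) = 0.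
Proof.
move=> uH vH; rewrite convectionE div_dotE.
rewrite !Rintegral_sum//; last 2 first.
- by move=> i _; apply: intg_sum => // j _; exact: H10_mul3.
- by move=> i _; apply: intg_sum => // j _; exact: H10_mul3.
rewrite mulr_sumr -big_split big1// => i _.
rewrite !Rintegral_sum//; last 2 first.
- by move=> j _; exact: H10_mul3.
- by move=> j _; exact: H10_mul3.
rewrite mulr_sumr -big_split big1// => j _.
exact: H10_skew.
Qed.

(** Poincare's inequality for a zero gradient: the L^4 bound has the gradient
as a factor. *)
Lemma H10_val_ae0 (u : sobfun R n) : H1O u -> (\forall x \ae mu, O x -> sobgrad u x = 0) ->
  \forall x \ae mu, O x -> sobval u x = 0.
Proof.
move=> uH u0; have [i4 le4] := H10_L4 oO bO n23 uH; have [mu1 _ mg ig] := H10_L2 uH.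
have g0 : \sum_i L2n (gradc u i) = 0.
  rewrite big1// => i _; rewrite /lnorm2.
  suff -> : \int[mu]_(x in O) (gradc u i x ^+ 2) = 0 by rewrite sqrtr0.
  rewrite /Rintegral (ae_eq_integral (cst 0%E))//.
  - by rewrite integral_cst// mul0e.
  - by apply/measurable_EFinP; exact: measurable_funX.
  - by apply: filterS u0 => x ux Ox; rewrite /gradc ux// mxE expr0n.
rewrite g0 expr0n mulr0 in le4.
have iz : (\int[mu]_(x in O) (sobval u x ^+ 4)%:E = 0)%E.
  apply/eqP; rewrite eq_le integral_ge0 ?andbT; last first.
    by move=> x _; rewrite lee_fin (exprM _ 2 2) sqr_ge0.
  by rewrite -[leLHS]fineK ?lee_fin//; exact: integrable_fin_num.
have : ae_eq mu O (fun x => (sobval u x ^+ 4)%:E) (cst 0%E).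
  apply/(ae_eq_integral_abs mu mO).
    by apply/measurable_EFinP; exact: measurable_funX.
  rewrite -iz; apply: eq_integral => x _ /=; rewrite ger0_norm//.
  by rewrite (exprM _ 2 2) sqr_ge0.
by apply: filterS => x + Ox => /(_ Ox)[/eqP]; rewrite expf_eq0 /= => /eqP.
Qed.

End Vector.

End Skew.

(** * Continuity in parameters and norms of combinations *)

Section ParameterIntegral.
Context d (T : measurableType d) (R : realType) (mu : {measure set T -> \bar R}).
Variables (D : set T) (mD : measurable D).
Local Notation intg f := (mu.-integrable D (EFin \o f)).

(** Dominated convergence is about sequences, hence the detour by a sequence
of parameters at distance less than 1 / (m + 1) on which continuity fails. *)
Lemma continuous_param_integral (V : normedModType R) (k : V -> T -> R) (H : T -> R) :
  (forall e, measurable_fun D (k e)) ->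
  (forall x, D x -> continuous (k ^~ x)) ->
  (forall e x, D x -> `|k e x| <= H x) -> intg H ->
  continuous (fun e => \int[mu]_(x in D) k e x).
Proof.
move=> mk ck kH iH e0; apply/cvgrPdist_lt => eps eps0.
apply: contrapT => far.
have pick_far m : exists e, `|e0 - e| < m.+1%:R^-1 /\
    eps <= `|\int[mu]_(x in D) k e0 x - \int[mu]_(x in D) k e x|.
  apply: contrapT => none; apply: far; apply/nbhs_ballP.
  exists m.+1%:R^-1; first by rewrite /= invr_gt0.
  move=> e; rewrite -ball_normE /ball_ /= => e0e; rewrite ltNge; apply/negP => le_eps.
  by apply: none; exists e.
have /choice[s sP] := pick_far.
have s_cvg : s @ \oo --> e0.
  apply/cvgrPdist_lt => del del0.
  exists (Num.truncn del^-1).+1 => // m /= lem; have [sm _] := sP m.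
  apply: (lt_trans sm); rewrite -[ltRHS]invrK ltf_pV2 ?posrE ?invr_gt0//.
  by apply: (lt_le_trans (truncnS_gt _)); rewrite ler_nat (leq_trans lem).
have ik e : intg (k e).
  have H0 x : D x -> 0 <= H x by move=> Dx; exact: le_trans (normr_ge0 _) (kH e x Dx).
  by have [] := ae_le_intg mD (mk e) iH H0 (aeW _ (fun x Dx => kH e x Dx)).
have DC := @dominated_convergence _ _ _ mu D mD (fun m x => (k (s m) x)%:E)
  (fun x => (k e0 x)%:E) (EFin \o H)
  (fun m => (measurable_EFinP _ _).2 (mk (s m))) ((measurable_EFinP _ _).2 (mk e0))
  (aeW _ (fun x Dx => cvg_EFin _ (cvg_comp _ _ s_cvg (ck x Dx e0)))) iH
  (aeW _ (fun x m Dx => kH (s m) x Dx)).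
have [|_ _ dc] := DC _; first by move=> x; exact: nearW.
have : (fun m => \int[mu]_(x in D) k (s m) x) @ \oo --> \int[mu]_(x in D) k e0 x.
  apply: fine_cvg; rewrite fineK; first exact: dc.
  exact: (integrable_fin_num mD (ik e0)).
move=> /cvgrPdist_lt/(_ eps eps0)[m _ /(_ m (leqnn m))].
by have [_] := sP m; rewrite leNgt => /negP.
Qed.

End ParameterIntegral.

Section GramNorm.
Context {R : realType} {n : nat}.
Variable G : 'M[R]_n.
Hypothesis Gsym : G^T = G.
Hypothesis Gpsd : forall c : 'rV[R]_n, 0 <= (c *m G *m c^T) 0 0.
Hypothesis Gdef : forall c : 'rV[R]_n, (c *m G *m c^T) 0 0 = 0 -> c = 0.

Definition gram_norm (c : 'rV[R]_n) := Num.sqrt ((c *m G *m c^T) 0 0).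

Lemma gram_norm_continuous : continuous gram_norm.
Proof.
rewrite /gram_norm => c.
apply: (@continuous_comp _ _ _ (fun c : 'rV[R]_n => (c *m G *m c^T) 0 0) (Num.sqrt : R -> R) c).
  apply: (@continuous_mulmx R _ 1 n 1 (fun c : 'rV[R]_n => c *m G) (fun c : 'rV[R]_n => c^T)) => i j.
    apply: (@continuous_mulmx R _ 1 n n id (fun=> G)) => k l.
      exact: coord_continuous.
    exact: cst_continuous.
  by under eq_fun do rewrite mxE; exact: coord_continuous.
exact: sqrt_continuous.
Qed.

Lemma gram_normZ t c : 0 <= t -> gram_norm (t *: c) = t * gram_norm c.
Proof.
move=> t0; rewrite /gram_norm linearZ /= -!scalemxAl -scalemxAr scalerA mxE.
by rewrite sqrtrM ?mulr_ge0// -expr2 sqrtr_sqr ger0_norm.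
Qed.

Lemma unitmx_of_injective (A : 'M[R]_n) : (forall c : 'rV[R]_n, c *m A = 0 -> c = 0) ->
  A \in unitmx.
Proof.
move=> A0; rewrite -row_free_unit -kermx_eq0; apply/eqP/row_matrixP => i.
by rewrite row0; apply: A0; rewrite -row_mul mulmx_ker row0.
Qed.

Lemma gram_cauchy_schwarz (c e : 'rV[R]_n) :
  `|(c *m G *m e^T) 0 0| <= gram_norm c * gram_norm e.
Proof.
pose q (a b : 'rV[R]_n) := (a *m G *m b^T) 0 0.
have qC a b : q a b = q b a.
  by rewrite /q -[a *m G *m _]trmxK [in LHS]mxE !trmx_mul trmxK Gsym mulmxA.
have qD a1 a2 b : q (a1 + a2) b = q a1 b + q a2 b by rewrite /q !mulmxDl mxE.
have qZ t a b : q (t *: a) b = t * q a b by rewrite /q -!scalemxAl mxE.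
have qDr a b1 b2 : q a (b1 + b2) = q a b1 + q a b2 by rewrite qC qD (qC b1) (qC b2).
have qZr t a b : q a (t *: b) = t * q a b by rewrite qC qZ (qC b).
have expand t s : q (t *: c + s *: e) (t *: c + s *: e) =
    t ^+ 2 * q c c + 2 * t * s * q c e + s ^+ 2 * q e e.
  rewrite !(qD, qDr, qZ, qZr) (qC e c); ring.
apply: le_sqrt_of_young; [exact: Gpsd|exact: Gpsd|move=> t t0].
rewrite -!/(q _ _); have t'0 : 0 < t^-1 by rewrite invr_gt0.
have h s : s ^+ 2 = 1 -> 0 <= t * q c c + 2 * s * q c e + t^-1 * q e e.
  move=> s1; have : 0 <= t^-1 * q (t *: c + s *: e) (t *: c + s *: e).
    by rewrite mulr_ge0 ?(ltW t'0)//; exact: Gpsd.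
  rewrite expand s1 !mulrDr mul1r expr2 !mulrA mulVf ?gt_eqF// mul1r.
  by rewrite [t^-1 * 2]mulrC -[2 * _ * t]mulrA mulVf ?gt_eqF// mulr1.
have := h 1 (expr1n _ _); have := h (-1); rewrite sqrrN expr1n => /(_ erefl).
rewrite ler_norml; move: (t * _) (t^-1 * _) (q c e) => x y z; move=> h1 h2.
by apply/andP; split; lra.
Qed.

(** Equivalence of norms in finite dimension, without compactness: the
coordinates are read off c G by the inverse matrix, and the entries of c G are
bounded by Cauchy-Schwarz. *)
Lemma gram_coord_le : exists K : R, forall (c : 'rV[R]_n) i, `|c 0 i| <= K * gram_norm c.
Proof.
pose K := \sum_i \sum_j gram_norm (delta_mx 0 j) * `|invmx G j i|.
have uG : G \in unitmx.
  by apply: unitmx_of_injective => c cG; apply: Gdef; rewrite cG mul0mx mxE.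
exists K => c i.
have -> : c 0 i = \sum_j (c *m G) 0 j * invmx G j i by rewrite -[in LHS](mulmxK uG c) mxE.
apply: (le_trans (ler_norm_sum _ _ _)).
apply: (@le_trans _ _ (\sum_j gram_norm (delta_mx 0 j) * `|invmx G j i| * gram_norm c)).
  apply: ler_sum => j _; rewrite normrM mulrAC; apply: ler_wpM2r => //.
  rewrite mulrC; apply: le_trans (gram_cauchy_schwarz c (delta_mx 0 j)).
  by rewrite trmx_delta -colE [(col _ _) _ _]mxE.
rewrite -mulr_suml ler_wpM2r ?sqrtr_ge0// /K [leRHS](bigD1 i)//= lerDl.
by apply: sumr_ge0 => k _; apply: sumr_ge0 => j _; rewrite mulr_ge0 ?sqrtr_ge0.
Qed.

End GramNorm.

(** * Linear forms on subspaces *)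

Section LinearOn.
Context {R : realType} {U : lmodType R}.
Implicit Types (V : set U) (L : U -> R).

Definition subspace V := V 0 /\ forall (a : R) u v, V u -> V v -> V (a *: u + v).

Definition linear_on V L := forall (a : R) u v, V u -> V v -> L (a *: u + v) = a * L u + L v.

Definition comb m (b : 'I_m -> U) (c : 'rV[R]_m) : U := \sum_i c 0 i *: b i.

Lemma fin_dim_subspace V : fin_dim V -> subspace V.
Proof.
move=> [m [b ->]]; split; first by exists (fun=> 0) => //; apply: big1 => i _; rewrite scale0r.
move=> a _ _ [c _ <-] [c' _ <-]; exists (fun i => a * c i + c' i) => //.
rewrite scaler_sumr -big_split; apply: eq_bigr => i _.
by rewrite scalerDl scalerA.
Qed.

Section Subspace.
Variables (V : set U) (sV : subspace V).

Lemma linear_on0 L : linear_on V L -> L 0 = 0.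
Proof.
move=> lL; have := lL 1 0 0 sV.1 sV.1; rewrite scaler0 addr0 mul1r => /eqP.
by rewrite -subr_eq0 opprD addNKr oppr_eq0 => /eqP.
Qed.

Lemma subspace_comb m (b : 'I_m -> U) c : (forall i, V (b i)) -> V (comb b c).
Proof.
move=> Vb; rewrite /comb; elim/big_ind: _ => [|u v Vu Vv|i _]; first exact: sV.1.
  by rewrite -[u]scale1r; exact: sV.2.
by rewrite -[_ *: _]addr0; apply: sV.2 => //; exact: sV.1.
Qed.

Lemma linear_on_comb L m (b : 'I_m -> U) c : linear_on V L -> (forall i, V (b i)) ->
  L (comb b c) = \sum_i c 0 i * L (b i).
Proof.
move=> lL Vb; suff [_ ->] : V (comb b c) /\ L (comb b c) = \sum_i c 0 i * L (b i) by [].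
rewrite /comb; elim/big_ind2: _ => [|lu u lv v [Vu Lu] [Vv Lv]|i _].
- by split; [exact: sV.1|exact: linear_on0].
- split; first by have := sV.2 1 u v Vu Vv; rewrite scale1r.
  by have := lL 1 u v Vu Vv; rewrite scale1r mul1r Lu Lv.
- split; first by have := sV.2 (c 0 i) _ _ (Vb i) sV.1; rewrite addr0.
  by have := lL (c 0 i) _ _ (Vb i) sV.1; rewrite addr0 linear_on0// addr0.
Qed.

End Subspace.

End LinearOn.

(** * The integrands of the discrete problem *)

Section Pointwise.
Context {R : realType} {n : nat}.
Local Notation E := 'rV[R]_n.
Implicit Types (u v z : vsobfun R n) (r s : sobfun R n).

Lemma dotrC (x y : E) : dotr x y = dotr y x.
Proof. by apply: eq_bigr => i _; rewrite mulrC. Qed.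

Lemma dotrDZl a (x y z : E) : dotr (a *: x + y) z = a * dotr x z + dotr y z.
Proof.
rewrite /dotr mulr_sumr -big_split; apply: eq_bigr => i _.
by rewrite !mxE mulrDl mulrA.
Qed.

Lemma dotrDZr a (x y z : E) : dotr z (a *: x + y) = a * dotr z x + dotr z y.
Proof. by rewrite dotrC dotrDZl !(dotrC z). Qed.

Lemma dotr0l (x : E) : dotr 0 x = 0.
Proof. by rewrite /dotr big1// => i _; rewrite mxE mul0r. Qed.

Lemma sobvalDZ a r s x : sobval (a *: r + s) x = a * sobval r x + sobval s x.
Proof. by []. Qed.

Lemma sobgradDZ a r s x : sobgrad (a *: r + s) x = a *: sobgrad r x + sobgrad s x.
Proof. by []. Qed.

Lemma vsobvalDZ a u v x : vsobval (a *: u + v) x = a *: vsobval u x + vsobval v x.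
Proof. by apply/rowP => i; rewrite !mxE. Qed.

Lemma divgDZ a u v x : divg (a *: u + v) x = a * divg u x + divg v x.
Proof.
rewrite /divg mulr_sumr -big_split; apply: eq_bigr => i _.
by rewrite [sobgrad _ _]sobgradDZ !mxE.
Qed.

Lemma grad_dotC u v x : grad_dot u v x = grad_dot v u x.
Proof. by apply: eq_bigr => i _; exact: dotrC. Qed.

Lemma grad_dotDZl a u v z x : grad_dot (a *: u + v) z x = a * grad_dot u z x + grad_dot v z x.
Proof.
rewrite /grad_dot mulr_sumr -big_split; apply: eq_bigr => i _.
by rewrite [sobgrad _ _]sobgradDZ dotrDZl.
Qed.

(** Convection with the stabilizing term that makes it skew-symmetric in (v, z). *)
Definition skewf u v z : E -> R := fun x =>
  convection u v z x + 2^-1 * divg u x * dotr (vsobval v x) (vsobval z x).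

Lemma skewfDZ1 a u1 u2 v z x : skewf (a *: u1 + u2) v z x = a * skewf u1 v z x + skewf u2 v z x.
Proof.
rewrite /skewf divgDZ.
have -> : convection (a *: u1 + u2) v z x = a * convection u1 v z x + convection u2 v z x.
  rewrite /convection mulr_sumr -big_split; apply: eq_bigr => i _.
  by rewrite vsobvalDZ dotrDZl mulrDl mulrA.
by ring.
Qed.

Lemma skewfDZ2 a u v1 v2 z x : skewf u (a *: v1 + v2) z x = a * skewf u v1 z x + skewf u v2 z x.
Proof.
rewrite /skewf vsobvalDZ dotrDZl.
have -> : convection u (a *: v1 + v2) z x = a * convection u v1 z x + convection u v2 z x.
  rewrite /convection mulr_sumr -big_split; apply: eq_bigr => i _.
  by rewrite [sobgrad _ _]sobgradDZ dotrDZr mulrDl mulrA.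
by ring.
Qed.

Lemma skewfDZ3 a u v z1 z2 x : skewf u v (a *: z1 + z2) x = a * skewf u v z1 x + skewf u v z2 x.
Proof.
rewrite /skewf vsobvalDZ dotrDZr.
have -> : convection u v (a *: z1 + z2) x = a * convection u v z1 x + convection u v z2 x.
  rewrite /convection mulr_sumr -big_split; apply: eq_bigr => i _.
  by rewrite [sobval _ _]sobvalDZ /=; ring.
by ring.
Qed.

End Pointwise.

Section Forms.
Context {R : realType} {n : nat}.
Local Notation E := 'rV[R]_n.
Local Notation mu := (lebesgue_row R n).
Variables (O : set E) (oO : open O) (bO : bounded_set O) (n23 : n = 2%N \/ n = 3%N).
Let mO : measurable O := open_measurable_row oO.
Local Notation intg f := (mu.-integrable O (EFin \o f)).
Local Notation vH1O := (vH10 O).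

Lemma RintegralDZ (a : R) (f g h : E -> R) : intg f -> intg g ->
  (forall x, h x = a * f x + g x) ->
  \int[mu]_(x in O) h x = a * \int[mu]_(x in O) f x + \int[mu]_(x in O) g x.
Proof.
move=> If Ig hE; rewrite -RintegralZl// -RintegralD//; last exact: intgZ.
by apply: eq_Rintegral => x _.
Qed.

Lemma intg_bounded_mul (k f : E -> R) (K : R) : measurable_fun O k ->
  (forall x, O x -> `|k x| <= K) -> intg f -> intg (fun x => k x * f x).
Proof.
move=> mk kK If; have K0 x : O x -> 0 <= K by move=> /kK; exact: le_trans.
have IF : intg (fun x => K * `|f x|) by apply: intgZ => //; exact: integrable_norm.
have [||||//] := @ae_le_intg _ _ _ mu O mO (fun x => k x * f x) (fun x => K * `|f x|).
- by apply: measurable_funM => //; exact: intg_measurable If.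
- exact: IF.
- by move=> x /K0 Kx; rewrite mulr_ge0.
- by apply: aeW => x Ox; rewrite normrM ler_wpM2r// kK.
Qed.

Lemma grad_dot_intg u v : vH1O u -> vH1O v -> intg (grad_dot u v).
Proof.
move=> uH vH; apply: intg_sum => // i _; apply: intg_sum => // j _.
have [_ _ mu1 iu] := H10_L2 (uH i); have [_ _ mv iv] := H10_L2 (vH i).
by have [] := intg_mul mO (mu1 j) (mv j) (iu j) (iv j).
Qed.

Lemma sum_intg2 (I : Type) (r : seq I) (f : I -> E -> R) :
  (forall i, measurable_fun O (f i) /\ intg (fun x => f i x ^+ 2)) ->
  measurable_fun O (fun x => \sum_(i <- r) f i x) /\
  intg (fun x => (\sum_(i <- r) f i x) ^+ 2).
Proof.
move=> f2; elim: r => [|i r [mr ir]].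
  have -> : (fun x => \sum_(i <- [::]) f i x) = cst 0.
    by apply/funext => x; rewrite big_nil.
  have -> : (fun x => (\sum_(i <- [::]) f i x) ^+ 2) = cst 0.
    by apply/funext => x; rewrite big_nil expr0n.
  by split; [exact: measurable_cst|exact: integrable0].
have [mi ii] := f2 i.
have -> : (fun x => \sum_(j <- i :: r) f j x) = (fun x => f i x + \sum_(j <- r) f j x).
  by apply/funext => x; rewrite big_cons.
have -> : (fun x => (\sum_(j <- i :: r) f j x) ^+ 2) = (fun x => (f i x + \sum_(j <- r) f j x) ^+ 2).
  by apply/funext => x; rewrite big_cons.
by split; [exact: measurable_funD|have [] := lnorm2_triangle mO mi mr ii ir].
Qed.

Lemma divg_intg2 u : vH1O u ->
  measurable_fun O (divg u) /\ intg (fun x => divg u x ^+ 2).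
Proof.
move=> uH; apply: (sum_intg2 _ (f := fun i => gradc (u i) i)) => i.
by have [_ _ mu1 iu] := H10_L2 (uH i).
Qed.

Lemma pressure_intg q u : L20 O q -> vH1O u -> intg (fun x => q x * divg u x).
Proof.
move=> [/L2_cst1[mq iq] _] /divg_intg2[md id].
by have [] := intg_mul mO mq md iq id.
Qed.

Lemma skewf_intg u v z : vH1O u -> vH1O v -> vH1O z -> intg (skewf u v z).
Proof.
move=> uH vH zH; apply: intgD => //; first exact: convection_intg.
have -> : (fun x => 2^-1 * divg u x * dotr (vsobval v x) (vsobval z x)) =
  (fun x => 2^-1 * (divg u x * dotr (vsobval v x) (vsobval z x))).
  by apply/funext => x; rewrite mulrA.
by apply: intgZ => //; exact: div_dot_intg.
Qed.

Lemma skewf_skew u v : vH1O u -> vH1O v -> \int[mu]_(x in O) skewf u v v x = 0.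
Proof.
move=> uH vH; rewrite -(convection_skew oO bO n23 uH vH) /skewf.
under eq_Rintegral => x _ do rewrite -mulrA.
rewrite RintegralD//; last 2 first.
- exact: convection_intg.
- by apply: intgZ => //; exact: div_dot_intg.
by rewrite RintegralZl//; exact: div_dot_intg.
Qed.

Section Weighted.
Variables (w : E -> R) (ww : weight w) (wi : weight (winv w)).

Lemma weight_measurable v : weight v -> measurable_fun O v.
Proof. by case=> mv _ _ _; exact: measurable_funTS. Qed.

(** Young's inequality with weights s and 1 / s, the form in which dual weights meet. *)
Lemma dotr_le (x y : E) (s t : R) : 0 < s -> 0 < t ->
  `|dotr x y| <= (t * (enorm x ^+ 2 * s) + t^-1 * (enorm y ^+ 2 * s^-1)) / 2.
Proof.
move=> s0 t0; rewrite !enorm_sqr !mulr_suml !mulr_sumr -big_split mulr_suml.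
apply: (le_trans (ler_norm_sum _ _ _)); apply: ler_sum => i _.
apply: (le_trans (young _ _ (mulr_gt0 t0 s0))).
rewrite invfM le_eqVlt; apply/orP; left; apply/eqP => /=.
by move: (t^-1) (s^-1) => t' s'; ring.
Qed.

Lemma grad_sqr_intg (v : E -> R) r : measurable_fun O v -> (forall x, 0 <= v x) -> H10 v O r ->
  (forall i, measurable_fun O (gradc r i)) /\
  intg (fun x => enorm (sobgrad r x) ^+ 2 * v x).
Proof.
move=> mv v0 [[_ gL _] _].
have mg i : measurable_fun O (gradc r i) by have [] := gL i.
split => //.
have -> : (fun x => enorm (sobgrad r x) ^+ 2 * v x) = (fun x => \sum_i gradc r i x ^+ 2 * v x).
  by apply/funext => x; rewrite enorm_sqr mulr_suml.
apply: intg_sum => // i _; apply: ge0_intg => //.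
- by apply: measurable_funM => //; exact: measurable_funX.
- by move=> x _; rewrite mulr_ge0 ?sqr_ge0.
- by have [_] := gL i.
Qed.

Lemma dotr_measurable r s : (forall i, measurable_fun O (gradc r i)) ->
  (forall i, measurable_fun O (gradc s i)) ->
  measurable_fun O (fun x => dotr (sobgrad r x) (sobgrad s x)).
Proof.
by move=> mr ms; apply: measurable_sum => i; apply: measurable_funM; [exact: mr|exact: ms].
Qed.

Lemma diffusion_bound (k : E -> R) (K : R) T r : measurable_fun O k -> 0 <= K ->
  (forall x, O x -> `|k x| <= K) -> H10 w O T -> H10 (winv w) O r ->
  intg (fun x => k x * dotr (sobgrad T x) (sobgrad r x)) /\
  `|\int[mu]_(x in O) (k x * dotr (sobgrad T x) (sobgrad r x))| <=
    K * H10norm w O T * H10norm (winv w) O r.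
Proof.
move=> mk K0 kK TH rH; have [_ w0 wpos _] := ww; have [_ winv_ge0 _ _] := wi.
have [mT iT] := grad_sqr_intg (weight_measurable ww) w0 TH.
have [mr ir] := grad_sqr_intg (weight_measurable wi) winv_ge0 rH.
have [||||||ik le_k] := @ae_young_intg _ _ _ mu O mO
  (fun x => k x * dotr (sobgrad T x) (sobgrad r x))
  (fun x => K * (enorm (sobgrad T x) ^+ 2 * w x))
  (fun x => K * (enorm (sobgrad r x) ^+ 2 * winv w x)).
- by apply: measurable_funM => //; exact: dotr_measurable.
- exact: intgZ.
- exact: intgZ.
- by move=> x _; apply: mulr_ge0 => //; apply: mulr_ge0 => //; exact: sqr_ge0.
- by move=> x _; apply: mulr_ge0 => //; apply: mulr_ge0 => //; exact: sqr_ge0.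
- apply: filterS wpos => x wx Ox t t0; rewrite normrM.
  apply: (@le_trans _ _ (K * ((t * (enorm (sobgrad T x) ^+ 2 * w x) +
      t^-1 * (enorm (sobgrad r x) ^+ 2 * winv w x)) / 2))).
    by apply: ler_pM => //; [exact: kK|exact: dotr_le].
  rewrite le_eqVlt; apply/orP; left; apply/eqP.
  by move: (t^-1) (winv w x) => t' w'; ring.
split => //; apply: (le_trans le_k).
rewrite !RintegralZl// !sqrtrM// mulrACA -expr2 sqr_sqrtr//.
by rewrite mulrA.
Qed.

Lemma weighted_dot_intg T S : H10 w O T -> H10 w O S ->
  intg (fun x => dotr (sobgrad T x) (sobgrad S x) * w x).
Proof.
move=> TH SH; have [_ w0 _ _] := ww.
have [mT iT] := grad_sqr_intg (weight_measurable ww) w0 TH.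
have [mS iS] := grad_sqr_intg (weight_measurable ww) w0 SH.
have [||||||//] := @ae_young_intg _ _ _ mu O mO
  (fun x => dotr (sobgrad T x) (sobgrad S x) * w x)
  (fun x => enorm (sobgrad T x) ^+ 2 * w x) (fun x => enorm (sobgrad S x) ^+ 2 * w x).
- by apply: measurable_funM; [exact: dotr_measurable|exact: weight_measurable ww].
- exact: iT.
- exact: iS.
- by move=> x _; rewrite mulr_ge0// sqr_ge0.
- by move=> x _; rewrite mulr_ge0// sqr_ge0.
- apply: aeW => x _ t t0; rewrite normrM (ger0_norm (w0 x)).
  apply: (@le_trans _ _ ((t * (enorm (sobgrad T x) ^+ 2 * 1) +
      t^-1 * (enorm (sobgrad S x) ^+ 2 * 1^-1)) / 2 * w x)).
    by apply: ler_wpM2r => //; exact: dotr_le.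
  rewrite invr1 le_eqVlt; apply/orP; left; apply/eqP.
  by move: (t^-1) => t'; ring.
Qed.

End Weighted.

End Forms.

(** * A priori estimates *)

Section Coefficients.
Context {R : realType}.

Lemma coefficient_continuous (nu : R -> R) num nup : coefficient nu num nup -> continuous nu.
Proof.
move=> [[M [_ lipM]] _ _] x.
have lip := lipM (`|M| + 1) (le_lt_trans (ler_norm M) (ltr_pwDr ltr01 (lexx _))).
 apply/cvgrPdist_lt => e e0.
have M0 : 0 < `|M| + 1 by rewrite ltr_wpDl.
apply/nbhs_ballP; exists (e / (`|M| + 1)); first by rewrite /= divr_gt0.
move=> y; rewrite /ball /= => xy.
have /= := lip (x, y) (conj I I) => /le_lt_trans; apply.
by rewrite mulrC -ltr_pdivlMr.
Qed.

Lemma coefficient_norm_le (nu : R -> R) num nup t : coefficient nu num nup -> `|nu t| <= nup.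
Proof.
move=> [_ n0 /(_ t)[lo hi]].
by rewrite ger0_norm// (le_trans (ltW n0)).
Qed.

End Coefficients.

Section Gram.
Context {R : realType} {U : lmodType R}.
Variables (V : set U) (sV : subspace V) (q : U -> U -> R).
Hypotheses (qC : forall u v, q u v = q v u) (qL : forall z, V z -> linear_on V (q ^~ z)).
Variables (m : nat) (b : 'I_m -> U) (Vb : forall i, V (b i)).

Definition gram : 'M[R]_m := \matrix_(i, j) q (b i) (b j).

Lemma gram_comb c e : (c *m gram *m e^T) 0 0 = q (comb b c) (comb b e).
Proof.
have Ve := subspace_comb sV e Vb; have Vc := subspace_comb sV c Vb.
rewrite (linear_on_comb sV c (qL Ve) Vb) mxE.
under eq_bigr => j _ do rewrite mxE mulr_suml.
rewrite exchange_big; apply: eq_bigr => i _ /=.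
rewrite qC (linear_on_comb sV e (qL (Vb i)) Vb) mulr_sumr; apply: eq_bigr => j _.
by rewrite !mxE (qC (b j)) mulrAC mulrA.
Qed.

Lemma gram_sym : gram^T = gram.
Proof. by apply/matrixP => i j; rewrite !mxE qC. Qed.

End Gram.

Section AlmostEverywhere.
Context d (T : measurableType d) (R : realType) (mu : {measure set T -> \bar R}).
Variables (D : set T) (mD : measurable D).
Local Notation intg f := (mu.-integrable D (EFin \o f)).

Lemma Rintegral_ae0 (f : T -> R) : measurable_fun D f ->
  (\forall x \ae mu, D x -> f x = 0) -> \int[mu]_(x in D) f x = 0.
Proof.
move=> mf f0; rewrite /Rintegral (ae_eq_integral (cst 0%E))//.
- by rewrite integral_cst// mul0e.
- exact/measurable_EFinP.
- by apply: filterS f0 => x fx Dx; rewrite fx.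
Qed.

Lemma ae0_of_Rintegral (f : T -> R) : intg f -> (forall x, D x -> 0 <= f x) ->
  \int[mu]_(x in D) f x = 0 -> \forall x \ae mu, D x -> f x = 0.
Proof.
move=> If f0 f1; have mf := intg_measurable If.
have : ae_eq mu D (fun x => (f x)%:E) (cst 0%E).
  apply/(ae_eq_integral_abs mu mD); first exact/measurable_EFinP.
  transitivity (\int[mu]_(x in D) (f x)%:E)%E.
    by apply: eq_integral => x /[!inE] Dx /=; rewrite ger0_norm ?f0.
  by rewrite -[LHS]fineK ?[fine _]f1//; exact: (integrable_fin_num mD If).
by apply: filterS => x + Dx => /(_ Dx)[].
Qed.

End AlmostEverywhere.

Section Estimates.
Context {R : realType} {n : nat}.
Local Notation E := 'rV[R]_n.
Local Notation mu := (lebesgue_row R n).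
Variables (O : set E) (oO : open O) (bO : bounded_set O) (n23 : n = 2%N \/ n = 3%N).
Let mO : measurable O := open_measurable_row oO.
Local Notation intg f := (mu.-integrable O (EFin \o f)).

(** The elements of seminorm zero: distinct representatives of the zero class
of the discrete space. *)
Definition grad_null : set (sobfun R n) := [set r | \forall x \ae mu, O x -> sobgrad r x = 0].

Lemma grad_null_subspace : subspace grad_null.
Proof.
split; first by apply: aeW.
move=> a r s r0 s0; apply: filterS2 r0 s0 => x rx sx Ox.
by rewrite sobgradDZ rx// sx// scaler0 addr0.
Qed.

Lemma H10norm_null v r : measurable_fun O v -> (forall i, measurable_fun O (gradc r i)) ->
  grad_null r -> H10norm v O r = 0.
Proof.
move=> mv mr r0; rewrite /H10norm /vL2norm Rintegral_ae0 ?sqrtr0//.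
- apply: measurable_funM => //; under eq_fun do rewrite enorm_sqr.
  by apply: measurable_sum => i; apply: measurable_funX; exact: mr.
- apply: filterS r0 => x rx Ox; rewrite rx// enorm_sqr big1 ?mul0r// => i _.
  by rewrite mxE expr0n.
Qed.

Lemma enorm_sqrE (x : E) : enorm x ^+ 2 = dotr x x.
Proof. by rewrite enorm_sqr; apply: eq_bigr => i _; rewrite expr2. Qed.

Lemma dotr_eq0 (x : E) : dotr x x = 0 -> x = 0.
Proof.
rewrite -enorm_sqrE enorm_sqr => /eqP; rewrite psumr_eq0; last by move=> i _; exact: sqr_ge0.
by move=> /allP x0; apply/rowP => i; have := x0 i; rewrite mem_index_enum mxE sqrf_eq0 => /(_ isT)/eqP.
Qed.

Lemma dotr_ge0 (x : E) : 0 <= dotr x x.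
Proof. by rewrite -enorm_sqrE sqr_ge0. Qed.

Lemma H10normE v r : H10norm v O r = Num.sqrt (\int[mu]_(x in O) (dotr (sobgrad r x) (sobgrad r x) * v x)).
Proof.
by rewrite /H10norm /vL2norm; under eq_Rintegral => x _ do rewrite enorm_sqrE.
Qed.

Section Heat.
Variables (w : E -> R) (ww : weight w) (wi : weight (winv w)).
Variables (W : set (sobfun R n)) (Ww : W `<=` H10 w O) (Wi : W `<=` H10 (winv w) O).
Variables (gam Ce2 : R) (gam0 : 0 < gam) (hCe2 : advection_const O w Ce2).
Hypothesis W_stable : grad_inf_sup O w (winv w) gam W.

Definition heat_form (k : E -> R) (u : vsobfun R n) (T r : sobfun R n) : R :=
  \int[mu]_(x in O) (k x * dotr (sobgrad T x) (sobgrad r x))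
  - \int[mu]_(x in O) (sobval T x * dotr (vsobval u x) (sobgrad r x)).

(** The inf-sup condition replaces coercivity, since T cannot be used as a
test function. In terms of t = |T|, the identity
kapp (grad T, grad r) = F r + advection + ((kapp - k) grad T, grad r)
gives gam kapp t <= Phi + (kapp - kapm) t + gam / 4 t, and the hypothesis on
kapm / kapp reads kapp - kapm <= gam kapp - gam / 2. *)
Lemma heat_estimate (k : E -> R) (kapm kapp : R) (u : vsobfun R n) (T : sobfun R n)
    (F : sobfun R n -> R) (Phi : R) :
  measurable_fun O k -> (forall x, O x -> kapm <= k x /\ k x <= kapp) ->
  0 < kapm -> kapm <= kapp -> 1 - gam * (1 - 1 / (2 * kapp)) <= kapm / kapp ->
  vH10 O u -> vH10norm O u <= flow_radius gam Ce2 -> W T -> 0 <= Phi ->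
  (forall r, W r -> heat_form k u T r = F r) ->
  (forall r, W r -> `|F r| <= Phi * H10norm (winv w) O r) ->
  gam / 4 * H10norm w O T <= Phi.
Proof.
move=> mk kk km0 kmp Lam uH ur WT Phi0 aF FPhi.
have [Ce0 adv] := hCe2; have kp0 : 0 < kapp by exact: lt_le_trans km0 kmp.
set t := H10norm w O T; have t0 : 0 <= t by exact: sqrtr_ge0.
set a := vH10norm O u in ur; have a0 : 0 <= a by exact: sqrtr_ge0.
pose S := (Phi + (kapp - kapm) * t + Ce2 * a * t) / kapp.
have S0 : 0 <= S.
  by rewrite divr_ge0 ?(ltW kp0)// !addr_ge0// ?mulr_ge0// ?(ltW Ce0)// subr_ge0.
have bound r : W r -> `|\int[mu]_(x in O) dotr (sobgrad T x) (sobgrad r x)| <= S * H10norm (winv w) O r.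
  move=> Wr; set nr := H10norm _ O r; have nr0 : 0 <= nr by exact: sqrtr_ge0.
  have mkd : measurable_fun O (fun x => kapp - k x) by exact: measurable_funB.
  have kd x : O x -> `|kapp - k x| <= kapp - kapm.
    by move=> /kk[? ?]; rewrite ger0_norm ?subr_ge0// lerD2l lerN2.
  have kb x : O x -> `|k x| <= kapp.
    by move=> /kk[? ?]; rewrite ger0_norm// (le_trans (ltW km0)).
  have kd0 : 0 <= kapp - kapm by rewrite subr_ge0.
  have [id led] := diffusion_bound oO ww wi mkd kd0 kd (Ww WT) (Wi Wr).
  have [ik _] := diffusion_bound oO ww wi mk (ltW kp0) kb (Ww WT) (Wi Wr).
  have [ia lea] := adv T u r (Ww WT) uH (Wi Wr).
  have E1 : kapp * \int[mu]_(x in O) dotr (sobgrad T x) (sobgrad r x) =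
      F r + \int[mu]_(x in O) (sobval T x * dotr (vsobval u x) (sobgrad r x)) +
      \int[mu]_(x in O) ((kapp - k x) * dotr (sobgrad T x) (sobgrad r x)).
    rewrite -(aF r Wr) /heat_form subrK -RintegralD// -RintegralZl//.
      by apply: eq_Rintegral => x _; ring.
    have m1 : measurable_fun O (cst (1 : R) : E -> R) by exact: measurable_cst.
    have b1 x : O x -> `|cst (1 : R) x| <= 1 by rewrite normr1.
    have [i1 _] := diffusion_bound oO ww wi m1 ler01 b1 (Ww WT) (Wi Wr).
    rewrite (_ : (fun x => dotr (sobgrad T x) (sobgrad r x)) =
      (fun x => cst 1 x * dotr (sobgrad T x) (sobgrad r x)))//.
    by apply/funext => x; rewrite mul1r.
  rewrite -(ler_pM2l kp0) -[X in X * `|_|](gtr0_norm kp0) -normrM E1.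
  rewrite /S mulrA [kapp * _]mulrC divfK ?gt_eqF// !mulrDl.
  apply: (le_trans (ler_normD _ _)); rewrite addrAC; apply: lerD => //.
  apply: (le_trans (ler_normD _ _)); apply: lerD; first exact: FPhi.
    exact: lea.
  by rewrite -!mulrDl.
have ratio r : W r -> \int[mu]_(x in O) dotr (sobgrad T x) (sobgrad r x) / H10norm (winv w) O r <= S.
  move=> Wr; have := bound r Wr; have [->|nr0] := eqVneq (H10norm (winv w) O r) 0.
    by rewrite invr0 !mulr0.
  have nrp : 0 < H10norm (winv w) O r by rewrite lt_def nr0 sqrtr_ge0.
  by move=> le_S; rewrite ler_pdivrMr// (le_trans (ler_norm _)).
have gS : gam * t <= S.
  have := W_stable WT; rewrite -lee_fin => /le_trans; apply.
  by apply: ge_ereal_sup => _ [r Wr <-]; rewrite lee_fin; exact: ratio.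
have at_ : Ce2 * a <= gam / 4.
  rewrite /flow_radius in ur; apply: (le_trans (ler_wpM2l (ltW Ce0) ur)).
  have -> : Ce2 * (gam / (4 * Ce2)) = gam / 4 by field; rewrite gt_eqF.
  exact: lexx.
(* the hypothesis on kapm / kapp, cleared of its denominators *)
have kg : kapp - kapm <= gam * kapp - gam / 2.
  move: Lam; rewrite ler_pdivlMr//.
  have -> : (1 - gam * (1 - 1 / (2 * kapp))) * kapp = kapp - gam * kapp + gam / 2.
    by field; rewrite gt_eqF.
  by move: (gam * kapp) (gam / 2) => p q; lra.
move: gS; rewrite ler_pdivlMr// => gS.
have h1 : (kapp - kapm) * t <= (gam * kapp - gam / 2) * t by rewrite ler_wpM2r.
have h2 : Ce2 * a * t <= gam / 4 * t by rewrite ler_wpM2r.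
move: gS h1 h2; rewrite !mulrBl => gS h1 h2.
have -> : gam / 4 * t = gam * t * kapp - (gam * kapp * t - gam / 2 * t) - gam / 4 * t by field.
have e1 : gam * kapp * t = gam * t * kapp by rewrite mulrAC.
move: gS h1 h2; rewrite e1; move: (gam * t * kapp) (gam / 2 * t) (gam / 4 * t) (kapp * t - kapm * t) (Ce2 * a * t) => p q s y z.
lra.
Qed.

End Heat.

Section Velocity.

(** The convection term drops out by skew-symmetry, whatever the convecting field. *)
Lemma velocity_coercive (k : E -> R) (num nup : R) (uh u : vsobfun R n) :
  measurable_fun O k -> (forall x, O x -> num <= k x /\ k x <= nup) -> 0 < num ->
  vH10 O uh -> vH10 O u ->
  num * vH10norm O u ^+ 2 <=
  \int[mu]_(x in O) (k x * grad_dot u u x) + \int[mu]_(x in O) skewf uh u u x.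
Proof.
move=> mk kk n0 uhH uH; rewrite (skewf_skew oO bO n23 uhH uH) addr0.
have g0 x : 0 <= grad_dot u u x by apply: sumr_ge0 => i _; exact: dotr_ge0.
have ig := grad_dot_intg oO uH uH.
rewrite sqr_sqrtr ?Rintegral_ge0// -RintegralZl//; apply: le_Rintegral => //.
- exact: intgZ.
- apply: (@intg_bounded_mul _ _ _ oO _ _ nup) => // x /kk[? ?].
  by rewrite ger0_norm// (le_trans (ltW n0)).
- by move=> x /kk[? _]; rewrite ler_wpM2r.
Qed.

Definition vgrad_null : set (vsobfun R n) :=
  [set v | \forall x \ae mu, O x -> forall i, sobgrad (v i) x = 0].

Lemma vgrad_null_subspace : subspace vgrad_null.
Proof.
split; first by apply: aeW.
move=> a u v u0 v0; apply: filterS2 u0 v0 => x ux vx Ox i.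
by rewrite [sobgrad _ _]sobgradDZ ux// vx// scaler0 addr0.
Qed.

Lemma vgrad_null_of_norm u : vH10 O u -> vH10norm O u = 0 -> vgrad_null u.
Proof.
move=> uH /eqP; rewrite sqrtr_eq0 => le0.
have g0 x : 0 <= grad_dot u u x by apply: sumr_ge0 => i _; exact: dotr_ge0.
have ig := grad_dot_intg oO uH uH.
have : \int[mu]_(x in O) grad_dot u u x = 0.
  by apply/eqP; rewrite eq_le le0 Rintegral_ge0.
move=> /(ae0_of_Rintegral mO ig (fun x _ => g0 x)); apply: filterS => x ux Ox i.
apply: dotr_eq0; apply/eqP; have /eqP := ux Ox.
rewrite psumr_eq0; last by move=> j _; exact: dotr_ge0.
by move=> /allP/(_ i); rewrite mem_index_enum => /(_ isT).
Qed.

Lemma vgrad_null_val v : vH10 O v -> vgrad_null v ->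
  \forall x \ae mu, O x -> forall i, sobval (v i) x = 0.
Proof.
move=> vH v0.
have : \forall x \ae mu, forall i, O x -> sobval (v i) x = 0.
  apply: filter_forall => i; apply: (H10_val_ae0 oO bO n23 (vH i)).
  by apply: filterS v0 => x vx Ox; exact: vx.
by apply: filterS => x vx Ox i; exact: vx.
Qed.

End Velocity.

End Estimates.

(** * Bases modulo null elements and Lagrange multipliers *)

Section FiniteDimension.
Context {R : realType} {U : lmodType R}.
Implicit Types (V N : set U) (L : U -> R).

Lemma fin_dim_comb V : fin_dim V -> exists m (b : 'I_m -> U),
  (forall i, V (b i)) /\ forall v, V v -> exists c : 'rV[R]_m, v = comb b c.
Proof.
move=> [m [b VE]]; exists m, b; split.
  move=> i; rewrite VE; exists (fun j => (j == i)%:R) => //.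
  rewrite (bigD1 i)//= eqxx scale1r big1 ?addr0// => j /negbTE ->.
  by rewrite scale0r.
rewrite VE => _ [c _ <-]; exists (\row_i c i).
by apply: eq_bigr => i _; rewrite mxE.
Qed.

Lemma fin_dim_of_comb m (b : 'I_m -> U) : fin_dim (range (comb b)).
Proof.
exists m, b; apply/seteqP; split => [_ [c _ <-]|_ [c _ <-]].
  by exists (fun i => c 0 i).
by exists (\row_i c i) => //; apply: eq_bigr => i _; rewrite mxE.
Qed.

Lemma comb_mulmx m k (b : 'I_m -> U) (D : 'rV[R]_k) (K : 'M[R]_(k, m)) :
  comb b (D *m K) = comb (fun i => comb b (row i K)) D.
Proof.
rewrite /comb; under eq_bigr => j _ do rewrite mxE scaler_suml.
rewrite exchange_big; apply: eq_bigr => i _ /=.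
by rewrite scaler_sumr; apply: eq_bigr => j _; rewrite scalerA mxE.
Qed.

(** A basis of the quotient of V by N, given by representatives. *)
Lemma exists_basis_modulo V N : fin_dim V -> subspace N -> exists m (t : 'I_m -> U),
  [/\ forall i, V (t i), forall c : 'rV[R]_m, N (comb t c) -> c = 0 &
    forall v, V v -> exists c : 'rV[R]_m, N (v - comb t c)].
Proof.
move=> /fin_dim_comb[m0 [b [Vb Vspan]]] [N0 NL].
have [m [f [free span]]] := exists_free_modulo b N0 NL.
exists m, (b \o f); split; first by move=> i; exact: Vb.
  by move=> c Nc; apply/rowP => i; rewrite mxE; exact: (free (fun i => c 0 i)).
move=> v /Vspan[c ->]; have [c' Nc'] := span (fun i => c 0 i).
exists (\row_i c' i); rewrite (_ : comb _ (\row_i c' i) = \sum_i c' i *: b (f i))//.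
by apply: eq_bigr => i _; rewrite mxE.
Qed.

Section Kernel.
Variables (V : set U) (k : nat) (L : 'I_k -> U -> R).
Hypotheses (fV : fin_dim V) (lL : forall j, linear_on V (L j)).

Definition joint_kernel : set U := [set v | V v /\ forall j, L j v = 0].

Lemma joint_kernel_fin_dim : fin_dim joint_kernel.
Proof.
have sV := fin_dim_subspace fV; have [m [b [Vb Vspan]]] := fin_dim_comb fV.
pose B : 'M[R]_(m, k) := \matrix_(i, j) L j (b i).
have LB c j : L j (comb b c) = (c *m B) 0 j.
  rewrite (linear_on_comb sV c (lL j) Vb) mxE.
  by apply: eq_bigr => i _; rewrite mxE.
rewrite (_ : joint_kernel = range (comb (fun i => comb b (row i (kermx B))))).
  exact: fin_dim_of_comb.
apply/seteqP; split => [v [/Vspan[c ->] Lc]|_ [D _ <-]].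
  have : (c <= kermx B)%MS.
    by apply/sub_kermxP/rowP => j; rewrite -LB Lc mxE.
  by move=> /submxP[D ->]; exists D => //; rewrite comb_mulmx.
rewrite -comb_mulmx; split; first exact: subspace_comb.
by move=> j; rewrite LB -mulmxA mulmx_ker mulmx0 mxE.
Qed.

(** In a spanning family of V the forms L j are the columns of a matrix whose
left kernel annihilates l, so l is in the column space. *)
Lemma multipliers (l : U -> R) : linear_on V l -> (forall v, joint_kernel v -> l v = 0) ->
  exists p : 'I_k -> R, forall v, V v -> l v = \sum_j p j * L j v.
Proof.
move=> ll l0.
have sV := fin_dim_subspace fV; have [m [b [Vb Vspan]]] := fin_dim_comb fV.
pose B : 'M[R]_(m, k) := \matrix_(i, j) L j (b i).
pose C : 'cV[R]_m := \col_i l (b i).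
have LB c j : L j (comb b c) = (c *m B) 0 j.
  rewrite (linear_on_comb sV c (lL j) Vb) mxE.
  by apply: eq_bigr => i _; rewrite mxE.
have lC c : l (comb b c) = (c *m C) 0 0.
  rewrite (linear_on_comb sV c ll Vb) mxE.
  by apply: eq_bigr => i _; rewrite mxE.
have [p CBp] : exists p, C = B *m p.
  apply: col_range_of_kernel => c cB; apply/matrixP => i j.
  rewrite !ord1 -lC mxE; apply: l0; split; first exact: subspace_comb.
  by move=> j'; rewrite LB cB mxE.
exists (fun j => p j 0) => v /Vspan[c ->]; rewrite lC CBp mulmxA mxE.
by apply: eq_bigr => j _; rewrite LB mulrC.
Qed.

End Kernel.

End FiniteDimension.

(** * The forms of the discrete problem *)

Section DiscreteForms.
Context {R : realType} {n : nat}.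
Local Notation E := 'rV[R]_n.
Local Notation mu := (lebesgue_row R n).
Variables (O : set E) (oO : open O) (bO : bounded_set O) (n23 : n = 2%N \/ n = 3%N).
Let mO : measurable O := open_measurable_row oO.
Local Notation intg f := (mu.-integrable O (EFin \o f)).
Variables (w : E -> R) (ww : weight w) (wi : weight (winv w)).
Variables (g : E).
Variables (X : set (vsobfun R n)) (XH : X `<=` vH10 O).
Variables (W : set (sobfun R n)) (Ww : W `<=` H10 w O) (Wi : W `<=` H10 (winv w) O).
Variables (Ce1 Ce2 : R) (hCe1 : buoyancy_const O w Ce1) (hCe2 : advection_const O w Ce2).

Lemma H10_measurable v r : H10 v O r ->
  measurable_fun O (sobval r) /\ forall i, measurable_fun O (gradc r i).
Proof. by move=> [[[m _] mg _] _]; split => // i; have [] := mg i. Qed.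

Definition viscous_form (k : E -> R) (u v : vsobfun R n) : R :=
  \int[mu]_(x in O) (k x * grad_dot u v x).
Definition skew_form (u v z : vsobfun R n) : R := \int[mu]_(x in O) skewf u v z x.
Definition buoyancy_form (T : sobfun R n) (v : vsobfun R n) : R :=
  \int[mu]_(x in O) (sobval T x * dotr g (vsobval v x)).
Definition div_form (q : E -> R^o) (v : vsobfun R n) : R :=
  \int[mu]_(x in O) (q x * divg v x).
Definition grad_form (u v : vsobfun R n) : R := \int[mu]_(x in O) grad_dot u v x.
Definition weighted_form (T S : sobfun R n) : R :=
  \int[mu]_(x in O) (dotr (sobgrad T x) (sobgrad S x) * w x).

Section Viscous.
Variables (k : E -> R) (K : R) (mk : measurable_fun O k) (kK : forall x, O x -> `|k x| <= K).

Lemma viscous_intg u v : X u -> X v -> intg (fun x => k x * grad_dot u v x).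
Proof. by move=> /XH uH /XH vH; apply: intg_bounded_mul mk kK _ => //; exact: grad_dot_intg. Qed.

Lemma viscous_formC u v : viscous_form k u v = viscous_form k v u.
Proof. by apply: eq_Rintegral => x _; rewrite grad_dotC. Qed.

Lemma viscous_linear z : X z -> linear_on X (fun u => viscous_form k u z).
Proof.
move=> Xz a u v Xu Xv; apply: RintegralDZ => //; try exact: viscous_intg.
by move=> x; rewrite grad_dotDZl; ring.
Qed.

End Viscous.

Lemma grad_formC u v : grad_form u v = grad_form v u.
Proof. by apply: eq_Rintegral => x _; rewrite grad_dotC. Qed.

Lemma grad_linear z : X z -> linear_on X (grad_form ^~ z).
Proof.
move=> Xz a u v Xu Xv; apply: RintegralDZ => //; try (apply: grad_dot_intg => //; exact: XH).
by move=> x; rewrite grad_dotDZl; ring.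
Qed.

Lemma skew_linear1 v z : X v -> X z -> linear_on X (fun u => skew_form u v z).
Proof.
move=> Xv Xz a u1 u2 Xu1 Xu2; apply: RintegralDZ => //; try (apply: skewf_intg => //; exact: XH).
by move=> x; rewrite skewfDZ1.
Qed.

Lemma skew_linear2 u z : X u -> X z -> linear_on X (fun v => skew_form u v z).
Proof.
move=> Xu Xz a v1 v2 Xv1 Xv2; apply: RintegralDZ => //; try (apply: skewf_intg => //; exact: XH).
by move=> x; rewrite skewfDZ2.
Qed.

Lemma skew_linear3 u v : X u -> X v -> linear_on X (fun z => skew_form u v z).
Proof.
move=> Xu Xv a z1 z2 Xz1 Xz2; apply: RintegralDZ => //; try (apply: skewf_intg => //; exact: XH).
by move=> x; rewrite skewfDZ3.
Qed.

Lemma buoyancy_intg T v : W T -> X v -> intg (fun x => sobval T x * dotr g (vsobval v x)).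
Proof. by move=> /Ww TH /XH vH; have [_ /(_ g T v TH vH)[]] := hCe1. Qed.

Lemma buoyancy_linear1 v : X v -> linear_on W (fun T => buoyancy_form T v).
Proof.
move=> Xv a T S WT WS; apply: RintegralDZ => //; try exact: buoyancy_intg.
by move=> x; rewrite sobvalDZ; ring.
Qed.

Lemma buoyancy_linear2 T : W T -> linear_on X (buoyancy_form T).
Proof.
move=> WT a u v Xu Xv; apply: RintegralDZ => //; try exact: buoyancy_intg.
by move=> x; rewrite vsobvalDZ dotrDZr; ring.
Qed.

Lemma div_linear q : L20 O q -> linear_on X (div_form q).
Proof.
move=> Lq a u v Xu Xv; apply: RintegralDZ => //; try (apply: pressure_intg => //; exact: XH).
by move=> x; rewrite divgDZ; ring.
Qed.

Lemma div_linearl (M : set (E -> R^o)) v : M `<=` L20 O -> X v -> linear_on M (div_form ^~ v).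
Proof.
move=> ML Xv a p q Mp Mq; apply: RintegralDZ => //.
- by apply: pressure_intg => //; [exact: ML|exact: XH].
- by apply: pressure_intg => //; [exact: ML|exact: XH].
- by move=> x; rewrite !fctE /GRing.scale /=; ring.
Qed.

Lemma weighted_formC T S : weighted_form T S = weighted_form S T.
Proof. by apply: eq_Rintegral => x _; rewrite dotrC. Qed.

Lemma weighted_linear S : W S -> linear_on W (weighted_form ^~ S).
Proof.
move=> WS a T1 T2 WT1 WT2; apply: RintegralDZ => //; try (apply: weighted_dot_intg => //; exact: Ww).
by move=> x; rewrite sobgradDZ dotrDZl; ring.
Qed.

Section HeatForm.
Variables (k : E -> R) (K : R) (mk : measurable_fun O k) (K0 : 0 <= K).
Hypothesis kK : forall x, O x -> `|k x| <= K.

Lemma diffusion_intg T r : W T -> W r ->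
  intg (fun x => k x * dotr (sobgrad T x) (sobgrad r x)).
Proof. by move=> /Ww TH /Wi rH; have [] := diffusion_bound oO ww wi mk K0 kK TH rH. Qed.

Lemma advection_intg u T r : X u -> W T -> W r ->
  intg (fun x => sobval T x * dotr (vsobval u x) (sobgrad r x)).
Proof. by move=> /XH uH /Ww TH /Wi rH; have [_ /(_ T u r TH uH rH)[]] := hCe2. Qed.

Lemma heat_linear1 u r : X u -> W r -> linear_on W (fun T => heat_form O k u T r).
Proof.
move=> Xu Wr a T S WT WS; rewrite /heat_form.
have -> : \int[mu]_(x in O) (k x * dotr (sobgrad (a *: T + S) x) (sobgrad r x)) =
    a * \int[mu]_(x in O) (k x * dotr (sobgrad T x) (sobgrad r x)) +
    \int[mu]_(x in O) (k x * dotr (sobgrad S x) (sobgrad r x)).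
  apply: RintegralDZ => //; try exact: diffusion_intg.
  by move=> x; rewrite sobgradDZ dotrDZl; ring.
have -> : \int[mu]_(x in O) (sobval (a *: T + S) x * dotr (vsobval u x) (sobgrad r x)) =
    a * \int[mu]_(x in O) (sobval T x * dotr (vsobval u x) (sobgrad r x)) +
    \int[mu]_(x in O) (sobval S x * dotr (vsobval u x) (sobgrad r x)).
  apply: RintegralDZ => //; try exact: advection_intg.
  by move=> x; rewrite sobvalDZ; ring.
by ring.
Qed.

Lemma heat_linear2 u T : X u -> W T -> linear_on W (heat_form O k u T).
Proof.
move=> Xu WT a r s Wr Ws; rewrite /heat_form.
have -> : \int[mu]_(x in O) (k x * dotr (sobgrad T x) (sobgrad (a *: r + s) x)) =
    a * \int[mu]_(x in O) (k x * dotr (sobgrad T x) (sobgrad r x)) +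
    \int[mu]_(x in O) (k x * dotr (sobgrad T x) (sobgrad s x)).
  apply: RintegralDZ => //; try exact: diffusion_intg.
  by move=> x; rewrite sobgradDZ dotrDZr; ring.
have -> : \int[mu]_(x in O) (sobval T x * dotr (vsobval u x) (sobgrad (a *: r + s) x)) =
    a * \int[mu]_(x in O) (sobval T x * dotr (vsobval u x) (sobgrad r x)) +
    \int[mu]_(x in O) (sobval T x * dotr (vsobval u x) (sobgrad s x)).
  apply: RintegralDZ => //; try exact: advection_intg.
  by move=> x; rewrite sobgradDZ dotrDZr; ring.
by ring.
Qed.

Lemma heat_null u T r : X u -> W T -> W r -> grad_null O r -> heat_form O k u T r = 0.
Proof.
move=> Xu WT Wr r0; rewrite /heat_form !Rintegral_ae0 ?subrr//.
- exact: intg_measurable (advection_intg Xu WT Wr).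
- by apply: filterS r0 => x rx Ox; rewrite rx// dotrC dotr0l mulr0.
- exact: intg_measurable (diffusion_intg WT Wr).
- by apply: filterS r0 => x rx Ox; rewrite rx// dotrC dotr0l mulr0.
Qed.

End HeatForm.

Lemma grad_null_of_norm T : W T -> H10norm w O T = 0 -> grad_null O T.
Proof.
move=> WT; rewrite H10normE => /eqP; rewrite sqrtr_eq0 => le0.
have [_ w0 wpos _] := ww.
have d0 x : 0 <= dotr (sobgrad T x) (sobgrad T x) * w x by rewrite mulr_ge0 ?dotr_ge0.
have iT := weighted_dot_intg oO ww (Ww WT) (Ww WT).
have : \int[mu]_(x in O) (dotr (sobgrad T x) (sobgrad T x) * w x) = 0.
  by apply/eqP; rewrite eq_le le0 Rintegral_ge0.
move=> /(ae0_of_Rintegral mO iT (fun x _ => d0 x)) T0.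
apply: filterS2 T0 wpos => x Tx wx Ox; apply: dotr_eq0; apply/eqP.
by have /eqP := Tx Ox; rewrite mulf_eq0 (gt_eqF wx) orbF.
Qed.

(** A null field has zero values and zero gradient almost everywhere, by
[vgrad_null_val], so all terms of the momentum equation ignore it as a test
field. *)
Lemma momentum_null (k : E -> R) (K : R) u v T z : measurable_fun O k ->
  (forall x, O x -> `|k x| <= K) -> X u -> X v -> W T -> X z -> vgrad_null O z ->
  [/\ viscous_form k v z = 0, skew_form u v z = 0 & buoyancy_form T z = 0].
Proof.
move=> mk kK Xu Xv WT Xz z0.
have zv := vgrad_null_val oO bO n23 (XH Xz) z0.
have zd : \forall x \ae mu, O x -> vsobval z x = 0.
  by apply: filterS zv => x zx Ox; apply/rowP => i; rewrite !mxE zx.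
split; apply: Rintegral_ae0 => //.
- exact: intg_measurable (viscous_intg mk kK Xv Xz).
- apply: filterS z0 => x zx Ox; rewrite /grad_dot big1 ?mulr0// => i _.
  by rewrite zx// dotrC dotr0l.
- by apply: intg_measurable; apply: skewf_intg => //; exact: XH.
- apply: filterS2 zv zd => x zx dx Ox; rewrite /skewf dx// dotrC dotr0l mulr0 addr0.
  by rewrite /convection big1// => i _; rewrite zx// mulr0.
- exact: intg_measurable (buoyancy_intg WT Xz).
- by apply: filterS zd => x dx Ox; rewrite dx// dotrC dotr0l mulr0.
Qed.

End DiscreteForms.

(** * Solution of the problem on divergence free fields *)

Section CombNorm.
Context {R : realType} {U : lmodType R}.
Variables (V : set U) (sV : subspace V) (q : U -> U -> R).
Hypotheses (qC : forall u v, q u v = q v u) (qL : forall z, V z -> linear_on V (q ^~ z)).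
Hypothesis q0 : forall u, 0 <= q u u.
Variables (m : nat) (b : 'I_m -> U) (Vb : forall i, V (b i)).

Definition comb_norm (c : 'rV[R]_m) : R := Num.sqrt (q (comb b c) (comb b c)).

Lemma comb_normE : comb_norm = gram_norm (gram q b).
Proof. by apply/funext => c; rewrite /comb_norm -(gram_comb sV qC qL Vb). Qed.

Lemma comb_norm_continuous : continuous comb_norm.
Proof. by rewrite comb_normE; exact: gram_norm_continuous. Qed.

Lemma comb_normZ t c : 0 <= t -> comb_norm (t *: c) = t * comb_norm c.
Proof. by rewrite comb_normE; exact: gram_normZ. Qed.

Lemma comb_norm_coord : (forall c, q (comb b c) (comb b c) = 0 -> c = 0) ->
  exists K : R, forall (c : 'rV[R]_m) i, `|c 0 i| <= K * comb_norm c.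
Proof.
move=> q_def; rewrite comb_normE; apply: gram_coord_le; first exact: gram_sym.
  by move=> c; rewrite (gram_comb sV qC qL Vb).
by move=> c; rewrite (gram_comb sV qC qL Vb); exact: q_def.
Qed.

End CombNorm.

Section DiscreteExistence.
Context {R : realType} {n : nat}.
Local Notation E := 'rV[R]_n.
Local Notation mu := (lebesgue_row R n).
Variables (O : set E) (oO : open O) (bO : bounded_set O) (n23 : n = 2%N \/ n = 3%N).
Let mO : measurable O := open_measurable_row oO.
Local Notation intg f := (mu.-integrable O (EFin \o f)).
Variables (w : E -> R) (ww : weight w) (wi : weight (winv w)).
Variables (g : E) (g0 : g <> 0).
Variables (nu : R -> R) (num nup : R) (hnu : coefficient nu num nup).
Variables (kappa : R -> R) (kapm kapp : R) (hkappa : coefficient kappa kapm kapp).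
Variables (X V : set (vsobfun R n)) (XH : X `<=` vH10 O) (fX : fin_dim X).
Variables (VX : V `<=` X) (fV : fin_dim V).
Variables (W : set (sobfun R n)) (Ww : W `<=` H10 w O) (Wi : W `<=` H10 (winv w) O).
Variables (fW : fin_dim W).
Variables (Ce1 Ce2 : R) (hCe1 : buoyancy_const O w Ce1) (hCe2 : advection_const O w Ce2).
Variables (gam : R) (gam0 : 0 < gam) (W_stable : grad_inf_sup O w (winv w) gam W).
Variables (CP : R) (CP0 : 0 < CP).
Hypothesis Lam : 1 - gam * (1 - 1 / (2 * kapp)) <= kapm / kapp.
Variables (H : sobfun R n -> R) (Hlin : linear_on W H).
Hypothesis Hsmall : forall r, W r ->
  `|H r| <= gam * heat_radius num g Ce1 CP gam Ce2 / 4 * H10norm (winv w) O r.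

Local Notation r1 := (flow_radius gam Ce2).
Local Notation r2 := (heat_radius num g Ce1 CP gam Ce2).

Lemma flow_radius_gt0 : 0 < r1.
Proof. by have [Ce0 _] := hCe2; rewrite divr_gt0// mulr_gt0. Qed.

Lemma enorm_gt0 : 0 < enorm g.
Proof.
rewrite lt_def sqrtr_ge0 andbT sqrtr_eq0; apply/negP => le0; apply: g0.
by apply: dotr_eq0; apply/eqP; rewrite eq_le le0 dotr_ge0.
Qed.

Lemma heat_radius_gt0 : 0 < r2.
Proof.
have [Ce10 _] := hCe1; have [Ce20 _] := hCe2; have [_ num0 _] := hnu.
rewrite mulr_gt0//; first by rewrite divr_gt0// mulr_gt0// enorm_gt0.
by rewrite lt_min !divr_gt0// mulr_gt0.
Qed.

(** This is where the second entry of the minimum in [heat_radius] is used: a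
temperature in its ball drives a velocity in the ball of radius
[flow_radius]. *)
Lemma buoyancy_radius : Ce1 * enorm g * r2 <= num * r1.
Proof.
have [Ce10 _] := hCe1; have [_ num0 _] := hnu.
rewrite /heat_radius mulrA.
have -> : Ce1 * enorm g * (num / (enorm g * Ce1)) = num.
  by field; rewrite !gt_eqF// enorm_gt0.
by rewrite ler_wpM2l ?(ltW num0)// ge_min lexx orbT.
Qed.

Let sX := fin_dim_subspace fX.
Let sV := fin_dim_subspace fV.
Let sW := fin_dim_subspace fW.
Let num0 : 0 < num. Proof. by have [] := hnu. Qed.
Let kapm0 : 0 < kapm. Proof. by have [] := hkappa. Qed.
Let kapmp : kapm <= kapp.
Proof. by have [_ _ /(_ 0)[lo hi]] := hkappa; exact: le_trans lo hi. Qed.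
Let kapp0 : 0 < kapp. Proof. exact: lt_le_trans kapmp. Qed.

Section Coordinates.
Variables (m1 m2 : nat) (v : 'I_m1 -> vsobfun R n) (t : 'I_m2 -> sobfun R n).
Hypotheses (Vv : forall i, V (v i)) (Wt : forall i, W (t i)).
Hypothesis vfree : forall c : 'rV[R]_m1, vgrad_null O (comb v c) -> c = 0.
Hypothesis tfree : forall c : 'rV[R]_m2, grad_null O (comb t c) -> c = 0.
Hypothesis vspan : forall z, V z -> exists c : 'rV[R]_m1, vgrad_null O (z - comb v c).
Hypothesis tspan : forall r, W r -> exists c : 'rV[R]_m2, grad_null O (r - comb t c).
Local Notation C := 'rV[R]_(m1 + m2).
Implicit Types (x : C) (y : E).

(* The unknown x lists the coordinates of the velocity, then those of the
   temperature; [uh x] and [Th x] are the fields at which coefficients are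
   frozen. *)
Let uh x := comb v (lsubmx x).
Let Th x := comb t (rsubmx x).
Let nuh x y := nu (sobval (Th x) y).
Let kah x y := kappa (sobval (Th x) y).

Let Xv i : X (v i). Proof. exact: VX. Qed.
Let Vc c : V (comb v c). Proof. exact: subspace_comb. Qed.
Let Xc c : X (comb v c). Proof. exact: VX. Qed.
Let Wc e : W (comb t e). Proof. exact: subspace_comb. Qed.

Let mTh x : measurable_fun O (sobval (Th x)).
Proof. by have [] := H10_measurable (Ww (Wc (rsubmx x))). Qed.

Let mnuh x : measurable_fun O (nuh x).
Proof.
apply: (measurableT_comp (continuous_measurable_fun (coefficient_continuous hnu))).
exact: mTh.
Qed.

Let mkah x : measurable_fun O (kah x).
Proof.
apply: (measurableT_comp (continuous_measurable_fun (coefficient_continuous hkappa))).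
exact: mTh.
Qed.

Let nuhK x y : O y -> `|nuh x y| <= nup.
Proof. by move=> _; exact: coefficient_norm_le hnu. Qed.
Let kahK x y : O y -> `|kah x y| <= kapp.
Proof. by move=> _; exact: coefficient_norm_le hkappa. Qed.

Let momentum_form x (u z : vsobfun R n) : R :=
  viscous_form O (nuh x) u z + skew_form O (uh x) u z.

Let momentum_linear1 x z : X z -> linear_on X (fun u => momentum_form x u z).
Proof.
move=> Xz a p q Xp Xq; rewrite /momentum_form.
rewrite (viscous_linear oO XH (mnuh x) (@nuhK x) Xz a Xp Xq).
by rewrite (skew_linear2 oO bO n23 XH (Xc _) Xz a Xp Xq); ring.
Qed.

Let momentum_linear2 x u : X u -> linear_on X (momentum_form x u).
Proof.
move=> Xu a p q Xp Xq; rewrite /momentum_form !(viscous_formC _ _ u).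
rewrite (viscous_linear oO XH (mnuh x) (@nuhK x) Xu a Xp Xq).
by rewrite (skew_linear3 oO bO n23 XH (Xc _) Xu a Xp Xq); ring.
Qed.

Let A x : 'M[R]_m1 := \matrix_(i, j) momentum_form x (v i) (v j).
Let B x : 'M[R]_m2 := \matrix_(i, j) heat_form O (kah x) (uh x) (t i) (t j).
Let f x : 'rV[R]_m1 := \row_j buoyancy_form O g (Th x) (v j).
Let b : 'rV[R]_m2 := \row_j H (t j).
Let N1 (c : 'rV[R]_m1) := vH10norm O (comb v c).
Let N2 (e : 'rV[R]_m2) := H10norm w O (comb t e).

Let N1E : N1 = comb_norm (grad_form O) v. Proof. by []. Qed.
Let N2E : N2 = comb_norm (weighted_form O w) t.
Proof. by apply/funext => e; rewrite /N2 H10normE. Qed.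

Let mulA c x j : (c *m A x) 0 j = momentum_form x (comb v c) (v j).
Proof.
rewrite (linear_on_comb sX c (momentum_linear1 x (Xv j)) Xv) mxE.
by apply: eq_bigr => i _; rewrite mxE.
Qed.

Let mulB e x j : (e *m B x) 0 j = heat_form O (kah x) (uh x) (comb t e) (t j).
Proof.
have hl := heat_linear1 oO ww wi XH Ww Wi hCe2 (mkah x) (ltW kapp0) (@kahK x)
  (Xc (lsubmx x)) (Wt j).
rewrite (linear_on_comb sW e hl Wt) mxE.
by apply: eq_bigr => i _; rewrite mxE.
Qed.

Let coord_continuous (k : 'I_(m1 + m2)) : continuous (fun x : C => x 0 k).
Proof. exact: coord_continuous. Qed.

Let lcoord_continuous i : continuous (fun x : C => lsubmx x 0 i).
Proof.
have -> : (fun x : C => lsubmx x 0 i) = (fun x : C => x 0 (lshift m2 i)).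
  by apply/funext => x; rewrite mxE.
exact: coord_continuous.
Qed.

Let rcoord_continuous i : continuous (fun x : C => rsubmx x 0 i).
Proof.
have -> : (fun x : C => rsubmx x 0 i) = (fun x : C => x 0 (rshift m1 i)).
  by apply/funext => x; rewrite mxE.
exact: coord_continuous.
Qed.

Let lin_continuous (U : lmodType R) (S : set U) m (s : 'I_m -> U) (c : C -> 'rV[R]_m)
    (L : U -> R) : subspace S -> (forall i, S (s i)) -> linear_on S L ->
  (forall i, continuous (fun x => c x 0 i)) -> continuous (fun x => L (comb s (c x))).
Proof.
move=> sS Ss lL cc.
have -> : (fun x => L (comb s (c x))) = (fun x => \sum_i c x 0 i * L (s i)).
  by apply/funext => x; exact: (linear_on_comb sS (c x) lL Ss).
apply: (@continuous_bigsum R C) => i _ x.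
by apply: (@continuousM _ _ (fun x => c x 0 i) (cst (L (s i))) x); [exact: cc|exact: cst_continuous].
Qed.

Let value_continuous y : continuous (fun x => sobval (Th x) y).
Proof.
apply: (@lin_continuous _ setT _ t (fun x => rsubmx x) (fun T => sobval T y)) => //.
Qed.

Let A_continuous i j : continuous (fun x => A x i j).
Proof.
have -> : (fun x => A x i j) = (fun x => momentum_form x (v i) (v j)).
  by apply/funext => x; rewrite mxE.
move=> x; apply: (@continuousD _ _ _ (fun x => viscous_form O (nuh x) (v i) (v j))
   (fun x => skew_form O (uh x) (v i) (v j)) x); move: x.
  have ig := grad_dot_intg oO (XH (Xv i)) (XH (Xv j)).
  apply: (@continuous_param_integral _ _ _ mu O mO C (fun x y => nuh x y * grad_dot (v i) (v j) y)
    (fun y => nup * `|grad_dot (v i) (v j) y|)).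
  - by move=> x; apply: measurable_funM; [exact: mnuh|exact: intg_measurable ig].
  - move=> y Oy x; apply: (@continuousM _ _ (nuh ^~ y) (cst (grad_dot (v i) (v j) y)) x).
      apply: (@continuous_comp _ _ _ (fun x => sobval (Th x) y) nu); first exact: value_continuous.
      exact: coefficient_continuous hnu _.
    exact: cst_continuous.
  - by move=> x y Oy; rewrite normrM ler_wpM2r// nuhK.
  - by apply: intgZ => //; exact: integrable_norm.
exact: (lin_continuous sX Xv (skew_linear1 oO bO n23 XH (Xv i) (Xv j))).
Qed.

Let f_continuous j : continuous (fun x => f x 0 j).
Proof.
have -> : (fun x => f x 0 j) = (fun x => buoyancy_form O g (Th x) (v j)).
  by apply/funext => x; rewrite mxE.
exact: (lin_continuous sW Wt (buoyancy_linear1 oO g XH Ww hCe1 (Xv j))).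
Qed.

Let B_continuous i j : continuous (fun x => B x i j).
Proof.
have -> : (fun x => B x i j) = (fun x => heat_form O (kah x) (uh x) (t i) (t j)).
  by apply/funext => x; rewrite mxE.
move=> x; apply: (@continuousB _ _ _
   (fun x => \int[mu]_(y in O) (kah x y * dotr (sobgrad (t i) y) (sobgrad (t j) y)))
   (fun x => \int[mu]_(y in O) (sobval (t i) y * dotr (vsobval (uh x) y) (sobgrad (t j) y))) x);
   move: x.
  have mcst : measurable_fun O (cst 1 : E -> R) by exact: measurable_cst.
  have ig : intg (fun y => dotr (sobgrad (t i) y) (sobgrad (t j) y)).
    have := diffusion_intg oO ww wi Ww Wi mcst ler01 _ (Wt i) (Wt j).
    under [in X in _ -> X]eq_fun do rewrite -[dotr _ _]mul1r.
    by apply => y _; rewrite normr1.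
  apply: (@continuous_param_integral _ _ _ mu O mO C
    (fun x y => kah x y * dotr (sobgrad (t i) y) (sobgrad (t j) y))
    (fun y => kapp * `|dotr (sobgrad (t i) y) (sobgrad (t j) y)|)).
  - by move=> x; apply: measurable_funM; [exact: mkah|exact: intg_measurable ig].
  - move=> y Oy x; apply: (@continuousM _ _ (kah ^~ y)
      (cst (dotr (sobgrad (t i) y) (sobgrad (t j) y))) x).
      apply: (@continuous_comp _ _ _ (fun x => sobval (Th x) y) kappa); first exact: value_continuous.
      exact: coefficient_continuous hkappa _.
    exact: cst_continuous.
  - by move=> x y Oy; rewrite normrM ler_wpM2r// kahK.
  - by apply: intgZ => //; exact: integrable_norm.
apply: (@lin_continuous _ X _ v (fun x => lsubmx x)
  (fun u => \int[mu]_(y in O) (sobval (t i) y * dotr (vsobval u y) (sobgrad (t j) y)))) => //.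
move=> a p q Xp Xq; apply: RintegralDZ => //; try exact: (advection_intg XH Ww Wi hCe2).
by move=> y; rewrite vsobvalDZ dotrDZl; ring.
Qed.

Let extend_null (U : lmodType R) (S N : set U) m (s : 'I_m -> U) (L F : U -> R) :
  subspace S -> (forall i, S (s i)) -> (forall r, S r -> exists c : 'rV[R]_m, N (r - comb s c)) ->
  linear_on S L -> linear_on S F -> (forall r, S r -> N r -> L r = 0 /\ F r = 0) ->
  (forall j, L (s j) = F (s j)) -> forall r, S r -> L r = F r.
Proof.
move=> sS Ss span lL lF null LF r Sr; have [c Nc] := span _ Sr.
have Sc := subspace_comb sS c Ss.
have Src : S (r - comb s c) by rewrite -scaleN1r addrC; apply: sS.2.
have [L0 F0] := null _ Src Nc.
have -> : r = 1 *: (r - comb s c) + comb s c by rewrite scale1r subrK.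
rewrite lL// lF// L0 F0 !mulr0 !add0r (linear_on_comb sS c lL Ss) (linear_on_comb sS c lF Ss).
by apply: eq_bigr => i _; rewrite LF.
Qed.

Let momentum_solved x c (F : vsobfun R n -> R) : linear_on X F ->
  (forall z, X z -> vgrad_null O z -> F z = 0) ->
  (forall j, (c *m A x) 0 j = F (v j)) ->
  forall z, V z -> momentum_form x (comb v c) z = F z.
Proof.
move=> lF F0 cF; apply: (extend_null sV Vv vspan).
- by move=> a p q Vp Vq; apply: momentum_linear2 => //; exact: VX.
- by move=> a p q Vp Vq; apply: lF; exact: VX.
- move=> z /VX Xz z0; split; last exact: F0.
  have [h1 h2 _] := momentum_null oO bO n23 g XH Ww hCe1 (mnuh x) (@nuhK x) (Xc (lsubmx x))
    (Xc c) (Wc (rsubmx x)) Xz z0.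
  by rewrite /momentum_form h1 h2 addr0.
- by move=> j; rewrite -mulA.
Qed.

Let momentum_coercive x c :
  num * N1 c ^+ 2 <= momentum_form x (comb v c) (comb v c).
Proof.
apply: (velocity_coercive oO bO n23 (mnuh x) _ num0 (XH (Xc _)) (XH (Xc _))) => y _.
by have [_ _] := hnu; exact.
Qed.

Let A_unit x : A x \in unitmx.
Proof.
apply: unitmx_of_injective => c cA; apply: vfree.
apply: (vgrad_null_of_norm oO (XH (Xc c))).
have := momentum_coercive x c.
rewrite (@momentum_solved x c (fun=> 0))//.
- rewrite pmulr_rle0// => N0; apply/eqP; rewrite -sqrf_eq0 eq_le sqr_ge0 andbT.
  exact: N0.
- by move=> a p q _ _; rewrite mulr0 addr0.
- by move=> j; rewrite cA mxE.
Qed.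

Let buoyancy_null x z : X z -> vgrad_null O z -> buoyancy_form O g (Th x) z = 0.
Proof.
move=> Xz z0; have [_ _] := momentum_null oO bO n23 g XH Ww hCe1 (mnuh x) (@nuhK x)
  (Xc (lsubmx x)) (Xc (lsubmx x)) (Wc (rsubmx x)) Xz z0.
exact.
Qed.

Let velocity_bound x c : N2 (rsubmx x) <= r2 -> c *m A x = f x -> N1 c <= r1.
Proof.
move=> Tr2 cA; have := momentum_coercive x c.
rewrite (@momentum_solved x c (buoyancy_form O g (Th x)))//.
- move=> /le_trans /(_ (ler_norm _)).
  have [Ce10 /(_ g (Th x) (comb v c) (Ww (Wc _)) (XH (Xc _)))[_ bound]] := hCe1.
  move=> /le_trans /(_ bound) h.
  have N10 : 0 <= N1 c by exact: sqrtr_ge0.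
  have [-> |Npos] := eqVneq (N1 c) 0; first exact: ltW flow_radius_gt0.
  have {}Npos : 0 < N1 c by rewrite lt_def Npos.
  rewrite -(ler_pM2l num0) -(ler_pM2r Npos) -mulrA -expr2.
  apply: (le_trans h); apply: ler_wpM2r => //.
  apply: le_trans buoyancy_radius; apply: ler_wpM2l => //.
  by rewrite mulr_ge0// ltW// enorm_gt0.
- exact (buoyancy_linear2 oO g XH Ww hCe1 (Wc (rsubmx x))).
- by move=> z; exact: buoyancy_null.
- by move=> j; rewrite cA mxE.
Qed.

Let load_null r : W r -> grad_null O r -> H r = 0.
Proof.
move=> Wr r0; apply/eqP; rewrite -normr_le0; apply: (le_trans (Hsmall Wr)).
have [_ mr] := H10_measurable (Wi Wr).
by rewrite (H10norm_null oO _ mr r0) ?mulr0//; exact: weight_measurable.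
Qed.

Let heat_solved x e (F : sobfun R n -> R) : linear_on W F ->
  (forall r, W r -> grad_null O r -> F r = 0) ->
  (forall j, (e *m B x) 0 j = F (t j)) ->
  forall r, W r -> heat_form O (kah x) (uh x) (comb t e) r = F r.
Proof.
move=> lF F0 eF; apply: (extend_null sW Wt tspan) => //.
- exact (heat_linear2 oO ww wi XH Ww Wi hCe2 (mkah x) (ltW kapp0) (@kahK x) (Xc (lsubmx x)) (Wc e)).
- move=> r Wr r0; split; last exact: F0.
  exact (heat_null oO ww wi XH Ww Wi hCe2 (mkah x) (ltW kapp0) (@kahK x) (Xc (lsubmx x)) (Wc e) Wr r0).
- by move=> j; rewrite -mulB.
Qed.

Let heat_bound x e (F : sobfun R n -> R) Phi : N1 (lsubmx x) <= r1 -> 0 <= Phi ->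
  linear_on W F -> (forall r, W r -> `|F r| <= Phi * H10norm (winv w) O r) ->
  (forall j, (e *m B x) 0 j = F (t j)) -> gam / 4 * N2 e <= Phi.
Proof.
move=> ur1 Phi0 lF FPhi eF.
apply: (heat_estimate oO ww wi Ww Wi hCe2 W_stable (mkah x) _ kapm0 kapmp Lam (XH (Xc _)) ur1
  (Wc e) Phi0 _ FPhi).
  by move=> y _; have [_ _] := hkappa; exact.
apply: heat_solved => // r Wr r0; apply/eqP; rewrite -normr_le0.
apply: (le_trans (FPhi r Wr)); have [_ mr] := H10_measurable (Wi Wr).
by rewrite (H10norm_null oO _ mr r0) ?mulr0//; exact: weight_measurable.
Qed.

Let B_unit x : N1 (lsubmx x) <= r1 -> B x \in unitmx.
Proof.
move=> ur1; apply: unitmx_of_injective => e eB; apply: tfree.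
apply: (grad_null_of_norm oO ww Ww (Wc e)).
have : gam / 4 * N2 e <= 0.
  apply: (@heat_bound x e (fun=> 0)) => //.
  - by move=> a p q _ _; rewrite mulr0 addr0.
  - by move=> r _; rewrite normr0 mul0r.
  - by move=> j; rewrite eB mxE.
rewrite pmulr_rle0 ?divr_gt0// => N0; apply/eqP.
by rewrite eq_le N0 /= sqrtr_ge0.
Qed.

Let temperature_bound x e : N1 (lsubmx x) <= r1 -> e *m B x = b -> N2 e <= r2.
Proof.
move=> ur1 eB; have r20 := heat_radius_gt0.
have : gam / 4 * N2 e <= gam * r2 / 4.
  apply: (@heat_bound x e H) => //; first by rewrite divr_ge0// mulr_ge0// ltW.
  by move=> j; rewrite eB mxE.
by rewrite [gam * r2 / 4]mulrAC ler_pM2l// divr_gt0.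
Qed.

(** The nonlinear problem is the fixed point form of the two linear systems
with matrices [A x] and [B x] and right-hand sides [f x] and [b]. *)
Lemma galerkin_solution_coord : exists (u : vsobfun R n) (T : sobfun R n),
  [/\ V u, W T, vH10norm O u <= r1, H10norm w O T <= r2 &
   (forall z, V z -> viscous_form O (fun y => nu (sobval T y)) u z + skew_form O u u z
     = buoyancy_form O g T z) /\
   (forall r, W r -> heat_form O (fun y => kappa (sobval T y)) u T r = H r)].
Proof.
have gsym u z : grad_form O u z = grad_form O z u by exact: grad_formC.
have gpos (u : vsobfun R n) : 0 <= grad_form O u u.
  by apply: Rintegral_ge0 => // y _; apply: sumr_ge0 => i _; exact: dotr_ge0.
have wpos (T : sobfun R n) : 0 <= weighted_form O w T T.
  by have [_ w0 _ _] := ww; apply: Rintegral_ge0 => // y _; rewrite mulr_ge0 ?dotr_ge0.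
have glin z : X z -> linear_on X (grad_form O ^~ z) by exact: grad_linear.
have wlin r : W r -> linear_on W (weighted_form O w ^~ r) by exact: weighted_linear.
have [K1 hK1] : exists K : R, forall (c : 'rV[R]_m1) i, `|c 0 i| <= K * N1 c.
  apply: (comb_norm_coord sX gsym glin gpos Xv) => c c0; apply: vfree.
  by apply: (vgrad_null_of_norm oO (XH (Xc c))); rewrite /vH10norm -/(grad_form O _ _) c0 sqrtr0.
have [K2 hK2] : exists K : R, forall (e : 'rV[R]_m2) i, `|e 0 i| <= K * N2 e.
  rewrite N2E; apply: (comb_norm_coord sW (@weighted_formC _ _ O w) wlin wpos Wt) => e e0.
  by apply: tfree; apply: (grad_null_of_norm oO ww Ww (Wc e)); rewrite H10normE -/(weighted_form O w _ _) e0 sqrtr0.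
have r10 := flow_radius_gt0; have r20 := heat_radius_gt0.
have bnd (k a N r : R) : `|a| <= k * N -> 0 <= N -> N <= r -> `|a| <= `|k| * r.
  move=> h N0 Nr; apply: (le_trans h); apply: (@le_trans _ _ (`|k| * N)).
    by rewrite ler_wpM2r// ler_norm.
  by rewrite ler_wpM2l.
have [|||||||x [ur1 Tr2 uA TB]] := @galerkin_fixpoint R m1 m2 A B f b N1 N2 r1 r2
  (`|K1| * r1 + `|K2| * r2) r10 r20 A_continuous B_continuous f_continuous.
- by rewrite N1E; exact (comb_norm_continuous sX gsym glin Xv).
- by rewrite N2E; exact (comb_norm_continuous sW (@weighted_formC _ _ O w) wlin Wt).
- by move=> s c s0; rewrite N1E; exact: (comb_normZ sX gsym glin Xv).
- by move=> s c s0; rewrite N2E; exact: (comb_normZ sW (@weighted_formC _ _ O w) wlin Wt).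
- move=> c i cr; apply: (le_trans (bnd _ _ _ _ (hK1 c i) (sqrtr_ge0 _) cr)).
  by rewrite lerDl mulr_ge0// ltW.
- move=> c i cr; apply: (le_trans (bnd _ _ _ _ (hK2 c i) (sqrtr_ge0 _) cr)).
  by rewrite lerDr mulr_ge0// ltW.
- move=> x ur1 Tr2; split; [exact: A_unit|exact: B_unit| |] => c.
    exact: velocity_bound.
  exact: temperature_bound.
exists (uh x), (Th x); split; [exact: Vc|exact: Wc|exact: ur1|exact: Tr2|split].
  apply: (@momentum_solved x (lsubmx x) (buoyancy_form O g (Th x))).
  - exact (buoyancy_linear2 oO g XH Ww hCe1 (Wc (rsubmx x))).
  - by move=> z; exact: buoyancy_null.
  - by move=> j; rewrite uA mxE.
apply: (@heat_solved x (rsubmx x) H); [by []|exact load_null|].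
by move=> j; rewrite TB mxE.
Qed.

End Coordinates.

Theorem galerkin_solution : exists (u : vsobfun R n) (T : sobfun R n),
  [/\ V u, W T, vH10norm O u <= r1, H10norm w O T <= r2 &
   (forall z, V z -> viscous_form O (fun y => nu (sobval T y)) u z + skew_form O u u z
     = buoyancy_form O g T z) /\
   (forall r, W r -> heat_form O (fun y => kappa (sobval T y)) u T r = H r)].
Proof.
have [m1 [v [Vv vfree vspan]]] := exists_basis_modulo fV (vgrad_null_subspace O).
have [m2 [t [Wt tfree tspan]]] := exists_basis_modulo fW (grad_null_subspace O).
exact: galerkin_solution_coord Vv Wt vfree tfree vspan tspan.
Qed.

End DiscreteExistence.

(** * The discrete problem with pressure *)

Section Assembly.
Context {R : realType} {n : nat}.
Local Notation E := 'rV[R]_n.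
Local Notation mu := (lebesgue_row R n).
Variables (O : set E) (oO : open O) (bO : bounded_set O) (n23 : n = 2%N \/ n = 3%N).
Let mO : measurable O := open_measurable_row oO.

Lemma momentum_skewE (nu : R -> R) num nup w g Ce1 (u v : vsobfun R n) T p :
  coefficient nu num nup -> buoyancy_const O w Ce1 -> vH10 O u -> vH10 O v ->
  H10 w O T -> L20 O p ->
  momentum_skew O nu g T u p v =
  viscous_form O (fun y => nu (sobval T y)) u v + skew_form O u u v
  - div_form O p v - buoyancy_form O g T v.
Proof.
move=> hnu hCe1 uH vH TH pL.
have mk : measurable_fun O (fun y => nu (sobval T y)).
  apply: (measurableT_comp (continuous_measurable_fun (coefficient_continuous hnu))).
  by have [] := H10_measurable TH.
have kK y : O y -> `|nu (sobval T y)| <= nup by move=> _; exact: coefficient_norm_le hnu.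
have i1 := viscous_intg oO (@subset_refl _ (vH10 O)) mk kK uH vH.
have i2 := skewf_intg oO bO n23 uH uH vH.
have i3 := pressure_intg oO pL vH.
have i4 := buoyancy_intg g (@subset_refl _ (vH10 O)) (@subset_refl _ (H10 w O)) hCe1 TH vH.
rewrite /momentum_skew /viscous_form /skew_form /div_form /buoyancy_form.
rewrite -RintegralD// -RintegralB//; last exact: intgD.
rewrite -RintegralB//; last by apply: intgB => //; exact: intgD.
by apply: eq_Rintegral => x _; rewrite /skewf; ring.
Qed.

(** The supremum says nothing when |r| = 0, because the quotient is then 0;
there the mere continuity of H gives H r = 0. *)
Lemma dual_norm_le v (H : sobfun R n -> R) (Phi : R) : H10_dual v O H ->
  (H10_dual_norm v O H <= Phi%:E)%E -> forall r, H10 v O r -> `|H r| <= Phi * H10norm v O r.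
Proof.
move=> [_ [C HC]] HPhi r rH; have [r0|r0] := eqVneq (H10norm v O r) 0.
  by rewrite r0 mulr0; have := HC r rH; rewrite r0 mulr0.
have rpos : 0 < H10norm v O r by rewrite lt_def r0 sqrtr_ge0.
rewrite -ler_pdivrMr// -lee_fin; apply: le_trans HPhi.
by apply: ereal_sup_ubound; exists r.
Qed.

End Assembly.

Theorem theorem4p4 (R : realType) (d : nat) (hd : d = 2%N \/ d = 3%N)
  (Omega : set 'rV[R]_d) (hOmega : lipschitz_polytope Omega)
  (w : 'rV[R]_d -> R) (hw : admissible_weight Omega w)
  (g : 'rV[R]_d) (hg : g <> 0)
  (nu : R -> R) (num nup : R) (hnu : coefficient nu num nup)
  (kappa : R -> R) (kapm kapp : R) (hkappa : coefficient kappa kapm kapp)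
  (W : R -> set (sobfun R d)) (X : R -> set (vsobfun R d))
  (M : R -> set ('rV[R]_d -> R^o))
  (hW : forall h : R, 0 < h ->
    [/\ fin_dim (W h), W h `<=` H10 w Omega & W h `<=` H10 (winv w) Omega])
  (hXM : forall h : R, 0 < h -> flow_spaces Omega (X h) (M h))
  (hWdense : dense_as_h_to_0 (H10 w Omega) (H10norm w Omega) W /\
    dense_as_h_to_0 (H10 (winv w) Omega) (H10norm (winv w) Omega) W)
  (hXdense : dense_as_h_to_0 (vH10 Omega) (vH10norm Omega) X)
  (hMdense : dense_as_h_to_0 (L20 Omega) (L2norm (cst 1) Omega) M)
  (beta : R) (hbeta : 0 < beta)
  (hXMstable : forall h : R, 0 < h -> div_inf_sup Omega beta (X h) (M h))
  (gam : R) (hgam : 0 < gam)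
  (hWstable : forall h : R, 0 < h ->
    grad_inf_sup Omega w (winv w) gam (W h) /\
    grad_inf_sup Omega (winv w) w gam (W h))
  (piW : R -> sobfun R d -> sobfun R d)
  (hpiW : stable_interpolation Omega (winv w) W piW)
  (Ce1 Ce2 Lam0 CP : R)
  (hCe1 : buoyancy_const Omega w Ce1) (hCe2 : advection_const Omega w Ce2)
  (hLam0 : diffusion_threshold Omega w Lam0)
  (hCP : NS_uniqueness_const Omega CP)
  (hLam1 : Num.max Lam0 (1 - gam * (1 - 1 / (2 * kapp))) <= kapm / kapp)
  (H : sobfun R d -> R) (hH : Hm1 w Omega H)
  (hHsmall : (Hm1norm w Omega H <=
    (gam * heat_radius num g Ce1 CP gam Ce2 / 4)%:E)%E) :
  forall h : R, 0 < h ->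
  exists (u : vsobfun R d) (p : 'rV[R]_d -> R^o) (T : sobfun R d),
    [/\ X h u /\ M h p /\ W h T,
      discrete_NS_solution Omega nu g T (X h) (M h) u p,
      forall r, W h r ->
        (\int[lebesgue_row R d]_(x in Omega)
           (kappa (sobval T x) * dotr (sobgrad T x) (sobgrad r x)
            - sobval T x * dotr (vsobval u x) (sobgrad r x)))%R = H r &
      vH10norm Omega u <= flow_radius gam Ce2 /\
      H10norm w Omega T <= heat_radius num g Ce1 CP gam Ce2].
Proof.
have [oO bO _ _] := hOmega; have [[ww _] [wi _] _ _] := hw.
move=> h h0; have [fW Ww Wi] := hW h h0; have [fX fM XH ML] := hXM h h0.
have [stab _] := hWstable h h0; have [CP0 _] := hCP.
have Lam : 1 - gam * (1 - 1 / (2 * kapp)) <= kapm / kapp.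
  by apply: le_trans hLam1; rewrite le_max lexx orbT.
have [k [q [Mq Mspan]]] := fin_dim_comb fM.
have lq j : linear_on (X h) (div_form Omega (q j)).
  by apply: div_linear => //; exact: ML.
(* the discretely divergence free fields *)
pose V := joint_kernel (X h) (fun j => div_form Omega (q j)).
have fV : fin_dim V by exact: joint_kernel_fin_dim.
have VX : V `<=` X h by move=> v [].
have lH : linear_on (W h) H by move=> a r s /Wi Wr /Wi Ws; exact: hH.1.
have Hle r (Wr : W h r) := dual_norm_le hH hHsmall (Wi r Wr).
have [u [T [Vu WT ur Tr [mom heat]]]] := galerkin_solution oO bO hd ww wi hg hnu hkappa XH fX VX fV
  Ww Wi fW hCe1 hCe2 hgam stab CP0 Lam lH Hle.
have Xu := VX u Vu; have sX := fin_dim_subspace fX.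
have mk (c : R -> R) cm cp : coefficient c cm cp -> measurable_fun Omega (fun y => c (sobval T y)).
  move=> hc; apply: (measurableT_comp (continuous_measurable_fun (coefficient_continuous hc))).
  by have [] := H10_measurable (Ww T WT).
have kK (c : R -> R) cm cp : coefficient c cm cp ->
    forall y, Omega y -> `|c (sobval T y)| <= cp.
  by move=> hc y _; exact: coefficient_norm_le hc.
(* the momentum residual, which the pressure has to balance *)
pose res v := viscous_form Omega (fun y => nu (sobval T y)) u v + skew_form Omega u u v
  - buoyancy_form Omega g T v.
have lres : linear_on (X h) res.
  move=> a y z Xy Xz; rewrite /res !(viscous_formC _ _ u).
  rewrite (viscous_linear oO XH (mk _ _ _ hnu) (kK _ _ _ hnu) Xu a Xy Xz).
  rewrite (skew_linear3 oO bO hd XH Xu Xu a Xy Xz).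
  by rewrite (buoyancy_linear2 oO g XH Ww hCe1 WT a Xy Xz); ring.
have [|p resE] := multipliers fX lq lres.
  by move=> v Vv; rewrite /res mom// subrr.
have sM := fin_dim_subspace fM.
have Mp : M h (comb q (\row_j p j)) by exact: subspace_comb.
have divE (c : 'rV[R]_k) v : X h v ->
    div_form Omega (comb q c) v = \sum_j c 0 j * div_form Omega (q j) v.
  by move=> Xv; apply: (linear_on_comb sM c (div_linearl oO XH ML Xv) Mq).
exists u, (comb q (\row_j p j)), T; split => //; last 1 first.
- move=> r Wr; rewrite -heat// /heat_form RintegralB//.
  + exact: open_measurable_row.
  + have [_ _ /(_ 0)[lo hi]] := hkappa.
    apply: (diffusion_intg oO ww wi Ww Wi (mk _ _ _ hkappa) _ (kK _ _ _ hkappa)) => //.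
    by apply: (le_trans _ hi); apply: (le_trans _ lo); apply: ltW; have [] := hkappa.
  + exact: (advection_intg XH Ww Wi hCe2).
- split => //.
  + move=> v Xv; rewrite (momentum_skewE oO bO hd g hnu hCe1 (XH _ Xu) (XH _ Xv) (Ww _ WT) (ML _ Mp)).
    rewrite divE//.
    have := resE v Xv; rewrite /res => e.
    rewrite addrAC e; apply/eqP; rewrite subr_eq0; apply/eqP.
    by apply: eq_bigr => j _; rewrite mxE.
  + move=> q' /Mspan[c ->]; have := divE c u Xu; rewrite /div_form => ->.
    by rewrite big1// => j _; have [_ /(_ j)] := Vu; rewrite /div_form => ->; rewrite mulr0.
Qed.
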